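(* Let $X$ be a stationary scroll of dimension $n$ and Gauss dimension $g$ with $g(g+1)\le n$. Then $X$ is an inflated cone or an inflated tangent scroll.
   Context: Everything is over $\mathbb C$. A (parametric) scroll $X/B$ in $\mathbb P^N$ is a $\mathbb P^k$-bundle $X\to B$ with $B$ irreducible, together with a generically finite morphism $f:X\to\mathbb P^N$ restricting to a linear isomorphism of a general fibre $X_b$ with a linear $\mathbb P^k\subset\mathbb P^N$ ($k=0$ is allowed). Fibres are identified with their images, and the viewpoint is local over $B$. For general $x\in X$, $\tilde T_xX\subset\mathbb P^N$ is the unique linear subspace through $f(x)$ with tangent space $df_x(T_xX)$. $X/B$ is stationary if, for general $b\in B$ and general $x\in X_b$, $\tilde T_xX$ depends only on $b$. The Gauss dimension $g$ is the dimension of the image of the Gauss map $x\mapsto\tilde T_xX$; the general fibre of the Gauss map of $f(X)$ is an open subset of a linear space $\mathbb P^{n-g}$. Inflation. Given a scroll $X_0=\bigcup_{b\in B}\mathbb P^k_b$ and, for each $b\in B$, an inclusion $\mathbb P^k_b\subset\mathbb P^\ell_b$ of linear subspaces of $\mathbb P^N$ (varying algebraically with $b$, i.e. a lifting of the classifying map of $X_0$ to the flag variety of pairs $\mathbb P^k\subset\mathbb P^\ell$ in $\mathbb P^N$), the scroll $X=\bigcup_{b\in B}\mathbb P^\ell_b$ is called an inflation of $X_0$. An inflated cone is an inflation of a cone (a scroll whose rulings all contain a common point; it may consist of just a point). An inflated tangent scroll is an inflation of the tangent scroll $\{\tilde T_pS\}$ (family of embedded tangent spaces) of a positive-dimensional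 variety $S$.
   Formalization: The conclusion is for X ruled by its Gauss fibres P^{n-g} (the given ruling if k=n-g); for smaller k the given ruling can fail, e.g. P^1 ruled by points. In an inflated tangent scroll, the tangent spaces of S are indexed by B via a dominant rational map from B to S. *)

(* Defs.v *)
(* MathComp world: algebraic geometry over a field by means of multivariate
   polynomials. Points of affine m-space are row vectors 'rV[K]_m; a subvariety
   of P^N is handled through its affine cone in 'rV[K]_N.+1. *)
From HB Require Import structures.
From mathcomp Require Import all_boot all_order all_algebra.
From mathcomp Require Import reals.
From mathcomp.real_closed Require Import complex.
From mathcomp.multinomials Require Import mpoly.

Set Implicit Arguments.
Unset Strict Implicit.
Unset Printing Implicit Defensive.

Import GRing.Theory.
Local Open Scope ring_scope.

Section AffineVarieties.
Variables (K : fieldType) (m : nat).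
Implicit Types (A Z : 'rV[K]_m -> Prop) (x v : 'rV[K]_m).

Definition vanishes_on A (p : {mpoly K[m]}) : Prop :=
  forall x, A x -> p.@[x 0] = 0.

Definition zclosed A : Prop :=
  exists I : {mpoly K[m]} -> Prop,
    forall x, A x <-> (forall p, I p -> p.@[x 0] = 0).

Definition zclosure A x : Prop := forall p, vanishes_on A p -> p.@[x 0] = 0.

Definition zirreducible A : Prop :=
  (exists x, A x) /\
  forall Z1 Z2, zclosed Z1 -> zclosed Z2 -> (forall x, A x -> Z1 x \/ Z2 x) ->
    (forall x, A x -> Z1 x) \/ (forall x, A x -> Z2 x).

(* "P holds at a general point of A", for A irreducible: P holds on a nonempty
   principal open subset of A. *)
Definition generic A (P : 'rV[K]_m -> Prop) : Prop :=
  exists2 h : {mpoly K[m]}, ~ vanishes_on A h &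
    forall x, A x -> h.@[x 0] != 0 -> P x.

Definition alg_indep_on A d (t : d.-tuple {mpoly K[m]}) : Prop :=
  forall Q : {mpoly K[d]}, vanishes_on A (Q \mPo t) -> Q = 0.

(* The transcendence degree of the ring of polynomial functions on A, that is
   the dimension of the (irreducible) closure of A. *)
Definition has_dim A d : Prop :=
  (exists t : d.-tuple {mpoly K[m]}, alg_indep_on A t) /\
  ~ (exists t : d.+1.-tuple {mpoly K[m]}, alg_indep_on A t).

Definition zariski_tangent A x v : Prop :=
  forall p, vanishes_on A p -> \sum_(i < m) v 0 i * (mderiv i p).@[x 0] = 0.

Definition row_basis r (T : 'M[K]_(r, m)) (V : 'rV[K]_m -> Prop) : Prop :=
  row_free T /\ forall v, V v <-> (v <= T)%MS.

Definition smooth_at A x : Prop :=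
  exists d (T : 'M[K]_(d, m)), has_dim A d /\ row_basis T (zariski_tangent A x).

Definition is_cone_set A : Prop := forall (c : K) x, A x -> A (c *: x).

Record variety := Variety {
  points :> 'rV[K]_m -> Prop;
  points_closed : zclosed points;
  points_irreducible : zirreducible points }.

End AffineVarieties.

Section Scrolls.
Variables (K : fieldType) (N : nat).

(* A family of linear P^rdim's in P^N varying algebraically with b in B (a
   classifying map from B to a Grassmannian): the ruling over b is the row space
   of the frame evaluated at b. Everything being local over B, the base is affine
   and the classifying map only needs to be defined at a general point. *)
Record family m (B : variety K m) := Family {
  rdim : nat;
  frame : 'M[{mpoly K[m]}]_(rdim.+1, N.+1);
  frame_free : generic B (fun b => row_free (map_mx (meval (b 0)) frame)) }.

Section Family.
Variables (m : nat) (B : variety K m) (X : family B).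
Local Notation k1 := (rdim X).+1.
Implicit Types (b v : 'rV[K]_m) (s : 'rV[K]_k1) (w : 'rV[K]_N.+1).

Definition ruling b : 'M[K]_(k1, N.+1) := map_mx (meval (b 0)) (frame X).

(* Derivative of the frame at b along v. *)
Definition dframe b v : 'M[K]_(k1, N.+1) :=
  \sum_(i < m) v 0 i *: map_mx (meval (b 0)) (map_mx (mderiv i) (frame X)).

(* The cone B x K^(rdim + 1) over the projective bundle X = B x P^rdim; the
   morphism f : X -> P^N is (b, [s]) |-> [s *m ruling b]. *)
Definition total (z : 'rV[K]_(m + k1)) : Prop := B (lsubmx z).

Definition image_cone w : Prop :=
  exists b s, [/\ B b, row_free (ruling b) & w = s *m ruling b].

(* The fibre of f through a general point (b, [s]) is finite. As f is injective
   on the fibres of X -> B, it suffices to bound the possible b'. *)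
Definition generically_finite : Prop :=
  generic total (fun z =>
    exists L : seq 'rV[K]_m, forall b' (s' : 'rV[K]_k1),
      B b' -> row_free (ruling b') -> s' != 0 ->
      (exists2 c : K, c != 0 &
         s' *m ruling b' = c *: (rsubmx z *m ruling (lsubmx z))) ->
      b' \in L).

(* The image of the differential of (b, s) |-> s *m ruling b, i.e. the affine cone
   over the embedded tangent space to X at (b, [s]). *)
Definition embedded_tangent b s w : Prop :=
  exists v (t : 'rV[K]_k1),
    zariski_tangent B b v /\ w = t *m ruling b + s *m dframe b v.

Definition stationary : Prop :=
  generic B (fun b =>
    exists T : 'rV[K]_N.+1 -> Prop,
      generic (fun _ : 'rV[K]_k1 => True)
        (fun s => forall w, embedded_tangent b s w <-> T w)).

Definition scroll_dim n : Prop := has_dim total n.+1.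

End Family.

(* Pluecker coordinates, indexed redundantly by all maps rather than by the
   increasing ones. *)
Definition pluecker n (W : 'M[K]_(n, N.+1)) : 'rV[K]_#|{ffun 'I_n -> 'I_N.+1}| :=
  \row_j \det (colsub (enum_val j : {ffun 'I_n -> 'I_N.+1}) W).

(* The affine cone over the image of the Gauss map X ---> G(n, P^N) in Pluecker
   space, the Gauss map being taken on the locus where the base is smooth and f is
   an immersion. All bases W of a tangent space occur, whence all scalings. *)
Definition gauss_cone m (B : variety K m) (X : family B) n
    (y : 'rV[K]_#|{ffun 'I_n.+1 -> 'I_N.+1}|) : Prop :=
  exists b (s : 'rV[K]_(rdim X).+1) (W : 'M[K]_(n.+1, N.+1)),
    [/\ B b, smooth_at B b, row_basis W (embedded_tangent b s)
      & y = pluecker W].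

Definition gauss_dim m (B : variety K m) (X : family B) g : Prop :=
  exists n, scroll_dim X n /\ has_dim (@gauss_cone m B X n) g.+1.

Definition inflation m (B : variety K m) (X0 X : family B) : Prop :=
  generic B (fun b => (ruling X0 b <= ruling X b)%MS).

Definition cone_family m (B : variety K m) (X0 : family B) : Prop :=
  exists2 p : 'rV[K]_N.+1, p != 0 & generic B (fun b => (p <= ruling X0 b)%MS).

(* S is (the affine cone over) a positive-dimensional subvariety of P^N and
   b |-> [p b] is a dominant rational map from B to S, along which the family of
   embedded tangent spaces of S is regarded as a family over B. The embedded
   tangent space of S at a point is the projectivised Zariski tangent space of the
   affine cone. *)
Definition tangent_family m (B : variety K m) (X0 : family B) : Prop :=
  exists (S : variety K N.+1) (e : nat) (p : 'rV[{mpoly K[m]}]_N.+1),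
    let pt b := map_mx (meval (b 0)) p in
    [/\ is_cone_set S,
        has_dim S e.+1 /\ (0 < e)%N,
        forall x, S x <->
          zclosure (fun y => exists (c : K) b, B b /\ y = c *: pt b) x
      & generic B (fun b => forall w : 'rV[K]_N.+1,
          (w <= ruling X0 b)%MS <-> zariski_tangent S (pt b) w)].

Definition inflated_cone m (B : variety K m) (X : family B) : Prop :=
  exists2 X0 : family B, cone_family X0 & inflation X0 X.

Definition inflated_tangent_scroll m (B : variety K m) (X : family B) : Prop :=
  exists2 X0 : family B, tangent_family X0 & inflation X0 X.

Record scroll := Scroll {
  amb : nat;
  base : variety K amb;
  scroll_family :> family base;
  scroll_finite : generically_finite scroll_family }.

(* X' is the variety X ruled by the fibres of its Gauss map: the same subvariety of
   P^N, with rulings P^(n-g) along which the tangent space is constant. *)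
Definition gauss_ruling (X : scroll) (n g : nat) (X' : scroll) : Prop :=
  [/\ forall w, zclosure (image_cone X) w <-> zclosure (image_cone X') w,
      stationary X'
    & (rdim X' + g = n)%N].

End Scrolls.

(* Main.v *)
(* Let [M] be the frame of a stationary scroll over a base [B] of dimension [g], of
   rulings [L_b], and [T_b] the constant tangent space along [L_b]. Differentiation
   of [M] is a linear map from [L] to [Hom(T_b B, T / L)], a space of dimension at
   most [g ^ 2], so it has a kernel when [g ^ 2 < dim L]. A section [p] of the kernel
   satisfies [dp] in [L]: either [p] is constant and the rulings pass through a common
   point, or [L_b] contains the tangent space at [p b] of the image of [p].
   In general the ruling by the fibres of the Gauss map has to be built first. At the
   generic point [x] let [G] be the reduced frame of the tangent space and [x = u G].
   Then [u D(G) = 0] for all derivations [D] of the function field, and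
   [D(u) D'(G) = D'(u) D(G)]; hence the [a] with [a D(G) = 0] for all [D] form a
   space of dimension [n + 1 - g], which is defined over the function field of the
   Gauss image and contains [u].
   Dimensions and tangent spaces are computed at generic points, as ranks of matrices
   [(D_i xi_j)] for a basis [D_i] of the derivations of a function field. *)
From HB Require Import structures.
From mathcomp Require Import all_boot all_order all_algebra.
From mathcomp Require Import perm boolp reals ring zify.
From mathcomp.real_closed Require Import complex.
From mathcomp.multinomials Require Import mpoly.
Require Import Defs.

Set Implicit Arguments.
Unset Strict Implicit.
Unset Printing Implicit Defensive.

Import GRing.Theory Num.Theory.
Local Open Scope ring_scope.

(** * Derivations *)

(** The bound on [g] has a direct origin: a ruling of dimension [n - g] has [n - g + 1] homogeneous
    coordinates, and [g (g + 1) <= n] says exactly that this number exceeds [g ^ 2]. The count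
    [n + 1 - g] comes from the symmetry of the second fundamental form: multiplication by the
    invertible matrix [(D_i u_j)] carries the derivations that kill [G] to the vectors killed by all
    [D(G)]. There are [n + 1] independent derivations, and [g] is the rank of their action on the
    entries of [G]. The main obstacle is that the Gauss cone contains the tangent spaces at all
    smooth points where the map is an immersion, whereas ranks over a function field only control
    general points. A tangent frame at an arbitrary smooth point is therefore extended to a
    polynomial frame, which makes its Plücker vector a specialization of a multiple of the generic
    one. Algebraic closedness turns an element killed by all derivations into a constant of the
    ground field, so that a section of constant direction is an actual point of projective space. *)

Section PrimeQuotient.
Variables (R : comNzRingType) (I : R -> Prop).
Hypotheses (I1 : ~ I 1)
  (IB : forall a u v, I u -> I v -> I (a * u + v))
  (I0 : I 0)
  (Iprime : forall u v, I (u * v) -> I u \/ I v).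

Let ideal : {pred R} := fun r => `[< I r >].

Let ideal_closed : idealr_closed ideal.
Proof.
split; first by apply/asboolP.
  by apply/asboolP.
by move=> a u v /asboolP Iu /asboolP Iv; apply/asboolP/IB.
Qed.

Let ideal_prime : prime_idealr_closed ideal.
Proof.
by move=> u v /asboolP /Iprime [] H; apply/orP; [left|right]; apply/asboolP.
Qed.

HB.instance Definition _ := isIdealr.Build R ideal ideal_closed.
HB.instance Definition _ := isPrimeIdealrClosed.Build R ideal ideal_prime.

Local Definition prime_quot := {ideal_quot ideal}.
HB.instance Definition _ := GRing.ComNzRing.on prime_quot.

(** The fraction field is formed over an integral domain with a partial inverse, which classical
    choice supplies here. *)
Let unitq : {pred prime_quot} := fun x => `[< exists y, y * x = 1 >].
Let invq (x : prime_quot) : prime_quot :=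
  if pselect (exists y, y * x = 1) is left e then projT1 (cid e) else x.

Let mulVq : {in unitq, left_inverse 1 invq *%R}.
Proof.
move=> x /asboolP e; rewrite /invq; case: pselect => // e'.
exact: (projT2 (cid e')).
Qed.
Let unitqP (x y : prime_quot) : y * x = 1 -> unitq x.
Proof. by move=> e; apply/asboolP; exists y. Qed.
Let invq_out : {in [predC unitq], invq =1 id}.
Proof.
by move=> x /asboolPn e; rewrite /invq; case: pselect.
Qed.

HB.instance Definition _ := GRing.ComNzRing_hasMulInverse.Build prime_quot
  mulVq unitqP invq_out.

Let quot_domain (x y : prime_quot) : x * y = 0 -> (x == 0) || (y == 0).
Proof. exact: Quotient.rquot_IdomainAxiom. Qed.
HB.instance Definition _ :=
  GRing.ComUnitRing_isIntegral.Build prime_quot quot_domain.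

Lemma prime_ideal_fraction_field :
  exists (F : fieldType) (f : {rmorphism R -> F}),
    (forall r, f r = 0 <-> I r) /\
    (forall x, exists p q, f q != 0 /\ x = f p / f q).
Proof.
have pi_eq0 (r : R) : (\pi_(prime_quot) r == 0)%qT <-> I r.
  have -> : 0 = \pi_(prime_quot)%qT 0 :> prime_quot by rewrite piE.
  by rewrite piE Quotient.equivE subr0; split=> /asboolP.
pose f : {rmorphism R -> {fraction prime_quot}} :=
  (@FracField.tofrac prime_quot \o \pi_(prime_quot)%qT)%FUN.
exists {fraction prime_quot}, f; split=> [r|x].
  rewrite -pi_eq0; split=> [/eqP|/eqP r0]; first by rewrite /f /= tofrac_eq0.
  by apply/eqP; rewrite /f /= tofrac_eq0; apply/eqP.
exists (repr \n_(repr x)), (repr \d_(repr x)); rewrite /f /= !reprK tofrac_eq0.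
split; first exact: denom_ratioP.
apply: (canRL (mulfK _)); first by rewrite tofrac_eq0 denom_ratioP.
rewrite -[x in LHS]reprK; set r := repr x.
unlock FracField.tofrac; rewrite -[LHS]FracField.pi_mul; apply/eqmodP => /=.
rewrite FracField.equivfE /FracField.mulf /= !numden_Ratio ?mulr1 ?oner_neq0 //.
  by rewrite /r reprK mulrC.
all: by case: (r).
Qed.
End PrimeQuotient.

Lemma mpoly_ring_ind (R : comNzRingType) n (P : {mpoly R[n]} -> Prop) :
  (forall c, P c%:MP) -> (forall i, P 'X_i) ->
  (forall p q, P p -> P q -> P (p + q)) ->
  (forall p q, P p -> P q -> P (p * q)) -> forall p, P p.
Proof.
move=> PC PX PD PM; elim/mpolyind; first by rewrite -mpolyC0.
move=> c mm p _ _ Pp; apply: (PD) => //; rewrite -mul_mpolyC; apply: (PM) => //.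
rewrite mpolyXE_id; elim/big_rec: _ => [|i x _ Px]; first by rewrite -mpolyC1.
apply: (PM) => //; elim: (mm i) => [|k IH]; first by rewrite expr0 -mpolyC1.
by rewrite exprS; apply: PM.
Qed.

Lemma eq_rmorph_mpoly (R : comNzRingType) n (S : comNzRingType)
    (f g : {rmorphism {mpoly R[n]} -> S}) :
  (forall c, f c%:MP = g c%:MP) -> (forall i, f 'X_i = g 'X_i) -> f =1 g.
Proof.
move=> fgC fgX; elim/mpoly_ring_ind => // p q fp fq.
  by rewrite !rmorphD fp fq.
by rewrite !rmorphM fp fq.
Qed.

Lemma mmap_mpolyX (R : comNzRingType) n (S : comNzRingType)
    (f : {rmorphism R -> S}) (h : 'I_n -> S) i : mmap f h 'X_i = h i.
Proof. by rewrite mmapX mmap1U. Qed.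

Lemma mderivXU (R : comNzRingType) n (i j : 'I_n) :
  mderiv i 'X_j = (i == j)%:R :> {mpoly R[n]}.
Proof.
rewrite mderivX mnm1E eq_sym; case: eqP => [->|_]; last by rewrite scale0r.
by rewrite -[X in (X - _)%MM]add0m addmK mpolyX0 scale1r.
Qed.

(** [S] is an [A]-module through [ev]: an evaluation gives tangent vectors at a point, the identity
    gives derivations of a field. *)
Definition derivation_over (A S : comNzRingType) (ev d : A -> S) :=
  (forall a b, d (a + b) = d a + d b) /\
  (forall a b, d (a * b) = d a * ev b + ev a * d b).

Section DerivationOver.
Variables (A S : comNzRingType) (ev : {rmorphism A -> S}) (d : A -> S).
Hypothesis derd : derivation_over ev d.

Lemma derivation_over0 : d 0 = 0.
Proof. by apply: (addrI (d 0)); rewrite -(proj1 derd) !addr0. Qed.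

Lemma derivation_over1 : d 1 = 0.
Proof.
apply: (addrI (d 1)); rewrite addr0.
by have /esym := proj2 derd 1 1; rewrite !mulr1 rmorph1 mulr1 mul1r.
Qed.

Lemma derivation_overN a : d (- a) = - d a.
Proof. by apply/eqP; rewrite -addr_eq0 -(proj1 derd) addNr derivation_over0. Qed.

Lemma derivation_overB a b : d (a - b) = d a - d b.
Proof. by rewrite (proj1 derd) derivation_overN. Qed.

Lemma derivation_over_sum I (r : seq I) (P : pred I) (F : I -> A) :
  d (\sum_(i <- r | P i) F i) = \sum_(i <- r | P i) d (F i).
Proof. exact: (big_morph d (proj1 derd) derivation_over0). Qed.

Lemma derivation_over_prod0 I (r : seq I) (P : pred I) (F : I -> A) :
  (forall i, P i -> d (F i) = 0) -> d (\prod_(i <- r | P i) F i) = 0.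
Proof.
move=> F0; elim/big_rec: _ => [|i x Pi dx0]; first exact: derivation_over1.
by rewrite (proj2 derd) F0 // dx0 mul0r mulr0 addr0.
Qed.

End DerivationOver.

Lemma mpoly_chain (R : comNzRingType) n (S : comNzRingType)
    (ev : {rmorphism {mpoly R[n]} -> S}) (d : {mpoly R[n]} -> S) :
  derivation_over ev d -> (forall c, d c%:MP = 0) ->
  forall p, d p = \sum_(i < n) d 'X_i * ev (mderiv i p).
Proof.
move=> derd dC; elim/mpoly_ring_ind => [c|i|p q IHp IHq|p q IHp IHq].
- by rewrite dC big1 // => i _; rewrite mderivC rmorph0 mulr0.
- rewrite (bigD1 i) //= mderivXU eqxx rmorph1 mulr1 big1 ?addr0 // => j ji.
  by rewrite mderivXU (negbTE ji) rmorph0 mulr0.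
- rewrite (proj1 derd) IHp IHq -big_split; apply: eq_bigr => i _ /=.
  by rewrite mderivD rmorphD mulrDr.
rewrite (proj2 derd) IHp IHq mulr_suml mulr_sumr -big_split.
apply: eq_bigr => i _ /=; rewrite mderivM rmorphD !rmorphM mulrDr.
by rewrite -!mulrA (mulrCA _ (ev p)).
Qed.

(** * Extension of derivations in characteristic 0 *)

Section ExtendDerivation.
Variables (A : comNzRingType) (F : fieldType) (ev : {rmorphism A -> F}) (d : A -> F).
Hypotheses (charF : forall k, k.+1%:R != 0 :> F) (derd : derivation_over ev d)
  (kerd : forall a, ev a = 0 -> d a = 0).
Variable x : F.

Let evx : {rmorphism {poly A} -> F} := (horner_eval x \o map_poly ev)%FUN.
(** The extension of [d] to [{poly A}] with value [c] at ['X]. *)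
Let dx c (p : {poly A}) := (map_poly d p).[x] + c * ((map_poly ev p)^`()).[x].

Let coefd p i : (map_poly d p)`_i = d p`_i.
Proof. by rewrite coef_map_id0 // (derivation_over0 derd). Qed.

Let derdx c : derivation_over evx (dx c).
Proof.
split=> p q; rewrite /dx.
  have -> : map_poly d (p + q) = map_poly d p + map_poly d q.
    by apply/polyP => i; rewrite coefD !coefd coefD (proj1 derd).
  by rewrite rmorphD derivD !hornerD mulrDr addrACA.
have -> : map_poly d (p * q) =
    map_poly d p * map_poly ev q + map_poly ev p * map_poly d q.
  apply/polyP => i; rewrite coefD !coefM coefd coefM (derivation_over_sum derd).
  rewrite -big_split; apply: eq_bigr => j _ /=.
  by rewrite (proj2 derd) !coefd !coef_map.
rewrite rmorphM derivM !(hornerD, hornerM) /evx /= /horner_eval.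
ring.
Qed.

Let dxC c a : dx c a%:P = d a.
Proof.
rewrite /dx map_polyC derivC horner0 mulr0 addr0.
rewrite [map_poly d _](_ : _ = (d a)%:P) ?hornerC //; apply/polyP => i.
by rewrite coefd !coefC; case: eqP => // _; rewrite (derivation_over0 derd).
Qed.

(** The relations [ev' p = 0] must be respected. If [x] is transcendental over the image of [ev],
    they leave the value at ['X] free; if it is algebraic, an equation of least degree determines
    this value, being separable in characteristic 0. *)
Lemma extend_derivation1 : exists (ev' : {rmorphism {poly A} -> F}) d',
  [/\ derivation_over ev' d', forall p, ev' p = 0 -> d' p = 0,
     forall a, ev' a%:P = ev a, forall a, d' a%:P = d a & ev' 'X = x].
Proof.
exists evx.
have evxC a : evx a%:P = ev a by rewrite /evx /= /horner_eval map_polyC hornerC.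
have evxX : evx 'X = x by rewrite /evx /= /horner_eval map_polyX hornerX.
case: (pselect (exists q, evx q = 0 /\ map_poly ev q != 0)); last first.
  move=> tr; exists (dx 0); split=> // p /= p0.
  rewrite /dx mul0r addr0; have -> : map_poly d p = 0; last by rewrite horner0.
  apply/polyP => i; rewrite coefd coef0 kerd // -coef_map.
  have [->|nz] := eqVneq (map_poly ev p) 0; first by rewrite coef0.
  by case: tr; exists p.
pose P k := `[< exists q, [/\ evx q = 0, map_poly ev q != 0 & size q = k] >].
case=> q [q0 nzq]; have exP : exists k, P k by exists (size q); apply/asboolP; exists q.
case: (ex_minnP exP) => k /asboolP [f [f0 nzf szf]] fmin.
(* Otherwise the leading term could be dropped, giving an equation of smaller size. *)
have lf0 : ev (lead_coef f) != 0.
  apply/negP => /eqP l0.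
  pose f1 := f - lead_coef f *: 'X^((size f).-1).
  have f1E : map_poly ev f1 = map_poly ev f.
    by rewrite /f1 rmorphB /= map_polyZ /= l0 scale0r subr0.
  have f_gt0 : (0 < size f)%N.
    by rewrite size_poly_gt0; apply: contraNneq nzf => ->; rewrite rmorph0.
  have : (k <= size f1)%N.
    by apply: fmin; apply/asboolP; exists f1; rewrite f1E /evx /= /horner_eval f1E.
  rewrite leqNgt -szf; case/negP; rewrite -(prednK f_gt0) ltnS.
  apply/leq_sizeP => j; rewrite leq_eqVlt => /predU1P[<-|lt_j].
    by rewrite /f1 coefB coefZ coefXn eqxx mulr1 subrr.
  rewrite /f1 coefB coefZ coefXn gtn_eqF // mulr0 subr0 nth_default //.
  by rewrite -(prednK f_gt0).
have small r : evx r = 0 -> (size r < size f)%N -> map_poly ev r = 0.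
  move=> r0; rewrite szf; apply: contraTeq => nzr; rewrite -leqNgt.
  by apply: fmin; apply/asboolP; exists r.
have sz_f : (1 < size f)%N.
  rewrite ltnNge; apply/negP => /size1_polyC fC; move: f0 nzf.
  by rewrite fC evxC map_polyC polyC_eq0 => e /negP[]; apply/eqP.
have szef : size (map_poly ev f) = size f by rewrite size_map_poly_id0.
have df0 : ((map_poly ev f)^`()).[x] != 0.
  apply/negP => /eqP e0; have : evx f^`() = 0.
    by rewrite /evx /= /horner_eval -deriv_map.
  move/small; have lt : (size f^`() < size f)%N.
    by rewrite lt_size_deriv // -size_poly_eq0 -lt0n (ltn_trans _ sz_f).
  move/(_ lt)/polyP/(_ (size f).-2); rewrite coef0 coef_map coef_deriv.
  rewrite prednK; last by rewrite -subn1 subn_gt0.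
  rewrite -lead_coefE raddfMn /= -mulr_natr => /eqP; rewrite mulf_eq0 (negbTE lf0) /=.
  have -> : (size f).-1 = ((size f).-2).+1 by rewrite prednK // -subn1 subn_gt0.
  by rewrite (negbTE (charF _)).
(* The value at ['X] is forced by [dx c f = 0]. *)
pose c := - (map_poly d f).[x] / ((map_poly ev f)^`()).[x].
have dxf : dx c f = 0 by rewrite /dx /c divfK // subrr.
exists (dx c); split=> // p p0.
(* Pseudo-division, as [A] is not a field. The remainder is too small to be an equation, so [ev]
   kills its coefficients, and then so does [d]. *)
have [e [u [r [rE szr]]]] : exists e u r,
    lead_coef f ^+ e *: p = u * f + r /\ (size r < size f)%N.
  exists (Pdiv.Ring.rscalp p f), (Pdiv.Ring.rdivp p f), (Pdiv.Ring.rmodp p f).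
  split; first exact: Pdiv.ComRing.rdivp_eq.
  by apply: Pdiv.Ring.ltn_rmodpN0; rewrite -size_poly_gt0 (ltn_trans _ sz_f).
have r0 : evx r = 0.
  have -> : r = (lead_coef f ^+ e)%:P * p - u * f by rewrite mul_polyC rE addrC addKr.
  by rewrite rmorphB !rmorphM p0 f0 !mulr0 subr0.
have dxr : dx c r = 0.
  have er0 := small r r0 szr; rewrite /dx er0 deriv0 horner0 mulr0 addr0.
  have -> : map_poly d r = 0; last by rewrite horner0.
  by apply/polyP => i; rewrite coefd coef0 kerd // -coef_map er0 coef0.
have : dx c ((lead_coef f ^+ e)%:P * p) = dx c (u * f + r) by rewrite mul_polyC rE.
rewrite (proj1 (derdx c)) !(proj2 (derdx c)) p0 f0 dxf dxr !mulr0 !add0r.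
move=> /eqP; rewrite mulf_eq0 evxC rmorphXn expf_eq0 (negbTE lf0) andbF /=.
by move/eqP.
Qed.
End ExtendDerivation.

(** The subrings of [F] generated by elements of [l] are represented by polynomial rings mapping to
    [F]; a derivation on them makes sense in [F] once it respects the kernel. *)
Lemma extend_derivation (F : fieldType) (charF : forall k, k.+1%:R != 0 :> F)
    (l : seq F) (A : comNzRingType) (ev : {rmorphism A -> F}) (d : A -> F) :
  derivation_over ev d -> (forall a, ev a = 0 -> d a = 0) ->
  exists (A' : comNzRingType) (i : {rmorphism A -> A'})
         (ev' : {rmorphism A' -> F}) (d' : A' -> F),
    [/\ derivation_over ev' d', forall a, ev' a = 0 -> d' a = 0,
       forall a, ev' (i a) = ev a, forall a, d' (i a) = d a
     & forall x, x \in l -> exists a, ev' a = x].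
Proof.
elim: l A ev d => [|x l IH] A ev d derd kerd.
  by exists A, (idfun : {rmorphism A -> A}), ev, d; split.
have [ev1 [d1 [der1 ker1 ev1C d1C ev1X]]] := extend_derivation1 charF derd kerd x.
have [A' [i [ev' [d' [der' ker' ev'i d'i l']]]]] := IH _ _ _ der1 ker1.
exists A', (i \o polyC)%FUN, ev', d'; split=> // [a|a|y].
- by rewrite /= ev'i.
- by rewrite /= d'i.
rewrite inE => /predU1P[->|/l' //]; exists (i 'X); rewrite ev'i //.
Qed.

(** * Function fields and general points *)

Section RankMinors.

Lemma rank_mxsub (F : fieldType) a b a' b' (f : 'I_a' -> 'I_a) (g : 'I_b' -> 'I_b)
  (M : 'M[F]_(a, b)) : (\rank (mxsub f g M) <= \rank M)%N.
Proof.
rewrite mxsubrc (leq_trans (mxrankS (rowsub_sub _ _))) //.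
by rewrite -mxrank_tr trmx_mxsub -[X in (_ <= X)%N]mxrank_tr mxrankS ?rowsub_sub.
Qed.

Lemma row_free_colsub (F : fieldType) r b (M : 'M[F]_(r, b)) : row_free M ->
  exists2 g : 'I_r -> 'I_b, injective g & colsub g M \in unitmx.
Proof.
move=> frM; have fuM : row_full M^T by rewrite /row_full mxrank_tr.
exists (fullrankfun fuM); first exact: fullrankfun_inj.
by rewrite -unitmx_tr trmx_mxsub; exact: fullrowsub_unit.
Qed.

Lemma rank_unit_minor (F : fieldType) a b (M : 'M[F]_(a, b)) :
  exists (f : 'I_(\rank M) -> 'I_a) (g : 'I_(\rank M) -> 'I_b),
    mxsub f g M \in unitmx.
Proof.
have [g _ gU] := row_free_colsub (maxrowsub_free M).
by exists (maxrankfun M), g; rewrite mxsubcr.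
Qed.

(** A minor that survives [f2] survives [f1]. With [f2] an evaluation this is semicontinuity of the
    rank; for maps with equal kernels it makes generic points interchangeable. *)
Lemma rank_map_mx_le (R : comNzRingType) (F1 F2 : fieldType)
    (f1 : {rmorphism R -> F1}) (f2 : {rmorphism R -> F2}) :
  (forall r, f1 r = 0 -> f2 r = 0) -> forall a b (M : 'M[R]_(a, b)),
  (\rank (map_mx f2 M) <= \rank (map_mx f1 M))%N.
Proof.
move=> k12 a b M; have [f [g fgU]] := rank_unit_minor (map_mx f2 M).
suff /mxrank_unit <- : mxsub f g (map_mx f1 M) \in unitmx by exact: rank_mxsub.
move: fgU; rewrite -!map_mxsub !unitmxE !det_map_mx !unitfE.
by apply: contraNneq => /k12 ->.
Qed.

Lemma rank_map_mx_eq (R : comNzRingType) (F1 F2 : fieldType)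
    (f1 : {rmorphism R -> F1}) (f2 : {rmorphism R -> F2}) :
  (forall r, f1 r = 0 <-> f2 r = 0) -> forall a b (M : 'M[R]_(a, b)),
  \rank (map_mx f2 M) = \rank (map_mx f1 M).
Proof.
by move=> k12 a b M; apply/eqP; rewrite eqn_leq !rank_map_mx_le // => r /k12.
Qed.

(** Inclusion is put in terms of ranks so that it can be specialized. *)
Lemma submx_rank_col (F : fieldType) a b c (M : 'M[F]_(a, c)) (M' : 'M[F]_(b, c)) :
  (M <= M')%MS = (\rank (col_mx M M') == \rank M').
Proof.
have sM' : (M' <= col_mx M M')%MS by rewrite -addsmxE addsmxSr.
rewrite eq_sym; apply/idP/idP => [sM|].
  rewrite eqn_leq mxrankS //= mxrankS // -addsmxE addsmx_sub sM.
  exact: submx_refl.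
move=> rk; have : (M' == col_mx M M')%MS by rewrite -(geq_leqif (mxrank_leqif_eq sM')) (eqP rk).
by case/andP => _; rewrite -addsmxE addsmx_sub => /andP[].
Qed.

End RankMinors.

Section Generic.
Variables (K : fieldType) (m : nat).
Implicit Types (A : 'rV[K]_m -> Prop) (p q h : {mpoly K[m]}) (x : 'rV[K]_m).

Lemma vanishes_onD A p q : vanishes_on A p -> vanishes_on A q -> vanishes_on A (p + q).
Proof. by move=> Ap Aq x Ax; rewrite mevalD Ap // Aq // addr0. Qed.

Lemma vanishes_onM A p q : vanishes_on A q -> vanishes_on A (p * q).
Proof. by move=> Aq x Ax; rewrite mevalM Aq // mulr0. Qed.

Lemma vanishes_onC A c : (exists x, A x) -> vanishes_on A c%:MP -> c = 0.
Proof. by case=> x Ax /(_ x Ax); rewrite mevalC. Qed.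

Lemma not_vanishes_on A p : ~ vanishes_on A p -> exists2 x, A x & p.@[x 0] != 0.
Proof.
move=> nv; apply: contrapT => H; apply: nv => x Ax; apply/eqP/negP => /negP px.
by apply: H; exists x.
Qed.

Lemma zirreducible_prime A p q : zirreducible A -> vanishes_on A (p * q) ->
  vanishes_on A p \/ vanishes_on A q.
Proof.
case=> _ irr pq0.
have cl r : zclosed (fun x => r.@[x 0] = 0).
  by exists (eq r) => x; split=> [e _ <- //|]; apply.
have [] := irr _ _ (cl p) (cl q); [|by left|by right].
move=> x /pq0 /eqP; rewrite mevalM mulf_eq0.
by case/orP => /eqP; [left|right].
Qed.

Lemma prime_zirreducible A : (exists x, A x) ->
  (forall p q, vanishes_on A (p * q) -> vanishes_on A p \/ vanishes_on A q) ->
  zirreducible A.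
Proof.
move=> exA prA; split=> // Z1 Z2 [I1 Z1E] [I2 Z2E] cov.
apply: contrapT => /not_orP[n1 n2].
have wit (I : {mpoly K[m]} -> Prop) (Z : 'rV[K]_m -> Prop) :
    (forall x, Z x <-> (forall p, I p -> p.@[x 0] = 0)) ->
    ~ (forall x, A x -> Z x) -> exists2 p, I p & ~ vanishes_on A p.
  move=> ZE nZ; apply: contrapT => H; apply: nZ => x Ax; apply/ZE => p Ip.
  by apply: contrapT => px; apply: H; exists p => // /(_ x Ax).
have [p Ip np] := wit _ _ Z1E n1; have [q Iq nq] := wit _ _ Z2E n2.
have /prA[] // : vanishes_on A (p * q).
move=> x Ax; rewrite mevalM; have [/Z1E->//|/Z2E H] := cov x Ax.
  by rewrite mul0r.
by rewrite (H q Iq) mulr0.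
Qed.

Lemma generic_imp A (P Q : 'rV[K]_m -> Prop) :
  (forall x, A x -> P x -> Q x) -> generic A P -> generic A Q.
Proof. by move=> PQ [h nh hP]; exists h => // x Ax hx; apply: PQ => //; apply: hP. Qed.

Lemma generic_all A (P : 'rV[K]_m -> Prop) : (exists x, A x) ->
  (forall x, A x -> P x) -> generic A P.
Proof.
case=> x Ax AP; exists 1; last by move=> y Ay _; apply: AP.
by move/(_ x Ax)/eqP; rewrite meval1 oner_eq0.
Qed.

Lemma generic_and A (P Q : 'rV[K]_m -> Prop) : zirreducible A ->
  generic A P -> generic A Q -> generic A (fun x => P x /\ Q x).
Proof.
move=> irr [h nh hP] [k nk kQ]; exists (h * k).
  by move=> /(zirreducible_prime irr)[].
by move=> x Ax; rewrite mevalM mulf_eq0 negb_or => /andP[hx kx]; split; auto.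
Qed.

Lemma generic_exists A (P : 'rV[K]_m -> Prop) : generic A P -> exists2 x, A x & P x.
Proof. by case=> h /not_vanishes_on[x Ax hx] hP; exists x => //; apply: hP. Qed.

Lemma zclosure_sub A x : A x -> zclosure A x.
Proof. by move=> Ax p; apply. Qed.

Lemma vanishes_on_zclosure A p : vanishes_on (zclosure A) p <-> vanishes_on A p.
Proof. by split=> [H x /zclosure_sub/H|H x]; [|apply]. Qed.

Lemma zclosure_closed A : zclosed (zclosure A).
Proof. by exists (vanishes_on A). Qed.

Lemma alg_indep_on_sub A d d' : (d' <= d)%N ->
  (exists t : d.-tuple {mpoly K[m]}, alg_indep_on A t) ->
  exists t : d'.-tuple {mpoly K[m]}, alg_indep_on A t.
Proof.
move=> le_d [t ti]; pose w := widen_ord le_d.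
exists [tuple tnth t (w i) | i < d'] => Q QA.
pose X := [tuple 'X_(w i) : {mpoly K[d]} | i < d'].
have : Q \mPo X = 0.
  apply: ti => x Ax; rewrite -(QA x Ax) !comp_mpoly_meval; apply: meval_eq => i.
  by rewrite !tnth_mktuple mevalXU.
(* A left inverse of the inclusion of variables: it kills the surplus ones. *)
have inv : forall Q : {mpoly K[d']}, Q = mmap (@mpolyC d' K)
    (fun j : 'I_d => if insub (val j) is Some i then 'X_i else 0) (Q \mPo X).
  move=> {QA}Q.
  pose f : {rmorphism {mpoly K[d']} -> {mpoly K[d']}} := idfun.
  pose g : {rmorphism {mpoly K[d']} -> {mpoly K[d']}} := (mmap (@mpolyC d' K)
    (fun j : 'I_d => if insub (val j) is Some i then 'X_i else 0) \o comp_mpoly X)%FUN.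
  apply: (@eq_rmorph_mpoly _ _ _ f g) => [c|i] /=.
    by rewrite comp_mpolyC mmapC.
  rewrite comp_mpolyXU -tnth_nth tnth_mktuple mmap_mpolyX.
  by case: i => i lt_i; rewrite insubT.
by move=> Q0; rewrite [LHS]inv Q0 rmorph0.
Qed.

Lemma has_dim_unique A d d' : has_dim A d -> has_dim A d' -> d = d'.
Proof.
move=> [H1 H2] [H1' H2']; apply/eqP; rewrite eqn_leq.
by apply/andP; split; rewrite leqNgt; apply/negP => /alg_indep_on_sub; auto.
Qed.

End Generic.

Section VectorDerivation.
Variables (R : comNzRingType) (F : fieldType) (f : {rmorphism R -> F}) (d : R -> F).
Hypotheses (ffrac : forall x, exists p q, f q != 0 /\ x = f p / f q)
  (derd : derivation_over f d) (kerd : forall r, f r = 0 -> d r = 0).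

Lemma derivation_frac : exists D : F -> F,
  derivation_over (idfun : {rmorphism F -> F}) D /\ forall r, D (f r) = d r.
Proof.
have [num numP] := choice ffrac; have [den denP] := choice numP.
pose D x := (d (num x) - x * d (den x)) / f (den x).
(* Independence of the fraction chosen: [num x * q - p * den x] lies in the kernel of [f], hence in
   that of [d]. *)
have DE x p q : f q != 0 -> x * f q = f p -> D x * f q = d p - x * d q.
  move=> q0 xq; have [dx0 xE] := denP x.
  have nE : f (num x) = x * f (den x) by rewrite {2}xE divfK.
  have : d (num x * q - p * den x) = 0.
    by apply: kerd; rewrite rmorphB !rmorphM /= nE -xq; ring.
  rewrite (derivation_overB derd) !(proj2 derd) nE -xq => e.
  apply: (mulIf dx0); rewrite /D mulrAC divfK //.
  apply/eqP; rewrite -subr_eq0; apply/eqP; rewrite -[RHS]e; ring.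
have fracE x : exists p q, [/\ f q != 0, x * f q = f p & d p = D x * f q + x * d q].
  have [p [q [q0 xE]]] := ffrac x; have e : x * f q = f p by rewrite xE divfK.
  by exists p, q; split => //; rewrite (DE x p q) // subrK.
exists D; split; last first.
  move=> r; have := DE (f r) r 1; rewrite rmorph1 oner_neq0 !mulr1.
  by rewrite (derivation_over1 derd) mulr0 subr0; apply.
split=> x y; have [p [q [q0 xq dp]]] := fracE x;
  have [p' [q' [q'0 yq' dp']]] := fracE y; have qq0 : f (q * q') != 0
    by rewrite rmorphM mulf_neq0.
  apply: (mulIf qq0); rewrite (DE _ (p * q' + p' * q)) //.
    by rewrite (proj1 derd) !(proj2 derd) rmorphM dp dp' -xq -yq'; ring.
  by rewrite rmorphD !rmorphM /= -xq -yq'; ring.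
apply: (mulIf qq0); rewrite (DE _ (p * p')) //.
  by rewrite !(proj2 derd) rmorphM dp dp' -xq -yq' /=; ring.
by rewrite !rmorphM /= -xq -yq'; ring.
Qed.

End VectorDerivation.

Section CommonDenominator.
Variables (R : comNzRingType) (F : fieldType) (f : {rmorphism R -> F}).
Hypothesis ffrac : forall x, exists p q, f q != 0 /\ x = f p / f q.

Lemma common_denominator_seq (l : seq F) :
  exists2 h, f h != 0 & forall x, x \in l -> exists p, f p = f h * x.
Proof.
elim: l => [|y l [h h0 hl]]; first by exists 1; rewrite ?rmorph1 ?oner_neq0.
have [p [q [q0 yE]]] := ffrac y; exists (h * q); first by rewrite rmorphM mulf_neq0.
move=> x; rewrite inE => /predU1P[->|/hl[r rE]].
  by exists (h * p); rewrite !rmorphM /= yE; field.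
by exists (r * q); rewrite !rmorphM /= rE; ring.
Qed.

Lemma common_denominator a b (M : 'M[F]_(a, b)) :
  exists2 h, f h != 0 & exists M' : 'M[R]_(a, b), map_mx f M' = f h *: M.
Proof.
have [h h0 hl] := common_denominator_seq [seq M ij.1 ij.2 | ij : 'I_a * 'I_b].
exists h => //; have hM (ij : 'I_a * 'I_b) : exists p, f p = f h * M ij.1 ij.2.
  by apply: hl; apply/codomP; exists ij.
have [g gE] := choice hM.
by exists (\matrix_(i, j) g (i, j)); apply/matrixP => i j; rewrite !mxE gE.
Qed.

End CommonDenominator.

Definition gradient (R : nzRingType) m (p : {mpoly R[m]}) : 'rV[{mpoly R[m]}]_m :=
  \row_j mderiv j p.

(** A longest independent family of gradients exists because its length is at most [m]; it replaces
    the Jacobian matrix of a set of generators. The map [f] will be the one to the function field or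
    the evaluation at a point. *)
Lemma maximal_gradients (K : fieldType) m (A : 'rV[K]_m -> Prop) (L : fieldType)
    (f : {rmorphism {mpoly K[m]} -> L}) : exists c (J : 'M[{mpoly K[m]}]_(c, m)),
  [/\ row_free (map_mx f J), forall i, exists2 p, vanishes_on A p & row i J = gradient p
    & forall p, vanishes_on A p -> (map_mx f (gradient p) <= map_mx f J)%MS].
Proof.
pose P c := `[< exists J : 'M[{mpoly K[m]}]_(c, m), row_free (map_mx f J) /\
  forall i, exists2 p, vanishes_on A p & row i J = gradient p >].
have exP : exists c, P c.
  exists 0%N; apply/asboolP; exists 0; split; last by case.
  by rewrite /row_free map_mx0 mxrank0.
have leP c : P c -> (c <= m)%N.
  case/asboolP => J [/eqP rkJ _]; rewrite -[c in (c <= _)%N]rkJ; exact: rank_leq_col.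
case: (ex_maxnP exP leP) => c Pc cmax; case/asboolP: Pc => J [Jfree Jgrad].
exists c, J; split=> // p Ap; apply: contrapT => nsub.
suff /cmax : P (c + 1)%N by rewrite addn1 ltnn.
apply/asboolP; exists (col_mx J (gradient p)); split.
  rewrite map_col_mx /row_free eqn_leq rank_leq_row /= [X in (X <= _)%N]addn1.
  rewrite -[X in (X < _)%N](eqP Jfree) ltn_neqAle mxrankS ?andbT; last first.
    by rewrite -addsmxE addsmxSl.
  apply: contra_notN nsub; rewrite submx_rank_col => /eqP ->.
  by rewrite -!addsmxE addsmxC.
move=> i; rewrite -(splitK i); case: (split i) => j /=.
  by rewrite rowKu; apply: Jgrad.
by rewrite rowKd ord1; exists p => //; apply/rowP => k; rewrite !mxE.
Qed.

(* The function field of an irreducible set [A], with a basis [ffder] of its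
   derivations over [K]; [fftan] is the matrix of the values of these derivations
   at the coordinates, and the rows of [ffgrad] are gradients of equations of [A]
   which cut out the tangent space at a general point. *)
Record function_field (K : fieldType) m (A : 'rV[K]_m -> Prop) := FunctionField {
  ff_sort :> fieldType;
  ff : {rmorphism {mpoly K[m]} -> ff_sort};
  ffdim : nat;
  ffcodim : nat;
  fftan : 'M[{mpoly K[m]}]_(ffdim, m);
  ffgrad : 'M[{mpoly K[m]}]_(ffcodim, m);
  ffder : 'I_ffdim -> ff_sort -> ff_sort;
  ff_ker : forall p, ff p = 0 <-> vanishes_on A p;
  ff_frac : forall x, exists p q, ff q != 0 /\ x = ff p / ff q;
  ff_dimE : (ffdim + ffcodim = m)%N;
  fftan_free : row_free (map_mx ff fftan);
  ffgrad_free : row_free (map_mx ff ffgrad);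
  ffgrad_vanishes : forall i, exists2 p, vanishes_on A p & row i ffgrad = gradient p;
  ffder_over : forall i, derivation_over (idfun : {rmorphism ff_sort -> ff_sort}) (ffder i);
  ffder_ff : forall i p, ffder i (ff p) = ff (\sum_j fftan i j * mderiv j p) }.

Lemma vector_derivation (R : comNzRingType) m (F : fieldType)
    (f : {rmorphism {mpoly R[m]} -> F}) (v : 'rV[F]_m) :
  derivation_over f (fun p => \sum_j v 0 j * f (mderiv j p)).
Proof.
split=> p q.
  by rewrite -big_split; apply: eq_bigr => j _; rewrite mderivD rmorphD mulrDr.
rewrite mulr_suml mulr_sumr -big_split; apply: eq_bigr => j _.
by rewrite mderivM rmorphD !rmorphM /=; ring.
Qed.

Section FunctionFieldExists.
Variables (K : fieldType) (m : nat) (A : 'rV[K]_m -> Prop).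

(** A vector orthogonal to the gradients of all equations of [A] respects the ideal of [A], so it
    defines a derivation of the fraction field. The rows of [fftan] form a basis of these vectors,
    cleared of denominators. *)
Lemma function_field_exists : zirreducible A -> inhabited (function_field A).
Proof.
move=> irr; have [exA _] := irr.
have [|a u v Iu Iv||u v|F [f [fker ffrac]]] :=
    @prime_ideal_fraction_field {mpoly K[m]} (vanishes_on A).
- by rewrite -mpolyC1 => /(vanishes_onC exA)/eqP; rewrite oner_eq0.
- by apply: vanishes_onD => //; apply: vanishes_onM.
- by move=> x _; rewrite meval0.
- exact: zirreducible_prime.
have [c [J [Jfree Jgrad Jspan]]] := maximal_gradients A f.
have le_cm : (c <= m)%N by rewrite -[c in (c <= _)%N](eqP Jfree) rank_leq_col.
pose N := row_base (kermx (map_mx f J)^T).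
have rkN : (\rank (kermx (map_mx f J)^T) = m - c)%N.
  by rewrite mxrank_ker mxrank_tr (eqP Jfree).
have [h h0 [V' V'E]] := common_denominator ffrac N.
pose V : 'M_(m - c, m) := castmx (rkN, erefl) V'.
have VE : (map_mx f V :=: kermx (map_mx f J)^T)%MS.
  rewrite /V map_castmx; apply: eqmx_trans (eqmx_cast _ _) _.
  by rewrite V'E; apply: eqmx_trans (eqmx_scale _ h0) (eq_row_base _).
have Vfree : row_free (map_mx f V) by rewrite /row_free VE rkN.
have Vtan i p : vanishes_on A p -> f (\sum_j V i j * mderiv j p) = 0.
  move=> Ap; have /submxP[D DE] := Jspan p Ap.
  have VJ : map_mx f V *m (map_mx f J)^T = 0 by apply/sub_kermxP; rewrite VE.
  have : map_mx f V *m (map_mx f (gradient p))^T = 0.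
    by rewrite DE trmx_mul mulmxA VJ mul0mx.
  move/matrixP/(_ i 0); rewrite !mxE => <-; rewrite rmorph_sum.
  by apply: eq_bigr => j _; rewrite rmorphM !mxE.
have der i : exists D : F -> F, derivation_over (idfun : {rmorphism F -> F}) D /\
    forall p, D (f p) = f (\sum_j V i j * mderiv j p).
  have e p : f (\sum_j V i j * mderiv j p) =
             \sum_j (row i (map_mx f V)) 0 j * f (mderiv j p).
    by rewrite rmorph_sum; apply: eq_bigr => j _; rewrite rmorphM !mxE.
  have [|D [derD DE]] := derivation_frac ffrac (vector_derivation f (row i (map_mx f V))).
    by move=> p /fker /(Vtan i); rewrite e.
  by exists D; split=> // p; rewrite DE e.
have [D DP] := choice der.
by constructor; exists F f (m - c)%N c V J D => // [|i|i p]; rewrite ?subnK //; case: (DP i).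
Qed.

End FunctionFieldExists.

Section MPolyChar0.
Variables (K : numFieldType) (n : nat).

Lemma mderiv_eq0_const (p : {mpoly K[n]}) :
  (forall i, mderiv i p = 0) -> p = (p@_0)%:MP.
Proof.
move=> dp; apply/mpolyP => mm; rewrite mcoeffC.
have [->|nz] := eqVneq mm 0%MM; rewrite ?mulr1 //.
rewrite mulr0.
have [i mi] : exists i, mm i != 0%N.
  apply: contrapT => H; case/eqP: nz; apply/mnmP => i; rewrite mnm0E.
  by apply: contrapT => /eqP mi; apply: H; exists i.
have := congr1 (mcoeff (mm - U_(i))%MM) (dp i); rewrite mcoeff_deriv mcoeff0.
rewrite submK; last by apply/mnm_lepP => j; rewrite mnm1E; case: eqP => // <-; rewrite lt0n.
by move/eqP; rewrite mulrn_eq0 /= => /eqP.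
Qed.

Lemma msize_mderiv i (p : {mpoly K[n]}) : p != 0 -> (msize (mderiv i p) < msize p)%N.
Proof.
move=> p0; have sp : (0 < msize p)%N by rewrite lt0n msize_poly_eq0.
rewrite -(prednK sp) ltnS msizeE; apply/bigmax_leqP_seq => mm mm_in _.
have : (mm + U_(i))%MM \in msupp p.
  move: mm_in; rewrite !mcoeff_msupp mcoeff_deriv.
  by apply: contraNneq => ->; rewrite mul0rn.
by move/msize_mdeg_lt; rewrite mdegD mdeg1 addn1 -[X in (_ < X)%N -> _](prednK sp).
Qed.

(** On lines parallel to the axes [p] has infinitely many roots, so its partial derivatives vanish
    everywhere too. They are zero by induction on the degree, and [p] is a constant. *)
Lemma mpoly_all_zero (p : {mpoly K[n]}) : (forall x : 'I_n -> K, p.@[x] = 0) -> p = 0.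
Proof.
move: {2}(msize p).+1 (ltnSn (msize p)) => N; elim: N p => // N IH p sp p0.
have [//|nz] := eqVneq p 0.
have d0 i : mderiv i p = 0.
  apply: IH; first by rewrite (leq_trans (msize_mderiv i nz)).
  move=> x; pose h (j : 'I_n) : {poly K} := (x j)%:P + (i == j)%:R *: 'X.
  pose ev : {rmorphism {mpoly K[n]} -> {poly K}} := mmap (@polyC K) h.
  have evE q c : (ev q).[c] = q.@[fun j => x j + (i == j)%:R * c].
    pose f1 : {rmorphism {mpoly K[n]} -> K} := (horner_eval c \o ev)%FUN.
    pose f2 : {rmorphism {mpoly K[n]} -> K} := meval (fun j => x j + (i == j)%:R * c).
    apply: (@eq_rmorph_mpoly _ _ _ f1 f2) => [a|j] /=; rewrite /horner_eval /ev.
      by rewrite mmapC hornerC mevalC.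
    by rewrite mmap_mpolyX mevalXU /h !hornerE.
  have ev0 : ev p = 0.
    have rt : forall k : nat, root (ev p) k%:R by move=> k; rewrite /root evE p0.
    apply: (@roots_geq_poly_eq0 _ _ [seq k%:R | k <- iota 0 (size (ev p))]).
    - by apply/allP => y /mapP[k _ ->].
    - rewrite map_inj_uniq ?iota_uniq // => a b /eqP.
      by rewrite eqr_nat => /eqP.
    - by rewrite size_map size_iota.
  have der : derivation_over (horner_eval 0 \o ev)%FUN (fun q => (ev q)^`().[0]).
    split=> a b; first by rewrite rmorphD derivD hornerD.
    by rewrite rmorphM derivM hornerD !hornerM /= /horner_eval.
  have dC c : (ev c%:MP)^`().[0] = 0 by rewrite /ev /= mmapC derivC horner0.
  have := mpoly_chain der dC p; rewrite ev0 deriv0 horner0 (bigD1 i) //= big1 => [|j ji].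
    rewrite addr0 /ev mmap_mpolyX /h eqxx scale1r derivD derivC derivX add0r hornerC mul1r.
    rewrite -/ev /horner_eval evE => e; rewrite [RHS]e; apply: meval_eq => j.
    by rewrite mulr0 addr0.
  rewrite /ev mmap_mpolyX /h eq_sym (negbTE ji) scale0r addr0 derivC horner0.
  by rewrite mul0r.
have e := mderiv_eq0_const d0; have := p0 (fun=> 0).
by rewrite [in X in X -> _]e mevalC => c0; rewrite e c0 mpolyC0.
Qed.
End MPolyChar0.

Section DerivationCalculus.
Variables (K : numFieldType) (m : nat) (A : 'rV[K]_m -> Prop) (F : function_field A).
Local Notation d := (ffdim F).
Implicit Types (x y : F) (b : 'rV[F]_d).

Definition ffC : K -> F := (ff F \o @mpolyC m K)%FUN.
HB.instance Definition _ := GRing.RMorphism.copy ffC (ff F \o @mpolyC m K)%FUN.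

Definition ffeval q (xi : 'rV[F]_q) : {mpoly K[q]} -> F := mmap ffC (xi 0).
HB.instance Definition _ q (xi : 'rV[F]_q) :=
  GRing.RMorphism.copy (ffeval xi) (mmap ffC (xi 0)).

Lemma ffevalC q (xi : 'rV[F]_q) c : ffeval xi c%:MP = ffC c.
Proof. exact: mmapC. Qed.

Lemma ffevalX q (xi : 'rV[F]_q) j : ffeval xi 'X_j = xi 0 j.
Proof. exact: mmap_mpolyX. Qed.

Definition jac q (xi : 'rV[F]_q) : 'M[F]_(d, q) := \matrix_(i, j) ffder i (xi 0 j).

Definition is_derivation (D : F -> F) :=
  derivation_over (idfun : {rmorphism F -> F}) D /\ forall c, D (ffC c) = 0.

Lemma ff_charE k : k.+1%:R != 0 :> F.
Proof. by rewrite -(rmorph_nat ffC) fmorph_eq0 pnatr_eq0. Qed.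

Lemma ffder_is_derivation i : is_derivation (@ffder _ _ _ F i).
Proof.
split=> [|c]; first exact: ffder_over.
by rewrite /ffC /= ffder_ff big1 ?rmorph0 // => j _; rewrite mderivC mulr0.
Qed.

Lemma comb_is_derivation b : is_derivation (fun x => \sum_i b 0 i * ffder i x).
Proof.
split=> [|c]; last first.
  by rewrite big1 // => i _; rewrite (proj2 (ffder_is_derivation i)) mulr0.
split=> x y.
  rewrite -big_split; apply: eq_bigr => i _.
  by rewrite (proj1 (proj1 (ffder_is_derivation i))) mulrDr.
rewrite mulr_suml mulr_sumr -big_split; apply: eq_bigr => i _.
by rewrite (proj2 (proj1 (ffder_is_derivation i))) /=; ring.
Qed.

Lemma derivation_ffeval D : is_derivation D -> forall q (xi : 'rV[F]_q) p,
  D (ffeval xi p) = \sum_j D (xi 0 j) * ffeval xi (mderiv j p).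
Proof.
move=> [[DD DM] DC] q xi p.
have der : derivation_over (ffeval xi) (fun p => D (ffeval xi p)).
  by split=> a a'; rewrite ?rmorphD ?rmorphM ?DD ?DM.
rewrite (mpoly_chain der) => [|c]; last by rewrite ffevalC DC.
by apply: eq_bigr => j _; rewrite ffevalX.
Qed.

Lemma ffX_eval p : ff F p = ffeval (\row_j ff F 'X_j) p.
Proof.
apply: eq_rmorph_mpoly => [c|i] /=; first by rewrite ffevalC.
by rewrite ffevalX mxE.
Qed.

Lemma derivation_div D : is_derivation D -> forall p q, ff F q != 0 ->
  D (ff F p / ff F q) = (D (ff F p) - ff F p / ff F q * D (ff F q)) / ff F q.
Proof.
move=> [[DD DM] _] p q q0; apply: (mulIf q0); rewrite divfK //.
by have := DM (ff F p / ff F q) (ff F q); rewrite divfK //= => ->; rewrite addrK.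
Qed.

Lemma eq_derivation D D' : is_derivation D -> is_derivation D' ->
  (forall j, D (ff F 'X_j) = D' (ff F 'X_j)) -> D =1 D'.
Proof.
move=> derD derD' DD'.
have e p : D (ff F p) = D' (ff F p).
  rewrite ffX_eval !derivation_ffeval //; apply: eq_bigr => j _.
  by rewrite !mxE DD'.
move=> x; have [p [q [q0 ->]]] := ff_frac x.
by rewrite !derivation_div // !e.
Qed.

Lemma ffder_X i j : ffder i (ff F 'X_j) = ff F (fftan F i j).
Proof.
rewrite ffder_ff; congr (ff F _); rewrite (bigD1 j) //= big1 => [|k kj].
  by rewrite addr0 mderivXU eqxx mulr1.
by rewrite mderivXU (negbTE kj) mulr0.
Qed.

Lemma fftan_grad : map_mx (ff F) (fftan F) *m (map_mx (ff F) (ffgrad F))^T = 0.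
Proof.
apply/matrixP => i k; rewrite !mxE; have [p Ap /rowP gp] := ffgrad_vanishes k.
transitivity (ffder i (ff F p)); last first.
  by rewrite (proj2 (ff_ker F p) Ap) (derivation_over0 (ffder_over i)).
rewrite ffder_ff rmorph_sum; apply: eq_bigr => j _; rewrite rmorphM !mxE.
by have := gp j; rewrite !mxE => ->.
Qed.

Lemma fftan_ker : (map_mx (ff F) (fftan F) :=: kermx (map_mx (ff F) (ffgrad F))^T)%MS.
Proof.
apply/eqmxP; rewrite -(geq_leqif (mxrank_leqif_eq _)); last by apply/sub_kermxP/fftan_grad.
by rewrite mxrank_ker mxrank_tr (eqP (ffgrad_free F)) (eqP (fftan_free F)) -{1}(ff_dimE F) addnK.
Qed.

(** The values of [D] at the coordinates determine it and form a vector orthogonal to all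
    gradients. *)
Lemma derivation_span D : is_derivation D ->
  exists b, forall x, D x = \sum_i b 0 i * ffder i x.
Proof.
move=> derD; pose v : 'rV[F]_m := \row_j D (ff F 'X_j).
have : (v <= map_mx (ff F) (fftan F))%MS.
  rewrite fftan_ker; apply/sub_kermxP/matrixP => k l; rewrite ord1 !mxE.
  have [p Ap /rowP gp] := ffgrad_vanishes l.
  transitivity (D (ff F p)); last first.
    by rewrite (proj2 (ff_ker F p) Ap) (derivation_over0 (proj1 derD)).
  rewrite [in RHS]ffX_eval derivation_ffeval //; apply: eq_bigr => j _.
  by have := gp j; rewrite !mxE => ->; rewrite -ffX_eval.
case/submxP => b vE; exists b; apply: eq_derivation => //.
  exact: comb_is_derivation.
move=> j; have /rowP/(_ j) := vE; rewrite !mxE => ->; apply: eq_bigr => i _.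
by rewrite mxE ffder_X.
Qed.

Lemma jac_comb b q (xi : 'rV[F]_q) :
  b *m jac xi = \row_j \sum_i b 0 i * ffder i (xi 0 j).
Proof. by apply/rowP => j; rewrite !mxE; apply: eq_bigr => i _; rewrite mxE. Qed.

Lemma jac_ffeval q r (xi : 'rV[F]_q) (phi : 'rV[{mpoly K[q]}]_r) :
  jac (map_mx (ffeval xi) phi) =
  jac xi *m \matrix_(j, k) ffeval xi (mderiv j (phi 0 k)).
Proof.
apply/matrixP => i k; rewrite !mxE derivation_ffeval; last exact: ffder_is_derivation.
by apply: eq_bigr => j _; rewrite !mxE.
Qed.

(* In characteristic 0 a derivation of [K(xi)] with values in [F] extends to [F]. *)
Lemma tangent_jac q (xi w : 'rV[F]_q) :
  (forall p, ffeval xi p = 0 -> \sum_j w 0 j * ffeval xi (mderiv j p) = 0) ->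
  (w <= jac xi)%MS.
Proof.
move=> wtan; have derw := vector_derivation (ffeval xi) w.
have [R [i [ev [D [derD kerD evi Di surj]]]]] :=
  extend_derivation ff_charE [seq ff F 'X_j | j : 'I_m] derw wtan.
have exX (j : 'I_m) : exists a, ev a = ff F 'X_j by apply: surj; apply/codomP; exists j.
have [X evX] := choice exX.
pose sub : {rmorphism {mpoly K[m]} -> R} := mmap (i \o @mpolyC q K) X.
have evsub p : ev (sub p) = ff F p.
  pose g : {rmorphism {mpoly K[m]} -> F} := (ev \o sub)%FUN.
  apply: (@eq_rmorph_mpoly _ _ _ g (ff F)) => [c|j] /=; rewrite /sub.
    by rewrite mmapC /= evi /= ffevalC.
  by rewrite mmap_mpolyX evX.
have dersub : derivation_over (ff F) (fun p => D (sub p)).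
  by split=> a a'; rewrite ?rmorphD ?rmorphM ?(proj1 derD) ?(proj2 derD) ?evsub.
have kersub p : ff F p = 0 -> D (sub p) = 0 by move=> p0; apply: kerD; rewrite evsub.
have [E [derE EE]] := derivation_frac (@ff_frac _ _ _ F) dersub kersub.
have DC c : D (i c%:MP) = 0.
  by rewrite Di big1 // => j _; rewrite mderivC rmorph0 mulr0.
have derE' : is_derivation E.
  by split=> // c; rewrite /ffC /= EE; transitivity (D (i c%:MP)); [congr D; exact: mmapC|].
have [b bE] := derivation_span derE'.
apply/submxP; exists b; rewrite jac_comb; apply/rowP => j; rewrite mxE -bE.
(* The relation [p' * xi_j = p] holds in [F], hence [D] respects it; this compares [E (xi_j)] with
   the prescribed value [w_j]. *)
have [p [p' [p'0 xiE]]] := ff_frac (xi 0 j).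
have : D (sub p' * i 'X_j - sub p) = 0.
  apply: kerD; rewrite rmorphB rmorphM /= evi /= !evsub ffevalX xiE.
  by rewrite mulrC divfK // subrr.
rewrite (derivation_overB derD) (proj2 derD) evsub evi /= ffevalX.
have -> : D (i 'X_j) = w 0 j.
  rewrite Di (bigD1 j) //= big1 => [|k kj].
    by rewrite addr0 mderivXU eqxx rmorph1 mulr1.
  by rewrite mderivXU (negbTE kj) rmorph0 mulr0.
rewrite -!EE => /eqP; rewrite subr_eq0 => /eqP e.
apply: (mulfI p'0); rewrite {1}xiE derivation_div // -xiE mulrCA mulfV // mulr1 -e.
by rewrite /=; ring.
Qed.

(** Jacobian criterion. Full rank provides derivations dual to the coordinates, so that the partial
    derivatives of a relation are relations of lower degree. Conversely, in the absence of relations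
    every vector is tangent. *)
Lemma jac_full_indep q (xi : 'rV[F]_q) :
  \rank (jac xi) = q <-> (forall Q, ffeval xi Q = 0 -> Q = 0).
Proof.
split=> [rk Q|indep]; last first.
  apply/eqP; rewrite eqn_leq rank_leq_col /= -{1}(mxrank1 F q) mxrankS //.
  apply/row_subP => j; apply: tangent_jac => p /indep ->.
  by rewrite big1 // => k _; rewrite mderiv0 rmorph0 mulr0.
move: {2}(msize Q).+1 (ltnSn (msize Q)) => N; elim: N Q => // N IH Q sQ Q0.
have [//|nz] := eqVneq Q 0.
have d0 i : mderiv i Q = 0.
  apply: IH; first by rewrite (leq_trans (msize_mderiv i nz)).
  have full : row_full (jac xi) by rewrite /row_full rk.
  have /submxP[b be] := submx_full (delta_mx 0 i : 'rV_q) full.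
  have bE j : \sum_k b 0 k * ffder k (xi 0 j) = (j == i)%:R.
    by move/rowP/(_ j): be; rewrite jac_comb !mxE eqxx.
  have derb := comb_is_derivation b.
  have : 0 = \sum_j (j == i)%:R * ffeval xi (mderiv j Q).
    have := derivation_ffeval derb xi Q.
    rewrite Q0 (derivation_over0 (proj1 derb)) => e; rewrite [LHS]e.
    by apply: eq_bigr => j _; rewrite bE.
  rewrite (bigD1 i) //= eqxx mul1r big1 ?addr0 => [<- //|j /negbTE ->].
  by rewrite mul0r.
move: Q0; rewrite (mderiv_eq0_const d0) ffevalC => /eqP.
by rewrite fmorph_eq0 => /eqP ->; rewrite mpolyC0.
Qed.

End DerivationCalculus.

Notation "M ^@ x" := (map_mx (meval (fun_of_matrix x 0%R)) M) (at level 8, x at level 8).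

(** * Passing between the generic point and general points *)

Section Specialization.
Variables (K : numFieldType) (m : nat) (A : 'rV[K]_m -> Prop) (F : function_field A).
Hypothesis irr : zirreducible A.
Implicit Types (x : 'rV[K]_m).

Lemma ff_neq0 p : ff F p != 0 <-> ~ vanishes_on A p.
Proof. by rewrite -(ff_ker F); split=> [/eqP //|H]; apply/eqP. Qed.

Lemma generic_ff p (P : 'rV[K]_m -> Prop) : ff F p != 0 ->
  (forall x, A x -> p.@[x 0] != 0 -> P x) -> generic A P.
Proof. by move=> /ff_neq0 np H; exists p. Qed.

Lemma rank_spec_le a b (M : 'M[{mpoly K[m]}]_(a, b)) x : A x ->
  (\rank (M^@x) <= \rank (map_mx (ff F) M))%N.
Proof. by move=> Ax; apply: rank_map_mx_le => p /ff_ker; apply. Qed.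

Lemma rank_spec a b (M : 'M[{mpoly K[m]}]_(a, b)) :
  generic A (fun x => \rank (M^@x) = \rank (map_mx (ff F) M)).
Proof.
have [f [g]] := rank_unit_minor (map_mx (ff F) M).
rewrite -map_mxsub unitmxE unitfE det_map_mx => /generic_ff; apply=> x Ax dx.
apply/eqP; rewrite eqn_leq rank_spec_le //=.
have /mxrank_unit <- : mxsub f g (M^@x) \in unitmx; last exact: rank_mxsub.
by rewrite -map_mxsub unitmxE unitfE det_map_mx.
Qed.

Lemma generic_rank_eq a b (M : 'M[{mpoly K[m]}]_(a, b)) r :
  generic A (fun x => \rank (M^@x) = r) -> \rank (map_mx (ff F) M) = r.
Proof.
by move=> /(generic_and irr (rank_spec M)) /generic_exists[x _ [-> ->]].
Qed.

Lemma rank_at_le a b (M : 'M[{mpoly K[m]}]_(a, b)) r :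
  generic A (fun x => (\rank (M^@x) <= r)%N) -> (\rank (map_mx (ff F) M) <= r)%N.
Proof.
by move=> /(generic_and irr (rank_spec M)) /generic_exists[x _ [-> ->]].
Qed.

Lemma submx_spec a b c (M : 'M[{mpoly K[m]}]_(a, c)) (M' : 'M_(b, c)) :
  (map_mx (ff F) M <= map_mx (ff F) M')%MS -> generic A (fun x => (M^@x <= M'^@x)%MS).
Proof.
rewrite submx_rank_col -map_col_mx => /eqP rk.
apply: generic_imp (generic_and irr (rank_spec M') (rank_spec (col_mx M M'))).
by move=> x Ax [r1 r2]; rewrite submx_rank_col -map_col_mx r1 r2 rk.
Qed.

Lemma generic_submx a b c (M : 'M[{mpoly K[m]}]_(a, c)) (M' : 'M_(b, c)) :
  generic A (fun x => (M^@x <= M'^@x)%MS) -> (map_mx (ff F) M <= map_mx (ff F) M')%MS.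
Proof.
move=> gen; rewrite submx_rank_col -map_col_mx; apply/eqP.
apply: generic_rank_eq; apply: generic_imp (generic_and irr gen (rank_spec M')).
by move=> x Ax []; rewrite submx_rank_col -map_col_mx => /eqP -> ->.
Qed.

Lemma map_mx_ff_eq0 a b (M : 'M[{mpoly K[m]}]_(a, b)) x :
  map_mx (ff F) M = 0 -> A x -> M^@x = 0.
Proof.
move=> /matrixP M0 Ax; apply/matrixP => i j; have := M0 i j.
by rewrite !mxE => /ff_ker; apply.
Qed.

Lemma fftan_tangent i x : A x -> zariski_tangent A x (row i (fftan F)^@x).
Proof.
move=> Ax p Ap; have : vanishes_on A (\sum_j fftan F i j * mderiv j p).
  apply/(ff_ker F); rewrite -ffder_ff (proj2 (ff_ker F p) Ap).
  exact: derivation_over0 (ffder_over i).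
move=> /(_ x Ax); rewrite rmorph_sum => e; rewrite -[RHS]e.
by apply: eq_bigr => j _; rewrite rmorphM !mxE.
Qed.

Lemma zariski_tangent_sub k (T : 'M[K]_(k, m)) x v :
  (forall i, zariski_tangent A x (row i T)) -> (v <= T)%MS -> zariski_tangent A x v.
Proof.
move=> Ttan /submxP[c ->] p Ap.
transitivity (\sum_i c 0 i * \sum_j (row i T) 0 j * (mderiv j p).@[x 0]).
  under [RHS]eq_bigr do rewrite mulr_sumr.
  rewrite exchange_big; apply: eq_bigr => j _; rewrite mxE mulr_suml.
  by apply: eq_bigr => i _; rewrite mxE mulrA.
by rewrite big1 // => i _; rewrite Ttan // mulr0.
Qed.

Lemma zariski_tangent_grad x v : zariski_tangent A x v -> v *m ((ffgrad F)^@x)^T = 0.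
Proof.
move=> vtan; apply/rowP => i; rewrite !mxE.
have [p Ap /rowP gp] := ffgrad_vanishes i; rewrite -[RHS](vtan p Ap).
by apply: eq_bigr => j _; have := gp j; rewrite !mxE => ->.
Qed.

(** At every point of [A] the rows of [fftan] bound the tangent space from below and [ffgrad] bounds
    it from above; where both have full rank the bounds coincide. *)
Lemma generic_tangent :
  generic A (fun x => row_basis ((fftan F)^@x) (zariski_tangent A x)).
Proof.
apply: generic_imp (generic_and irr (rank_spec (fftan F)) (rank_spec (ffgrad F))).
move=> x Ax []; rewrite (eqP (fftan_free F)) (eqP (ffgrad_free F)) => r1 r2.
have sub v : (v <= (fftan F)^@x)%MS -> zariski_tangent A x v.
  by apply: zariski_tangent_sub => i; apply: fftan_tangent.
split; first by rewrite /row_free r1.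
move=> v; split=> [vtan|]; last exact: sub.
have : (v <= kermx ((ffgrad F)^@x)^T)%MS by apply/sub_kermxP/zariski_tangent_grad.
suff /eqmxP -> : ((fftan F)^@x == kermx ((ffgrad F)^@x)^T)%MS by [].
rewrite -(geq_leqif (mxrank_leqif_eq _)).
  by rewrite mxrank_ker mxrank_tr r1 r2 -{1}(ff_dimE F) addnK.
apply/row_subP => i; apply/sub_kermxP/zariski_tangent_grad.
exact: fftan_tangent.
Qed.

(** A generic point in the sense of Weil: its coordinates lie in the function field of [A], which
    may be larger than that of [Z]. *)
Definition generic_point q (Z : 'rV[K]_q -> Prop) (xi : 'rV[F]_q) :=
  forall p, vanishes_on Z p <-> ffeval xi p = 0.

Lemma ffeval_comp q r (xi : 'rV[F]_q) (phi : 'rV[{mpoly K[q]}]_r) p :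
  ffeval (map_mx (ffeval xi) phi) p = ffeval xi (mmap (@mpolyC q K) (phi 0) p).
Proof.
pose g : {rmorphism {mpoly K[r]} -> F} := (ffeval xi \o mmap (@mpolyC q K) (phi 0))%FUN.
apply: (@eq_rmorph_mpoly _ _ _ (ffeval (map_mx (ffeval xi) phi)) g) => [c|j] /=.
  by rewrite mmapC !ffevalC.
by rewrite mmap_mpolyX ffevalX mxE.
Qed.

Lemma generic_point_irr q (Z : 'rV[K]_q -> Prop) xi : generic_point Z xi -> zirreducible Z.
Proof.
move=> ZE; apply: prime_zirreducible.
  apply: contrapT => H; have /ZE : vanishes_on Z 1 by move=> x Zx; case: H; exists x.
  by move/eqP; rewrite rmorph1 oner_eq0.
move=> p q' /ZE/eqP; rewrite rmorphM mulf_eq0.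
by case/orP => /eqP /ZE; [left|right].
Qed.

(** The columns of an invertible minor of [jac xi] are independent coordinates. No larger
    independent family exists, as the Jacobian of polynomials in [xi] factors through [jac xi]. *)
Lemma has_dim_generic_point q (Z : 'rV[K]_q -> Prop) xi : generic_point Z xi ->
  has_dim Z (\rank (jac xi)).
Proof.
have tup r (t : r.-tuple {mpoly K[q]}) Q :
    ffeval xi (Q \mPo t) = ffeval (map_mx (ffeval xi) (\row_k tnth t k)) Q.
  rewrite ffeval_comp; congr (ffeval xi _); apply: eq_bigr => mm _; congr (_ * _).
  by apply: mmap1_eq => k; rewrite mxE.
move=> ZE; split.
  have [f [g]] := rank_unit_minor (jac xi); rewrite mxsubrc => U.
  exists [tuple 'X_(g k) | k < \rank (jac xi)] => Q /ZE; rewrite tup.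
  move: Q; apply/jac_full_indep; apply/eqP; rewrite eqn_leq rank_leq_col /=.
  rewrite -[X in (X <= _)%N](mxrank_unit U) mxrankS //.
  rewrite [X in (_ <= X)%MS](_ : _ = colsub g (jac xi)) ?rowsub_sub //.
  by apply/matrixP => i k; rewrite !mxE tnth_mktuple ffevalX.
case=> t ti; have : \rank (jac (map_mx (ffeval xi) (\row_k tnth t k))) = (\rank (jac xi)).+1.
  apply/jac_full_indep => Q; rewrite -tup => /ZE; exact: ti.
rewrite jac_ffeval => e; have := mxrankM_maxl (jac xi) (\matrix_(j, k) ffeval xi (mderiv j ((\row_k tnth t k) 0 k))).
by rewrite e ltnn.
Qed.

Lemma ffX_generic_point : generic_point A (\row_j ff F 'X_j).
Proof. by move=> p; rewrite -ffX_eval ff_ker. Qed.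

Lemma jac_ffX : jac (\row_j ff F 'X_j) = map_mx (ff F) (fftan F).
Proof. by apply/matrixP => i j; rewrite !mxE ffder_X. Qed.

Lemma has_dim_ff : has_dim A (ffdim F).
Proof.
by have := has_dim_generic_point ffX_generic_point; rewrite jac_ffX (eqP (fftan_free F)).
Qed.

Lemma ffeval_poly q (phi : 'rV[{mpoly K[m]}]_q) p :
  ffeval (map_mx (ff F) phi) p = ff F (mmap (@mpolyC m K) (phi 0) p).
Proof.
rewrite [RHS]ffX_eval -ffeval_comp; congr (ffeval _ p).
by apply/rowP => j; rewrite !mxE -ffX_eval.
Qed.

Lemma meval_comp q (phi : 'rV[{mpoly K[m]}]_q) p x :
  (mmap (@mpolyC m K) (phi 0) p).@[x 0] = p.@[(phi^@x) 0].
Proof.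
pose g : {rmorphism {mpoly K[q]} -> K} := (meval (x 0) \o mmap (@mpolyC m K) (phi 0))%FUN.
apply: (@eq_rmorph_mpoly _ _ _ g (meval ((phi^@x) 0))) => [c|j] /=.
  by rewrite mmapC !mevalC.
by rewrite mmap_mpolyX mevalXU mxE.
Qed.

Lemma ffeval_poly_eq0 q (phi : 'rV[{mpoly K[m]}]_q) p :
  ffeval (map_mx (ff F) phi) p = 0 <-> forall x, A x -> p.@[(phi^@x) 0] = 0.
Proof.
rewrite ffeval_poly ff_ker.
by split=> H x Ax; have := H x Ax; rewrite meval_comp.
Qed.

(** [P] is [p (phi / h)] cleared of denominators; the exponent depends on [p]. *)
Lemma ffeval_frac q (xi : 'rV[F]_q) h (phi : 'rV[{mpoly K[m]}]_q) :
  ff F h != 0 -> map_mx (ff F) phi = ff F h *: xi -> forall p,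
  exists k P, ff F P = ff F h ^+ k * ffeval xi p /\
    forall x, h.@[x 0] != 0 -> P.@[x 0] = h.@[x 0] ^+ k * p.@[((h.@[x 0])^-1 *: phi^@x) 0].
Proof.
move=> h0 phiE; elim/mpoly_ring_ind => [c|j|p p' [k [P [PE PxE]]] [k' [P' [PE' PxE']]]|
  p p' [k [P [PE PxE]]] [k' [P' [PE' PxE']]]].
- exists 0%N, c%:MP; rewrite expr0 mul1r ffevalC; split=> // x _.
  by rewrite expr0 !mevalC mul1r.
- exists 1%N, (phi 0 j); rewrite expr1 ffevalX; split.
    by have /rowP/(_ j) := phiE; rewrite !mxE.
  by move=> x hx; rewrite expr1 mevalXU !mxE mulVKf.
- exists (k + k')%N, (P * h ^+ k' + P' * h ^+ k).
  split=> [|x hx]; first by rewrite !(rmorphD, rmorphM, rmorphXn) /= PE PE' exprD; ring.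
  by rewrite !(rmorphD, rmorphM, rmorphXn) /= PxE // PxE' // exprD; ring.
exists (k + k')%N, (P * P'); split=> [|x hx].
  by rewrite !rmorphM PE PE' exprD; ring.
by rewrite !rmorphM /= PxE // PxE' // exprD; ring.
Qed.

Lemma ffeval_spec q (xi : 'rV[F]_q) h (phi : 'rV[{mpoly K[m]}]_q) :
  ff F h != 0 -> map_mx (ff F) phi = ff F h *: xi -> forall p,
  ffeval xi p = 0 <->
  forall x, A x -> h.@[x 0] != 0 -> p.@[((h.@[x 0])^-1 *: phi^@x) 0] = 0.
Proof.
move=> h0 phiE p; have [k [P [PE PxE]]] := ffeval_frac h0 phiE p; split=> [p0 x Ax hx|H].
  move: PE; rewrite p0 mulr0 => /ff_ker/(_ x Ax)/eqP.
  by rewrite PxE // mulf_eq0 expf_eq0 (negbTE hx) andbF /= => /eqP.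
(* The factor [h] takes care of the points where [h] vanishes. *)
have : ff F (P * h) = 0.
  apply/ff_ker => x Ax; rewrite mevalM; have [->|hx] := eqVneq h.@[x 0] 0.
    by rewrite mulr0.
  by rewrite PxE // H // mulr0 mul0r.
move/eqP; rewrite rmorphM PE !mulf_eq0 expf_eq0 (negbTE h0) andbF /= orbF.
by move/eqP.
Qed.

End Specialization.

(** Both row spaces lie in the kernel of the gradients of [Z] and have the dimension of [Z]. *)
Lemma generic_point_tangent (K : numFieldType) m (A : 'rV[K]_m -> Prop)
    (F : function_field A) q (Z : 'rV[K]_q -> Prop) (FZ : function_field Z)
    (xi : 'rV[F]_q) :
  generic_point Z xi -> (map_mx (ffeval xi) (fftan FZ) :=: jac xi)%MS.
Proof.
move=> ZE.
have kerE p : ff FZ p = 0 <-> ffeval xi p = 0 by rewrite ff_ker.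
have rkE a b (M : 'M_(a, b)) : \rank (map_mx (ffeval xi) M) = \rank (map_mx (ff FZ) M).
  exact: rank_map_mx_eq.
set W := kermx (map_mx (ffeval xi) (ffgrad FZ))^T.
have rkW : \rank W = ffdim FZ.
  by rewrite mxrank_ker mxrank_tr rkE (eqP (ffgrad_free FZ)) -{1}(ff_dimE FZ) addnK.
have eqW a (M : 'M_(a, q)) : (M <= W)%MS -> \rank M = ffdim FZ -> (M :=: W)%MS.
  by move=> sMW rM; apply/eqmxP; rewrite -(geq_leqif (mxrank_leqif_eq sMW)) rkW rM.
apply: eqmx_trans (eqW _ _ _ _) (eqmx_sym (eqW _ _ _ _)).
- apply/sub_kermxP/matrixP => i k; have /matrixP/(_ i k) := fftan_grad FZ.
  rewrite !mxE => e.
  have : ff FZ (\sum_j fftan FZ i j * ffgrad FZ k j) = 0.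
    by rewrite rmorph_sum -[RHS]e; apply: eq_bigr => j _; rewrite rmorphM !mxE.
  move/kerE => e'; rewrite -[RHS]e' rmorph_sum.
  by apply: eq_bigr => j _; rewrite rmorphM !mxE.
- by rewrite rkE (eqP (fftan_free FZ)).
- apply/sub_kermxP/matrixP => i k; rewrite !mxE.
  have [p Zp /rowP gp] := ffgrad_vanishes k.
  have := derivation_ffeval (ffder_is_derivation i) xi p.
  rewrite (proj1 (ZE p) Zp) (derivation_over0 (ffder_over i)) => e; rewrite [RHS]e.
  by apply: eq_bigr => j _; have := gp j; rewrite !mxE => ->.
exact: has_dim_unique (has_dim_generic_point ZE) (has_dim_ff FZ).
Qed.

(** * Polynomial maps, products and smooth points *)

Section PolynomialMaps.
Variables (K : numFieldType) (m q : nat) (phi : 'rV[{mpoly K[m]}]_q).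
Implicit Types (x v : 'rV[K]_m) (p : {mpoly K[q]}).

Definition poly_comp : {mpoly K[q]} -> {mpoly K[m]} := mmap (@mpolyC m K) (phi 0).
HB.instance Definition _ := GRing.RMorphism.copy poly_comp (mmap (@mpolyC m K) (phi 0)).

Definition jacobian : 'M[{mpoly K[m]}]_(m, q) := \matrix_(i, j) mderiv i (phi 0 j).

Lemma poly_compE p x : (poly_comp p).@[x 0] = p.@[(phi^@x) 0].
Proof. exact: meval_comp. Qed.

Lemma poly_compC c : poly_comp c%:MP = c%:MP.
Proof. exact: mmapC. Qed.

Lemma poly_compX j : poly_comp 'X_j = phi 0 j.
Proof. exact: mmap_mpolyX. Qed.

Lemma meval_chain p x v :
  \sum_i v 0 i * (mderiv i (poly_comp p)).@[x 0] =
  \sum_j (v *m jacobian^@x) 0 j * (mderiv j p).@[(phi^@x) 0].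
Proof.
pose ev : {rmorphism {mpoly K[q]} -> K} := (meval (x 0) \o poly_comp)%FUN.
pose d p := \sum_i v 0 i * (mderiv i (poly_comp p)).@[x 0].
have derv := vector_derivation (meval (x 0)) v.
have derd : derivation_over ev d.
  by split=> a b; rewrite /d ?rmorphD ?rmorphM (proj1 derv, proj2 derv).
rewrite -/(d p) (mpoly_chain derd) => [|c].
  apply: eq_bigr => j _; rewrite /ev /= poly_compE; congr (_ * _).
  by rewrite !mxE; apply: eq_bigr => i _; rewrite !mxE poly_compX.
by rewrite /d poly_compC big1 // => i _; rewrite mderivC meval0 mulr0.
Qed.

Lemma tangent_push (A : 'rV[K]_m -> Prop) (B : 'rV[K]_q -> Prop) x v :
  (forall y, A y -> B (phi^@y)) -> zariski_tangent A x v ->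
  zariski_tangent B (phi^@x) (v *m jacobian^@x).
Proof.
move=> AB vtan p Bp; rewrite -meval_chain; apply: vtan => y Ay.
by rewrite poly_compE; apply/Bp/AB.
Qed.

End PolynomialMaps.

Section ZariskiTangent.
Variables (K : numFieldType) (m : nat) (A : 'rV[K]_m -> Prop).

Lemma zariski_tangentD x v w :
  zariski_tangent A x v -> zariski_tangent A x w -> zariski_tangent A x (v + w).
Proof.
move=> vt wt p Ap; under eq_bigr do rewrite mxE mulrDl.
by rewrite big_split /= vt // wt // addr0.
Qed.

Lemma zariski_tangent_full x v : zariski_tangent (fun _ : 'rV[K]_m => True) x v.
Proof.
move=> p p0; have -> : p = 0.
  apply: mpoly_all_zero => y; rewrite -[RHS](p0 (\row_j y j) I).
  by apply: meval_eq => j; rewrite mxE.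
by rewrite big1 // => i _; rewrite mderiv0 meval0 mulr0.
Qed.

End ZariskiTangent.

Lemma jacobianX (R : numFieldType) n : jacobian (\row_j 'X_j : 'rV[{mpoly R[n]}]_n) = 1%:M.
Proof.
by apply/matrixP => i j; rewrite !mxE mderivXU.
Qed.

Lemma spec_rowX (R : numFieldType) n (x : 'rV[R]_n) : (\row_j 'X_j : 'rV[{mpoly R[n]}]_n)^@x = x.
Proof. by apply/rowP => j; rewrite !mxE mevalXU. Qed.

Lemma spec_const (R : numFieldType) n a b (M : 'M[R]_(a, b)) (x : 'rV[R]_n) :
  (map_mx (@mpolyC n R) M)^@x = M.
Proof. by apply/matrixP => i j; rewrite !mxE mevalC. Qed.

Lemma jacobian_const (R : numFieldType) n k (w : 'rV[R]_k) :
  jacobian (map_mx (@mpolyC n R) w) = 0.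
Proof. by apply/matrixP => i j; rewrite !mxE mderivC. Qed.

Lemma jacobian_row_mx (R : numFieldType) n a b (f : 'rV[{mpoly R[n]}]_a) (g : 'rV_b) :
  jacobian (row_mx f g) = row_mx (jacobian f) (jacobian g).
Proof.
apply/matrixP => i j; rewrite -(splitK j); case: (split j) => k /=.
  by rewrite row_mxEl [LHS]mxE [RHS]mxE row_mxEl.
by rewrite row_mxEr [LHS]mxE [RHS]mxE row_mxEr.
Qed.

(** * Products with an affine space *)

Definition prod_affine (K : fieldType) m (A : 'rV[K]_m -> Prop) k (z : 'rV[K]_(m + k)) :=
  A (lsubmx z).

Section ProdAffine.
Variables (K : numFieldType) (m : nat) (A : 'rV[K]_m -> Prop) (k : nat).
Implicit Types (b : 'rV[K]_m) (s : 'rV[K]_k).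

Let inl_s s : 'rV[{mpoly K[m]}]_(m + k) := row_mx (\row_j 'X_j) (map_mx (@mpolyC m K) s).
Let inr_b b : 'rV[{mpoly K[k]}]_(m + k) := row_mx (map_mx (@mpolyC k K) b) (\row_j 'X_j).

Definition left_coords : 'rV[{mpoly K[m + k]}]_m := \row_j 'X_(lshift k j).
Definition right_coords : 'rV[{mpoly K[m + k]}]_k := \row_j 'X_(rshift m j).

Lemma spec_left z : left_coords^@z = lsubmx z.
Proof. by apply/rowP => j; rewrite !mxE mevalXU. Qed.

Lemma spec_right z : right_coords^@z = rsubmx z.
Proof. by apply/rowP => j; rewrite !mxE mevalXU. Qed.

Lemma row_coords : row_mx left_coords right_coords = \row_j 'X_j.
Proof.
by apply/rowP => j; rewrite -(splitK j); case: (split j) => i /=;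
  rewrite ?row_mxEl ?row_mxEr !mxE.
Qed.

Lemma jacobian_coords : row_mx (jacobian left_coords) (jacobian right_coords) = 1%:M.
Proof. by rewrite -jacobian_row_mx row_coords jacobianX. Qed.

Let spec_inl b s : (inl_s s)^@b = row_mx b s.
Proof. by rewrite map_row_mx spec_rowX spec_const. Qed.

Let spec_inr b s : (inr_b b)^@s = row_mx b s.
Proof. by rewrite map_row_mx spec_rowX spec_const. Qed.

(** Slices: if neither factor vanishes on the product, irreducibility of [A] gives one [b] over
    which neither vanishes on the fibre, and the fibre is an affine space. *)
Lemma prod_affine_irr : zirreducible A -> zirreducible (@prod_affine K m A k).
Proof.
move=> irr; apply: prime_zirreducible.
  by case: irr => -[b Ab] _; exists (row_mx b 0); rewrite /prod_affine row_mxKl.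
move=> p q pq0; apply: contrapT => /not_orP[/not_vanishes_on[z1 A1 p1] /not_vanishes_on[z2 A2 q2]].
have np : ~ vanishes_on A (poly_comp (inl_s (rsubmx z1)) p).
  by move/(_ _ A1)/eqP; rewrite poly_compE spec_inl hsubmxK (negbTE p1).
have nq : ~ vanishes_on A (poly_comp (inl_s (rsubmx z2)) q).
  by move/(_ _ A2)/eqP; rewrite poly_compE spec_inl hsubmxK (negbTE q2).
have : ~ vanishes_on A (poly_comp (inl_s (rsubmx z1)) p * poly_comp (inl_s (rsubmx z2)) q).
  by move/(zirreducible_prime irr) => [].
case/not_vanishes_on => b Ab; rewrite mevalM mulf_eq0 negb_or !poly_compE !spec_inl.
case/andP => p1b q2b.
have nz r s : r.@[(row_mx b s) 0] != 0 -> poly_comp (inr_b b) r != 0.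
  by apply: contraNneq => r0; rewrite -spec_inr -poly_compE r0 meval0.
have := mulf_neq0 (nz _ _ p1b) (nz _ _ q2b); case/eqP; apply: mpoly_all_zero => s.
pose s' : 'rV_k := \row_j s j; have e r : r.@[s] = r.@[s' 0].
  by apply: meval_eq => j; rewrite mxE.
rewrite e -rmorphM poly_compE spec_inr; apply: pq0.
by rewrite /prod_affine row_mxKl.
Qed.

Lemma generic_left (P : 'rV[K]_m -> Prop) :
  generic A P -> generic (@prod_affine K m A k) (fun z => P (lsubmx z)).
Proof.
case=> h nh hP; exists (poly_comp left_coords h).
  move=> H; apply: nh => b Ab; have := H (row_mx b 0).
  by rewrite poly_compE spec_left row_mxKl; apply; rewrite /prod_affine row_mxKl.
by move=> z Az; rewrite poly_compE spec_left; apply: hP.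
Qed.

Lemma generic_prod (P : 'rV[K]_(m + k) -> Prop) : generic (@prod_affine K m A k) P ->
  generic A (fun b => generic (fun _ => True) (fun s => P (row_mx b s))).
Proof.
case=> h /not_vanishes_on[z0 Az0 h0] hP; exists (poly_comp (inl_s (rsubmx z0)) h).
  by move/(_ _ Az0)/eqP; rewrite poly_compE spec_inl hsubmxK (negbTE h0).
move=> b Ab; rewrite poly_compE spec_inl => hb; exists (poly_comp (inr_b b) h).
  by move/(_ (rsubmx z0) I)/eqP; rewrite poly_compE spec_inr (negbTE hb).
move=> s _; rewrite poly_compE spec_inr; apply: hP.
by rewrite /prod_affine row_mxKl.
Qed.

Lemma tangent_prod z v : prod_affine A z ->
  zariski_tangent (@prod_affine K m A k) z v <-> zariski_tangent A (lsubmx z) (lsubmx v).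
Proof.
move=> Az; split=> [vt|vt].
  have := @tangent_push _ _ _ left_coords (@prod_affine K m A k) A z v.
  rewrite spec_left (_ : v *m _ = lsubmx v).
    by apply=> // y; rewrite spec_left.
  have /(congr1 lsubmx) := jacobian_coords; rewrite row_mxKl => ->.
  rewrite map_lsubmx map_mx1 -[in LHS](mulmx1 v).
  by apply/rowP => j; rewrite mulmx1 !mxE (bigD1 (lshift k j)) //= big1 ?addr0 =>
    [|i ij]; rewrite !mxE ?eqxx ?mulr1 // (negbTE ij) mulr0.
have -> : v = row_mx (lsubmx v) 0 + row_mx 0 (rsubmx v).
  by rewrite add_row_mx add0r addr0 hsubmxK.
apply: zariski_tangentD.
  have := @tangent_push _ _ _ (inl_s (rsubmx z)) A (@prod_affine K m A k) (lsubmx z) (lsubmx v).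
  rewrite spec_inl hsubmxK jacobian_row_mx jacobianX jacobian_const.
  rewrite map_row_mx map_mx1 map_mx0 mul_mx_row mulmx1 mulmx0; apply=> // y Ay.
  by rewrite spec_inl /prod_affine row_mxKl.
have := @tangent_push _ _ _ (inr_b (lsubmx z)) (fun=> True) (@prod_affine K m A k) (rsubmx z) (rsubmx v).
rewrite spec_inr hsubmxK jacobian_row_mx jacobianX jacobian_const.
rewrite map_row_mx map_mx1 map_mx0 mul_mx_row mulmx1 mulmx0; apply.
  by move=> y _; rewrite spec_inr /prod_affine row_mxKl.
exact: zariski_tangent_full.
Qed.

(** The dimensions are compared through tangent spaces, at a point general for both [A] and the
    product. *)
Lemma has_dim_prod d : zirreducible A -> has_dim A d ->
  has_dim (@prod_affine K m A k) (d + k).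
Proof.
move=> irr dimA; have irrP := prod_affine_irr irr.
have [F] := function_field_exists irr; have [G] := function_field_exists irrP.
suff -> : (d + k = ffdim G)%N by apply: has_dim_ff.
have -> : d = ffdim F := has_dim_unique dimA (has_dim_ff F).
have [z Az [[frG GT] [frF FT]]] := generic_exists (generic_and irrP
  (generic_tangent G irrP) (generic_left (generic_tangent F irr))).
set VF := (fftan F)^@_ in frF FT; set VG := (fftan G)^@_ in frG GT.
have e : (block_mx VF 0 0 (1%:M : 'M_k) :=: VG)%MS.
  apply/eqmxP/andP; split; apply/rV_subP => v.
    move=> /submxP[c ->]; apply/GT/tangent_prod => //; apply/FT.
    by rewrite -[c]hsubmxK mul_row_block mulmx0 addr0 row_mxKl submxMl.
  move/GT/(tangent_prod _ Az)/FT => /submxP[c cE]; apply/submxP.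
  exists (row_mx c (rsubmx v)).
  by rewrite mul_row_block !mulmx0 addr0 add0r mulmx1 -cE hsubmxK.
rewrite -[RHS](eqP frG) -e rank_diag_block_mx mxrank1; congr (_ + _)%N.
exact/esym/eqP.
Qed.

End ProdAffine.

Lemma full_gradient_rows (K : fieldType) m (A : 'rV[K]_m -> Prop) x :
  exists c (J : 'M[{mpoly K[m]}]_(c, m)),
    [/\ row_free (J^@x), forall i, exists2 p, vanishes_on A p & row i J = gradient p
      & forall v, v *m (J^@x)^T = 0 -> zariski_tangent A x v].
Proof.
have [c [J [Jfree Jgrad Jspan]]] := maximal_gradients A (meval (x 0)).
exists c, J; split=> // v vJ p Ap; have /submxP[u uE] := Jspan p Ap.
have : v *m ((gradient p)^@x)^T = 0 by rewrite [(gradient p)^@x]uE trmx_mul mulmxA vJ mul0mx.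
move/matrixP/(_ 0 0); rewrite !mxE => e; rewrite -[RHS]e.
by apply: eq_bigr => j _; rewrite !mxE.
Qed.

(* With [J] a matrix of gradients and [R] a constant right inverse of [J] at [x],
   the matrix [P := \det (J R) - R \adj (J R) J] is killed by [J], and at [x] it is
   the projection onto the kernel of [J]. *)
Lemma smooth_frame (K : numFieldType) m (A : 'rV[K]_m -> Prop) d x (T : 'M[K]_(d, m)) :
  zirreducible A -> has_dim A d -> A x -> row_basis T (zariski_tangent A x) ->
  exists2 V : 'M[{mpoly K[m]}]_(d, m), V^@x = T &
    forall y i, A y -> zariski_tangent A y (row i (V^@y)).
Proof.
move=> irr dimA Ax [frT TT]; have [F] := function_field_exists irr.
have [c [J [Jfree Jgrad Jker]]] := full_gradient_rows A x.
have TJ v : zariski_tangent A x v -> v *m (J^@x)^T = 0.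
  move=> vt; apply/rowP => i; rewrite !mxE; have [p Ap /rowP gp] := Jgrad i.
  rewrite -[RHS](vt p Ap); apply: eq_bigr => j _.
  by have := gp j; rewrite !mxE => ->.
have TE : (T :=: kermx (J^@x)^T)%MS.
  apply/eqmxP/andP; split; apply/rV_subP => v.
    by move=> /TT/TJ e; apply/sub_kermxP.
  by move/sub_kermxP/Jker/TT.
have cE : (d + c = m)%N.
  rewrite -[d in LHS](eqP frT) TE mxrank_ker mxrank_tr (eqP Jfree) subnK //.
  by rewrite -[c in (c <= _)%N](eqP Jfree) rank_leq_col.
have [R JR] := row_freeP Jfree.
pose Rp := map_mx (@mpolyC m K) R; pose S := J *m Rp.
pose P := (\det S)%:M - Rp *m \adj S *m J.
have JP : J *m P = 0.
  rewrite mulmxBr mul_mx_scalar !mulmxA -/S mul_mx_adj mul_scalar_mx subrr //.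
have Sx : S^@x = 1%:M by rewrite map_mxM spec_const.
exists (map_mx (@mpolyC m K) T *m P^T).
  rewrite map_mxM spec_const -map_trmx map_mxB map_scalar_mx /= !map_mxM spec_const.
  rewrite -det_map_mx map_mx_adj Sx det1.
  have -> : \adj (1%:M : 'M[K]_c) = 1%:M by rewrite -[LHS]mul1mx mul_mx_adj det1.
  rewrite mulmx1 linearB /= trmx1 mulmxBr mulmx1 trmx_mul mulmxA.
  have -> : T *m (J^@x)^T = 0 by apply/sub_kermxP; rewrite TE.
  by rewrite mul0mx subr0.
move=> y i Ay p Ap; set V := _ *m _.
have VJ : V *m J^T = 0 by rewrite /V -mulmxA -trmx_mul JP trmx0 mulmx0.
(* The rank of [J] cannot drop at the generic point, and at [x] it is already the codimension; so
   the kernel of [J] is the generic tangent space. *)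
have rkJ : \rank (map_mx (ff F) J) = c.
  apply/eqP; rewrite eqn_leq rank_leq_row /= -[X in (X <= _)%N](eqP Jfree).
  exact: rank_spec_le.
have FJ : (map_mx (ff F) (fftan F) :=: kermx (map_mx (ff F) J)^T)%MS.
  apply/eqmxP; rewrite -(geq_leqif (mxrank_leqif_eq _)).
    rewrite mxrank_ker mxrank_tr rkJ (eqP (fftan_free F)) -{1}cE addnK.
    by rewrite (has_dim_unique dimA (has_dim_ff F)).
  apply/sub_kermxP/matrixP => k l; rewrite !mxE; have [r Ar /rowP gr] := Jgrad l.
  transitivity (ffder k (ff F r)); last first.
    by rewrite (proj2 (ff_ker F r) Ar) (derivation_over0 (ffder_over k)).
  rewrite ffder_ff rmorph_sum; apply: eq_bigr => j _; rewrite rmorphM !mxE.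
  by have := gr j; rewrite !mxE => ->.
have : (map_mx (ff F) V <= map_mx (ff F) (fftan F))%MS.
  by rewrite FJ; apply/sub_kermxP; rewrite map_trmx -map_mxM VJ map_mx0.
case/submxP => D DE.
have : ff F (\sum_j V i j * mderiv j p) = 0.
  transitivity (\sum_k D i k * ffder k (ff F p)); last first.
    rewrite big1 // => k _; rewrite (proj2 (ff_ker F p) Ap).
    by rewrite (derivation_over0 (ffder_over k)) mulr0.
  rewrite rmorph_sum; under [RHS]eq_bigr do rewrite ffder_ff rmorph_sum mulr_sumr.
  rewrite exchange_big; apply: eq_bigr => j _.
  have /matrixP/(_ i j) := DE; rewrite [LHS]mxE rmorphM => ->.
  by rewrite mxE mulr_suml; apply: eq_bigr => k _; rewrite mxE rmorphM mulrA.
move/ff_ker/(_ y Ay); rewrite rmorph_sum => e; rewrite -[RHS]e.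
by apply: eq_bigr => j _; rewrite rmorphM !mxE.
Qed.

Lemma mpoly_split_last (K : comNzRingType) d (Q : {mpoly K[d.+1]}) : exists Q',
  Q = mmap (@mpolyC d.+1 K) (fun j => 'X_(lift ord_max j))
        (mmap (@mpolyC d K) (fun i => oapp (fun j => 'X_j) 0 (unlift ord_max i)) Q)
      + 'X_ord_max * Q'.
Proof.
elim/mpoly_ring_ind: Q => [c|i|p q [p' pE] [q' qE]|p q [p' pE] [q' qE]].
- by exists 0; rewrite !mmapC mulr0 addr0.
- rewrite mmap_mpolyX; case: unliftP => [j ->|->] /=.
    by exists 0; rewrite mmap_mpolyX mulr0 addr0.
  by exists 1; rewrite rmorph0 add0r mulr1.
- by exists (p' + q'); rewrite {1}pE {1}qE !rmorphD /= mulrDr addrACA.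
pose f (r : {mpoly K[d.+1]}) := mmap (@mpolyC d.+1 K) (fun j => 'X_(lift ord_max j))
  (mmap (@mpolyC d K) (fun i => oapp (fun j => 'X_j) 0 (unlift ord_max i)) r).
rewrite -/(f p) in pE; rewrite -/(f q) in qE; rewrite -/(f (p * q)).
exists (f p * q' + p' * f q + p' * q' * 'X_ord_max).
have -> : f (p * q) = f p * f q by rewrite /f !rmorphM.
by rewrite {1}pE {1}qE; ring.
Qed.

(** If [f] vanishes on [Z2] but not on [Z1], then [f] extends [t] to an independent family on [Z1]:
    on [Z2] a relation loses all terms with [f], so it is divisible by the last variable, and [f]
    cancels on the irreducible [Z1]. *)
Lemma equal_dim_vanishes (K : numFieldType) q (Z1 Z2 : 'rV[K]_q -> Prop) d :
  zirreducible Z1 -> (forall p, vanishes_on Z1 p -> vanishes_on Z2 p) ->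
  has_dim Z1 d -> (exists t : d.-tuple {mpoly K[q]}, alg_indep_on Z2 t) ->
  forall p, vanishes_on Z2 p -> vanishes_on Z1 p.
Proof.
move=> irr sub [_ dim1] [t ti] f f2; apply: contrapT => f1; apply: dim1.
pose h i := oapp (tnth t) f (unlift (@ord_max d) i).
pose t' := [tuple h i | i < d.+1]; exists t' => Q.
move: {2}(msize Q).+1 (ltnSn (msize Q)) => N; elim: N Q => // N IH Q sQ Qv.
have [Q' QE] := mpoly_split_last Q; set Q0 := mmap (@mpolyC d K) _ Q in QE.
have compM a b : (a * b) \mPo t' = (a \mPo t') * (b \mPo t') by rewrite rmorphM.
have compX : 'X_ord_max \mPo t' = f.
  by rewrite comp_mpolyXU -tnth_nth tnth_mktuple /h unlift_none.
have Q0t : mmap (@mpolyC d.+1 K) (fun j => 'X_(lift ord_max j)) Q0 \mPo t' = Q0 \mPo t.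
  pose g1 : {rmorphism {mpoly K[d]} -> {mpoly K[q]}} := (comp_mpoly t' \o
    mmap (@mpolyC d.+1 K) (fun j => 'X_(lift ord_max j)))%FUN.
  apply: (@eq_rmorph_mpoly _ _ _ g1 (comp_mpoly t)) => [c|j] /=.
    by rewrite mmapC !comp_mpolyC.
  rewrite mmap_mpolyX !comp_mpolyXU -!tnth_nth tnth_mktuple /h.
  by rewrite liftK.
have Q00 : Q0 = 0.
  apply: ti => x Zx; have := sub _ Qv x Zx; rewrite {1}QE comp_mpolyD compM Q0t compX.
  by rewrite mevalD mevalM f2 // mul0r addr0.
rewrite Q00 rmorph0 add0r in QE.
have [Q'0|Q'n0] := eqVneq Q' 0; first by rewrite QE Q'0 mulr0.
have Q'v : vanishes_on Z1 (Q' \mPo t').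
  by move: Qv; rewrite QE compM compX => /(zirreducible_prime irr)[].
have X0 : 'X_ord_max != 0 :> {mpoly K[d.+1]} by rewrite -msize_poly_eq0 msizeX.
rewrite QE (IH Q') ?mulr0 //; move: sQ; rewrite QE msizeM //.
by rewrite msizeX mdeg1 add2n.
Qed.

Definition last_subst (R S : comNzRingType) (f : R -> S) d (tau : 'rV[S]_d) (c : S)
  (Q : {mpoly R[d.+1]}) : S := mmap f (fun i => oapp (tau 0) c (unlift ord_max i)) Q.

(* For [tau] algebraically independent over [K], a nonzero [Q] does not vanish at
   [(tau, c)] for some constant [c]; so [Q(tau, Y)] is a nontrivial polynomial. *)
Lemma indep_specialize_last (K : numFieldType) m (A : 'rV[K]_m -> Prop)
    (F : function_field A) d (tau : 'rV[F]_d) (Q : {mpoly K[d.+1]}) :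
  (forall P, ffeval tau P = 0 -> P = 0) -> Q != 0 ->
  exists c : K, last_subst (ffC F) tau (ffC F c) Q != 0.
Proof.
move=> indep; apply: contraNP => none; apply/eqP; apply: mpoly_all_zero => x.
have Q0 : last_subst (ffC F) tau (ffC F (x ord_max)) Q = 0.
  by apply/eqP/negPn/negP => nz; apply: none; exists (x ord_max).
pose sub : {rmorphism {mpoly K[d.+1]} -> {mpoly K[d]}} := mmap (@mpolyC d K)
  (fun i => oapp (fun j => 'X_j) (x ord_max)%:MP (unlift ord_max i)).
have : sub Q = 0.
  apply: indep; rewrite -[RHS]Q0.
  pose g1 : {rmorphism {mpoly K[d.+1]} -> F} := (ffeval tau \o sub)%FUN.
  pose g2 : {rmorphism {mpoly K[d.+1]} -> F} := mmap (ffC F)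
    (fun i => oapp (tau 0) (ffC F (x ord_max)) (unlift ord_max i)).
  apply: (@eq_rmorph_mpoly _ _ _ g1 g2) => [c|i] /=; rewrite /sub.
    by rewrite !mmapC ffevalC.
  by rewrite !mmap_mpolyX; case: unliftP => [j|] _ /=; rewrite ?ffevalX ?ffevalC.
move=> Q0'; rewrite -[RHS](meval0 (fun j => x (lift ord_max j))) -Q0'.
pose g1 : {rmorphism {mpoly K[d.+1]} -> K} := (meval (fun j => x (lift ord_max j)) \o sub)%FUN.
apply: (@eq_rmorph_mpoly _ _ _ (meval x) g1) => [c|i] /=; rewrite /sub.
  by rewrite mmapC !mevalC.
rewrite mmap_mpolyX mevalXU; case: unliftP => [j|] -> /=; first by rewrite mevalXU.
by rewrite mevalC.
Qed.

(** * Rulings with a kernel *)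

Section PolyPoints.
Variables (K : numFieldType) (m : nat) (A : 'rV[K]_m -> Prop) (F : function_field A).

Lemma jac_ff q (phi : 'rV[{mpoly K[m]}]_q) :
  jac (map_mx (ff F) phi) = map_mx (ff F) (fftan F *m jacobian phi).
Proof.
apply/matrixP => i k; rewrite !mxE ffder_ff; congr (ff F _).
by apply: eq_bigr => j _; rewrite !mxE.
Qed.

Lemma map_ffeval_ff q (phi : 'rV[{mpoly K[m]}]_q) a b (M : 'M[{mpoly K[q]}]_(a, b)) :
  map_mx (ffeval (map_mx (ff F) phi)) M = map_mx (ff F) (map_mx (poly_comp phi) M).
Proof. by apply/matrixP => i j; rewrite !mxE ffeval_poly. Qed.

Lemma spec_map_comp q (phi : 'rV[{mpoly K[m]}]_q) a b (M : 'M[{mpoly K[q]}]_(a, b)) (x : 'rV[K]_m) :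
  (map_mx (poly_comp phi) M)^@x = M^@(phi^@x).
Proof. by apply/matrixP => i j; rewrite !mxE poly_compE. Qed.

Lemma generic_pull q (Z : 'rV[K]_q -> Prop) (phi : 'rV[{mpoly K[m]}]_q) P :
  generic_point Z (map_mx (ff F) phi) -> (forall x, A x -> Z (phi^@x)) ->
  generic Z P -> generic A (fun x => P (phi^@x)).
Proof.
move=> ZE AZ [h nh hP]; exists (poly_comp phi h).
  by move/(ff_ker F) => h0; apply/nh/ZE; rewrite ffeval_poly.
by move=> x Ax; rewrite poly_compE; apply/hP/AZ.
Qed.

(** A transcendental element would have a [jac] of rank one. *)
Lemma constant_of_derivations (x : F) : (forall i, ffder i x = 0) ->
  (exists2 P : {poly K}, P != 0 & (map_poly (ffC F) P).[x] = 0).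
Proof.
move=> dx; apply: contrapT => tr.
have : \rank (jac (\row_(j < 1) x)) = 1%N.
  apply/jac_full_indep => Q Q0; apply: mpoly_all_zero => y.
  pose ev : {rmorphism {mpoly K[1]} -> {poly K}} := mmap (@polyC K) (fun=> 'X).
  have evx : (map_poly (ffC F) (ev Q)).[x] = 0.
    rewrite -[RHS]Q0.
    pose g : {rmorphism {mpoly K[1]} -> F} := (horner_eval x \o map_poly (ffC F) \o ev)%FUN.
    apply: (@eq_rmorph_mpoly _ _ _ g (ffeval (\row_(j < 1) x))) => [c|j] /=;
      rewrite /horner_eval /ev.
      by rewrite mmapC map_polyC hornerC ffevalC.
    by rewrite mmap_mpolyX map_polyX hornerX ffevalX mxE.
  have ev0 : ev Q = 0 by apply: contrapT => /eqP nz; apply: tr; exists (ev Q).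
  rewrite -[RHS](horner0 (y 0)) -ev0.
  pose g : {rmorphism {mpoly K[1]} -> K} := (horner_eval (y 0) \o ev)%FUN.
  apply: (@eq_rmorph_mpoly _ _ _ (meval y) g) => [c|j] /=; rewrite /horner_eval /ev.
    by rewrite mmapC hornerC mevalC.
  by rewrite mmap_mpolyX hornerX mevalXU ord1.
rewrite (_ : jac _ = 0) ?mxrank0 //.
by apply/matrixP => i j; rewrite !mxE dx.
Qed.

End PolyPoints.

Lemma closed_constant (K : numClosedFieldType) m (A : 'rV[K]_m -> Prop)
  (F : function_field A) (x : F) : (forall i, ffder i x = 0) -> exists c, x = ffC F c.
Proof.
case/constant_of_derivations => P P0; have [r ->] := closed_field_poly_normal P.
rewrite map_polyZ hornerZ => /eqP; rewrite mulf_eq0 fmorph_eq0 lead_coef_eq0 (negbTE P0) /=.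
rewrite rmorph_prod horner_prod prodf_seq_eq0 => /hasP[c _ /=].
rewrite rmorphB /= map_polyX map_polyC hornerXsubC subr_eq0 => /eqP ->.
by exists c.
Qed.

Lemma mderiv_comp (K : numFieldType) m q (phi : 'rV[{mpoly K[m]}]_q) i p :
  mderiv i (poly_comp phi p) = \sum_j mderiv i (phi 0 j) * poly_comp phi (mderiv j p).
Proof.
have der : derivation_over (poly_comp phi) (fun p => mderiv i (poly_comp phi p)).
  by split=> a b; rewrite ?rmorphD ?rmorphM ?mderivD ?mderivM.
rewrite (mpoly_chain der) => [|c]; last by rewrite poly_compC mderivC.
by apply: eq_bigr => j _; rewrite poly_compX.
Qed.

Lemma zariski_tangentZ (K : numFieldType) m (A : 'rV[K]_m -> Prop) x c v :
  zariski_tangent A x v -> zariski_tangent A x (c *: v).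
Proof.
move=> vt p Ap; under eq_bigr do rewrite mxE -mulrA.
by rewrite -mulr_sumr vt // mulr0.
Qed.

Lemma cone_tangent (K : numFieldType) m (S : 'rV[K]_m -> Prop) c x v :
  is_cone_set S -> c != 0 -> zariski_tangent S (c *: x) v <-> zariski_tangent S x v.
Proof.
move=> coneS c0.
have push a y w : zariski_tangent S y w -> zariski_tangent S (a *: y) (a *: w).
  pose phi : 'rV[{mpoly K[m]}]_m := \row_j (a *: 'X_j).
  have phiE z : phi^@z = a *: z by apply/rowP => j; rewrite !mxE mevalZ mevalXU.
  move=> wt; have := @tangent_push _ _ _ phi S S y w; rewrite phiE.
  have -> : (jacobian phi)^@y = a%:M.
    apply/matrixP => i j; rewrite !mxE mderivZ mderivXU mevalZ rmorph_nat.
    by rewrite mulr_natr.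
  rewrite mul_mx_scalar; apply=> // z Sz; rewrite phiE; exact: coneS.
split=> [/(push c^-1)|/(push c)] /(zariski_tangentZ c) => [|H].
  by rewrite !scalerA mulVf // mulfV // !scale1r.
(* In this direction the homothety and the rescaling have each multiplied [v] by [c]. *)
by have := zariski_tangentZ (c^-1 * c^-1) H; rewrite !scalerA (_ : c^-1 * _ * _ * _ = 1) ?scale1r //; field.
Qed.

Lemma generic_linear0 (K : numFieldType) k n (C : 'M[K]_(k, n)) :
  generic (fun _ : 'rV[K]_k => True) (fun s => s *m C = 0) -> C = 0.
Proof.
case=> h /not_vanishes_on[s0 _ h0] hC; apply/matrixP => i j; rewrite mxE.
pose p : {mpoly K[k]} := \sum_i C i j *: 'X_i.
have pE (s : 'rV[K]_k) : p.@[s 0] = (s *m C) 0 j.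
  rewrite rmorph_sum mxE; apply: eq_bigr => l _.
  by rewrite /= mevalZ mevalXU mulrC.
have /eqP : h * p = 0.
  apply: mpoly_all_zero => y; pose s : 'rV[K]_k := \row_l y l.
  have -> : (h * p).@[y] = (h * p).@[s 0] by apply: meval_eq => l; rewrite mxE.
  rewrite mevalM pE; have [->|hs] := eqVneq h.@[s 0] 0; first by rewrite mul0r.
  by rewrite hC // mxE mulr0.
rewrite mulf_eq0 => /orP[/eqP h00|/eqP p0]; first by rewrite h00 meval0 eqxx in h0.
have := pE (delta_mx 0 i); rewrite p0 meval0 -rowE mxE => e; rewrite [RHS]e.
by [].
Qed.

Section Stack.
Variables (R : Type) (g k n : nat).

Definition stackmx (M : 'I_g -> 'M[R]_(k, n)) : 'M[R]_(#|{: 'I_g * 'I_k}|, n) :=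
  \matrix_(l, j) M (enum_val l).1 (enum_val l).2 j.

Lemma row_stackmx M l : row l (stackmx M) = row (enum_val l).2 (M (enum_val l).1).
Proof. by apply/rowP => j; rewrite !mxE. Qed.

End Stack.

Lemma map_stackmx (R S : Type) (f : R -> S) g k n (M : 'I_g -> 'M[R]_(k, n)) :
  map_mx f (stackmx M) = stackmx (fun i => map_mx f (M i)).
Proof. by apply/matrixP => i j; rewrite !mxE. Qed.

Lemma stackmx_sub (F : fieldType) g k n r (M : 'I_g -> 'M[F]_(k, n)) (T : 'M_(r, n)) :
  (stackmx M <= T)%MS <-> forall i, (M i <= T)%MS.
Proof.
split=> [sT i|MT].
  apply/row_subP => a; have := row_subP sT (enum_rank (i, a)).
  by rewrite row_stackmx enum_rankK.
by apply/row_subP => l; rewrite row_stackmx (submx_trans (row_sub _ _)).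
Qed.

(* A linear map from a [k]-dimensional space to the [g]-th power of a space of
   dimension at most [g] has a kernel when [g ^ 2 < k]. *)
Lemma common_kernel (F : fieldType) g k n l (L : 'M[F]_(l, n)) (M : 'I_g -> 'M[F]_(k, n)) :
  (\rank (col_mx L (stackmx M)) <= \rank L + g)%N -> (g * g < k)%N ->
  exists2 s : 'rV[F]_k, s != 0 & forall i, (s *m M i <= L)%MS.
Proof.
set Big := col_mx _ _ => rkB gk; set Q := cokermx L; set Y := row_base (Big *m Q).
have rkY : (\rank (Big *m Q) <= g)%N.
  have := mxrank_mul_ker Big Q; have : (L <= Big :&: kermx Q)%MS.
    by rewrite sub_capmx -addsmxE addsmxSl /=; apply/sub_kermxP; rewrite mulmx_coker.
  by move/mxrankS; lia.
have MY i : (M i *m Q <= Y)%MS.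
  rewrite eq_row_base submxMr // /Big -addsmxE.
  by rewrite (submx_trans (proj1 (stackmx_sub M _) (submx_refl _) i)) ?addsmxSr.
have [C CE] := choice (fun i => submxP (MY i)).
(* The coordinates modulo [L] of all [M i], side by side: [k] rows and at most [g * g] columns. *)
pose D : 'M[F]_(k, _) := \matrix_(a < k, l < #|{: 'I_g * 'I_(\rank (Big *m Q))}|)
  C (enum_val l).1 a (enum_val l).2.
have : kermx D != 0.
  rewrite -mxrank_eq0 mxrank_ker subn_eq0 -ltnNge.
  rewrite (leq_ltn_trans (rank_leq_col _)) // card_prod !card_ord.
  by rewrite (leq_ltn_trans _ gk) // leq_mul2l rkY orbT.
case/rowV0Pn => s /sub_kermxP sD s0; exists s => // i.
have sC : s *m C i = 0.
  apply/rowP => a; have /rowP/(_ (enum_rank (i, a))) := sD.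
  rewrite !mxE => e; rewrite -[RHS]e; apply: eq_bigr => b _.
  by rewrite !mxE enum_rankK.
by rewrite submxE -/Q -mulmxA CE mulmxA sC mul0mx.
Qed.

(** * The kernel section of a stationary scroll *)

Section StationaryKernel.
Variables (K : numFieldType) (N m : nat) (B : variety K m) (X : family N B).
Variable F : function_field B.
Let irr : zirreducible B := points_irreducible B.

Definition frame_der i : 'M[{mpoly K[m]}]_((rdim X).+1, N.+1) :=
  \sum_j fftan F i j *: map_mx (mderiv j) (frame X).

Lemma frame_der_spec i b : (frame_der i)^@b = dframe X b (row i (fftan F)^@b).
Proof.
apply/matrixP => a c; rewrite mxE !summxE rmorph_sum; apply: eq_bigr => j _.
by rewrite !mxE rmorphM.
Qed.

Lemma frame_der_ff i : map_mx (ff F) (frame_der i) =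
  map_mx (ffder i) (map_mx (ff F) (frame X)).
Proof.
apply/matrixP => a c; rewrite !mxE ffder_ff summxE; congr (ff F _).
by apply: eq_bigr => j _; rewrite !mxE.
Qed.

Lemma rank_frame_ff : \rank (map_mx (ff F) (frame X)) = (rdim X).+1.
Proof.
apply: generic_rank_eq => //; apply: generic_imp (frame_free X) => b _.
by rewrite /row_free => /eqP.
Qed.

Lemma embedded_tangentE b (s : 'rV[K]_((rdim X).+1)) w : row_basis ((fftan F)^@b) (zariski_tangent B b) ->
  embedded_tangent b s w <->
  (w <= col_mx (ruling X b) (\matrix_i (s *m (frame_der i)^@b)))%MS.
Proof.
move=> [_ TB]; split=> [[v [t [/TB/submxP[c ->] ->]]]|/submxP[c ->]].
  apply/submxP; exists (row_mx t c); rewrite mul_row_col; congr (_ + _).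
  rewrite /dframe mulmx_sumr; apply/rowP => l; rewrite summxE mxE.
  under eq_bigr do rewrite -scalemxAr mxE mxE mulr_suml.
  rewrite exchange_big; apply: eq_bigr => i _ /=.
  rewrite mxE frame_der_spec /dframe mulmx_sumr summxE mulr_sumr.
  by apply: eq_bigr => j _; rewrite -scalemxAr !mxE mulrA.
exists (rsubmx c *m (fftan F)^@b), (lsubmx c); split; first by apply/TB/submxMl.
rewrite -[c in LHS]hsubmxK mul_row_col; congr (_ + _).
rewrite /dframe mulmx_sumr; apply/rowP => l; rewrite summxE mxE.
under [RHS]eq_bigr do rewrite -scalemxAr mxE mxE mulr_suml.
rewrite [RHS]exchange_big; apply: eq_bigr => i _ /=.
rewrite mxE frame_der_spec /dframe mulmx_sumr summxE mulr_sumr.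
by apply: eq_bigr => j _; rewrite -scalemxAr !mxE mulrA.
Qed.

(** For fixed [b] the common tangent space is spanned by the ruling and the derivatives at a single
    [s0], which bounds its dimension; yet it contains the derivatives at all [s]. *)
Lemma stationary_rank : stationary X ->
  (\rank (map_mx (ff F) (col_mx (frame X) (stackmx frame_der))) <= (rdim X).+1 + ffdim F)%N.
Proof.
move=> statX; apply: rank_at_le => //.
apply: generic_imp (generic_and irr statX (generic_tangent F irr)) => b Bb [[T TE] tanb].
have irrK : zirreducible (fun _ : 'rV[K]_((rdim X).+1) => True).
  apply: prime_zirreducible; first by exists 0.
  have z0 (p : {mpoly K[_]}) : vanishes_on (fun=> True) p -> p = 0.
    move=> p0; apply: mpoly_all_zero => y; rewrite -[RHS](p0 (\row_j y j) I).
    by apply: meval_eq => j; rewrite mxE.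
  move=> p q /z0/eqP; rewrite mulf_eq0.
  by case/orP => /eqP ->; [left|right] => x _; rewrite meval0.
have [s0 _ Ts0] := generic_exists TE.
set C := col_mx (ruling X b) (\matrix_i (s0 *m (frame_der i)^@b)).
have sC w : T w <-> (w <= C)%MS by rewrite -(Ts0 w); apply: embedded_tangentE.
rewrite (leq_trans _ (rank_leq_row C)) // mxrankS // map_col_mx -addsmxE addsmx_sub.
rewrite (_ : (frame X)^@b <= C)%MS /=; last by rewrite /C -addsmxE addsmxSl.
rewrite map_stackmx; apply/stackmx_sub => i; rewrite submxE; apply/eqP.
(* The condition is linear in [s], so it passes from general [s] to the whole matrix. *)
apply: generic_linear0; apply: generic_imp TE => s _ Ts.
rewrite mulmxA; apply/eqP; rewrite -submxE; apply/sC/Ts.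
exists (row i (fftan F)^@b), 0; split; last by rewrite mul0mx add0r frame_der_spec.
by case: tanb => _ H; apply/H/row_sub.
Qed.

Lemma stationary_section : stationary X -> (ffdim F * ffdim F < (rdim X).+1)%N ->
  exists p : 'rV[{mpoly K[m]}]_N.+1,
    [/\ map_mx (ff F) p != 0, (map_mx (ff F) p <= map_mx (ff F) (frame X))%MS
      & (jac (map_mx (ff F) p) <= map_mx (ff F) (frame X))%MS].
Proof.
move=> statX small; set L := map_mx (ff F) (frame X).
have [] := @common_kernel F (ffdim F) _ _ _ L (fun i => map_mx (ff F) (frame_der i)).
- rewrite rank_frame_ff -map_stackmx -map_col_mx; exact: stationary_rank.
- exact: small.
move=> s s0 sL; have [h h0 [s' s'E]] := common_denominator (@ff_frac _ _ _ F) s.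
have pE : map_mx (ff F) (s' *m frame X) = (ff F h *: s) *m L by rewrite map_mxM s'E.
have freeL : row_free L by rewrite /row_free rank_frame_ff.
exists (s' *m frame X); split.
- rewrite pE; apply: contraNneq s0 => /eqP.
  by rewrite mulmx_free_eq0 // scaler_eq0 (negbTE h0).
- by rewrite pE submxMl.
apply/row_subP => i.
(* Leibniz rule: the first term lies in [L], the second one by the choice of [s]. *)
have -> : row i (jac (map_mx (ff F) (s' *m frame X))) =
    (\row_a ffder i (map_mx (ff F) s' 0 a)) *m L
    + map_mx (ff F) s' *m map_mx (ff F) (frame_der i).
  apply/rowP => j; rewrite !mxE rmorph_sum (derivation_over_sum (ffder_over i)) -big_split.
  apply: eq_bigr => a _; rewrite rmorphM (proj2 (ffder_over i)) frame_der_ff !mxE.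
  by rewrite [LHS]/=.
by rewrite addmx_sub ?submxMl // s'E -scalemxAl scalemx_sub.
Qed.

End StationaryKernel.

(** * The cone over the image of a section and its tangent spaces *)

Section ConeMap.
Variables (K : numFieldType) (N m : nat) (p : 'rV[{mpoly K[m]}]_N).

Definition cone_map : 'rV[{mpoly K[m + 1]}]_N :=
  (right_coords K m 1) 0 0 *: map_mx (poly_comp (left_coords K m 1)) p.

Lemma cone_map_spec (z : 'rV[K]_(m + 1)) : cone_map^@z = rsubmx z 0 0 *: p^@(lsubmx z).
Proof.
rewrite -spec_left -spec_right -spec_map_comp.
by apply/rowP => j; rewrite !mxE rmorphM.
Qed.

Lemma cone_map_jacobian (z : 'rV[K]_(m + 1)) : (jacobian cone_map)^@z =
  col_mx (rsubmx z 0 0 *: (jacobian p)^@(lsubmx z)) (p^@(lsubmx z)).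
Proof.
apply/matrixP => i j; rewrite mxE.
have dright a : mderiv a ((right_coords K m 1) 0 0) = (a == rshift m 0)%:R.
  by rewrite mxE mderivXU.
have dleft a c : mderiv a ((left_coords K m 1) 0 c) = (a == lshift 1 c)%:R.
  by rewrite mxE mderivXU.
have E : jacobian cone_map i j =
    (i == rshift m 0)%:R * poly_comp (left_coords K m 1) (p 0 j) +
    (right_coords K m 1) 0 0 *
      (\sum_c (i == lshift 1 c)%:R * poly_comp (left_coords K m 1) (mderiv c (p 0 j))).
  rewrite mxE [cone_map 0 j]mxE mderivM dright mxE mderiv_comp; congr (_ + _ * _).
  by apply: eq_bigr => c _; rewrite dleft.
rewrite E mevalD !mevalM rmorph_nat poly_compE spec_left.
have -> : meval (z 0) ((right_coords K m 1) 0 0) = rsubmx z 0 0.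
  by rewrite !mxE mevalXU.
rewrite -(splitK i); case: (split i) => l /=.
  rewrite col_mxEu (negbTE (_ : lshift 1 l != rshift m 0)) ?eq_lrshift // mul0r add0r.
  rewrite [RHS]mxE [((jacobian p)^@_) l j]mxE; congr (_ * _).
  rewrite (bigD1 l) //= big1 => [|c cl].
    by rewrite eqxx mul1r addr0 poly_compE spec_left mxE.
  by rewrite eq_lshift eq_sym (negbTE cl) mul0r.
rewrite col_mxEd [l]ord1 eqxx mul1r big1 ?meval0 ?mulr0 ?addr0 => [|c _].
  by rewrite mxE.
by rewrite eq_rlshift mul0r.
Qed.

End ConeMap.

Section TangentScroll.
Variables (K : numFieldType) (N m : nat) (B : variety K m) (p : 'rV[{mpoly K[m]}]_N.+1).
Variable F : function_field B.
Let irr : zirreducible B := points_irreducible B.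
Let C := @prod_affine K m B 1.
Let irrC : zirreducible C := prod_affine_irr 1 irr.

Definition cone_closure : 'rV[K]_N.+1 -> Prop :=
  zclosure (fun y => exists (c : K) b, B b /\ y = c *: p^@b).

Lemma cone_closure_vanishes q : vanishes_on cone_closure q <->
  forall z, C z -> q.@[((cone_map p)^@z) 0] = 0.
Proof.
rewrite vanishes_on_zclosure; split=> [H z Cz|H _ [c [b [Bb ->]]]].
  by apply: H; rewrite cone_map_spec; exists (rsubmx z 0 0), (lsubmx z).
have := H (row_mx b (\row_(j < 1) c)); rewrite cone_map_spec row_mxKl row_mxKr mxE.
by apply; rewrite /C /prod_affine row_mxKl.
Qed.

Lemma cone_closure_cone : is_cone_set cone_closure.
Proof.
move=> a y Sy q qS; pose phi : 'rV[{mpoly K[N.+1]}]_N.+1 := \row_j (a *: 'X_j).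
have phiE z : phi^@z = a *: z by apply/rowP => j; rewrite !mxE mevalZ mevalXU.
rewrite -phiE -poly_compE; apply: Sy => _ [c [b [Bb ->]]].
by rewrite poly_compE phiE scalerA; apply: qS; exists (a * c), b.
Qed.

Lemma cone_closure_generic (G : function_field C) :
  generic_point cone_closure (map_mx (ff G) (cone_map p)).
Proof. by move=> q; rewrite cone_closure_vanishes ffeval_poly_eq0. Qed.

Lemma cone_closure_irr : zirreducible cone_closure.
Proof.
by have [G] := function_field_exists irrC; exact: generic_point_irr (cone_closure_generic G).
Qed.

(** Spans, for general [b], the tangent space at [p b] to the affine cone over the image of [p]. *)
Definition tangent_frame := col_mx p (fftan F *m jacobian p).

(** The derivatives of [c p(b)] are [p(b)] and [c] times those of [p], with the same span as for
    [c = 1] when [c != 0]. *)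
Lemma cone_map_tangent (G : function_field C) : generic C (fun z =>
  rsubmx z 0 0 != 0 /\
  ((fftan G *m jacobian (cone_map p))^@z :=: tangent_frame^@(lsubmx z))%MS).
Proof.
have nz : generic C (fun z => rsubmx z 0 0 != 0).
  have hz (z : 'rV[K]_(m + 1)) : ((right_coords K m 1) 0 0).@[z 0] = rsubmx z 0 0.
    by rewrite -spec_right [RHS]mxE.
  exists ((right_coords K m 1) 0 0) => [|z _]; last by rewrite hz.
  have [[b Bb] _] := irr; move/(_ (row_mx b (\row_(j < 1) 1))).
  rewrite hz row_mxKr mxE /C /prod_affine row_mxKl => /(_ Bb)/eqP.
  by rewrite oner_eq0.
apply: generic_imp (generic_and irrC nz (generic_and irrC (generic_tangent G irrC)
  (generic_left 1 (generic_tangent F irr)))) => z Cz [c0 [[_ GT] [_ FT]]].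
split=> //; apply/eqmxP; rewrite !map_mxM map_col_mx map_mxM cone_map_jacobian.
set c := rsubmx z 0 0 in c0 *; set VF := (fftan F)^@_ in FT *; set J := (jacobian p)^@_.
set pb := p^@_; apply/andP; split.
  apply/row_subP => i; rewrite row_mul -[row i _]hsubmxK mul_row_col.
  have /tangent_prod : zariski_tangent C z (row i (fftan G)^@z) by apply/GT/row_sub.
  move=> /(_ Cz)/FT/submxP[u uE].
  rewrite addmx_sub // -addsmxE; last first.
    by rewrite (submx_trans (submxMl _ _)) // addsmxSl.
  by rewrite -scalemxAr scalemx_sub // uE -mulmxA (submx_trans (submxMl _ _)) // addsmxSr.
have sub v : zariski_tangent B (lsubmx z) (lsubmx v) ->
    (v *m col_mx (c *: J) pb <= (fftan G)^@z *m col_mx (c *: J) pb)%MS.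
  by move=> vt; apply: submxMr; apply/GT; apply/tangent_prod.
rewrite -addsmxE addsmx_sub; apply/andP; split.
  have := sub (row_mx 0 1%:M); rewrite mul_row_col mul0mx add0r mul1mx; apply.
  by rewrite row_mxKl => q _; rewrite big1 // => i _; rewrite mxE mul0r.
apply/row_subP => i; have := sub (row_mx (c^-1 *: row i VF) 0).
rewrite mul_row_col mul0mx addr0 -scalemxAl -scalemxAr scalerA mulVf // scale1r.
rewrite -row_mul; apply; rewrite row_mxKl; apply: zariski_tangentZ.
by apply/FT/row_sub.
Qed.

Lemma tangent_frame_ff : map_mx (ff F) tangent_frame =
  col_mx (map_mx (ff F) p) (jac (map_mx (ff F) p)).
Proof. by rewrite map_col_mx jac_ff. Qed.

Lemma has_dim_cone_closure : has_dim cone_closure (\rank (map_mx (ff F) tangent_frame)).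
Proof.
have [G] := function_field_exists irrC.
have -> : \rank (map_mx (ff F) tangent_frame) = \rank (jac (map_mx (ff G) (cone_map p))).
  rewrite jac_ff; apply/esym/generic_rank_eq => //.
  apply: generic_imp (generic_and irrC (cone_map_tangent G)
    (generic_left 1 (rank_spec F tangent_frame))) => z _ [[_ ->] ->] //.
exact: has_dim_generic_point (cone_closure_generic G).
Qed.

(** The tangent space is known at [c p(b)] for general [(b, c)], but the slice [c = 1] need not meet
    the open set in question; invariance under homotheties moves the result to [p b]. *)
Lemma cone_closure_tangent : generic B (fun b => forall w,
  (w <= tangent_frame^@b)%MS <-> zariski_tangent cone_closure (p^@b) w).
Proof.
have [G] := function_field_exists irrC.
have [FS] := function_field_exists cone_closure_irr.
have inS z : C z -> cone_closure ((cone_map p)^@z).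
  move=> Cz; apply: zclosure_sub; rewrite cone_map_spec.
  by exists (rsubmx z 0 0), (lsubmx z).
have gS := generic_pull (cone_closure_generic G) inS (generic_tangent FS cone_closure_irr).
have gV : generic C (fun z => ((fftan FS)^@((cone_map p)^@z) :=:
    (fftan G *m jacobian (cone_map p))^@z)%MS).
  have /eqmxP/andP[] := generic_point_tangent FS (cone_closure_generic G).
  rewrite map_ffeval_ff jac_ff => /(submx_spec irrC) s1 /(submx_spec irrC) s2.
  apply: generic_imp (generic_and irrC s1 s2) => z _ [].
  by rewrite spec_map_comp => le1 le2; apply/eqmxP/andP.
have := generic_and irrC gS (generic_and irrC gV (cone_map_tangent G)).
move/generic_prod; apply: generic_imp => b Bb /generic_exists[s _].
rewrite cone_map_spec row_mxKl row_mxKr => -[[_ ST] [e1 [c0 e2]]] w.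
rewrite -(cone_tangent _ _ cone_closure_cone c0); split=> [le_w|/ST].
  by apply/ST; rewrite e1 e2.
by rewrite e1 e2.
Qed.

End TangentScroll.

Section SmallGaussDimension.
Variables (K : numClosedFieldType) (N m : nat) (B : variety K m) (X : family N B).

Lemma inflation_refl : inflation X X.
Proof.
by have [exB _] := points_irreducible B; apply: generic_all exB _ => b _; exact: submx_refl.
Qed.

(* The rulings contain a point [p b] with [dp] in the ruling; either [p] is
   constant, or the rulings contain the tangent spaces of its image. *)
Lemma stationary_inflated g : stationary X -> has_dim B g -> (g * g < (rdim X).+1)%N ->
  inflated_cone X \/ inflated_tangent_scroll X.
Proof.
move=> statX dimB small; have irr := points_irreducible B.
have [F] := function_field_exists irr.
have gE : g = ffdim F := has_dim_unique dimB (has_dim_ff F); rewrite gE in small.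
have [p [p0 pL jL]] := stationary_section statX small.
have TL : (map_mx (ff F) (tangent_frame p F) <= map_mx (ff F) (frame X))%MS.
  by rewrite tangent_frame_ff -addsmxE addsmx_sub pL.
have pT : (map_mx (ff F) p <= map_mx (ff F) (tangent_frame p F))%MS.
  by rewrite tangent_frame_ff -addsmxE addsmxSl.
(* This rank is the dimension of the affine cone over the image of [p]: the image is a point for
   rank 1 and positive-dimensional for larger ranks. *)
case rkT : (\rank (map_mx (ff F) (tangent_frame p F))) => [|e].
  by have := mxrankS pT; rewrite rkT leqn0 mxrank_eq0 (negbTE p0).
case: e rkT => [|e] rkT; [left|right].
  have [j pj] : exists j, map_mx (ff F) p 0 j != 0.
    apply: contrapT => H; case/eqP: p0; apply/rowP => j; rewrite [RHS]mxE.
    by apply: contrapT => /eqP nz; apply: H; exists j.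
  set P := map_mx (ff F) p in p0 pL jL pT pj *.
  have jP : (jac P <= P)%MS.
    have /eqmxP eqPT : (P == map_mx (ff F) (tangent_frame p F))%MS.
      by rewrite -(geq_leqif (mxrank_leqif_eq pT)) rkT lt0n mxrank_eq0.
    by rewrite eqPT tangent_frame_ff -addsmxE addsmxSr.
  (* [dP] is proportional to [P], so every derivation kills the ratios of coordinates. *)
  have const l : exists c, P 0 l / P 0 j = ffC F c.
    apply: closed_constant => i; have /submxP[u uE] := row_subP jP i.
    have dP k : ffder i (P 0 k) = u 0 0 * P 0 k.
      by have /rowP/(_ k) := uE; rewrite [LHS]mxE [LHS]mxE => ->; rewrite mxE big_ord1.
    have e1 : ffder i (P 0 l / P 0 j * P 0 j) =
        ffder i (P 0 l / P 0 j) * P 0 j + P 0 l / P 0 j * ffder i (P 0 j).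
      exact: (proj2 (ffder_over i)).
    move: e1; rewrite divfK // !dP mulrCA divfK // => /esym/eqP.
    by rewrite -subr_eq0 addrK mulf_eq0 (negbTE pj) orbF => /eqP.
  have [c cE] := choice const; pose q : 'rV[K]_N.+1 := \row_l c l.
  have qE : P = P 0 j *: map_mx (ffC F) q.
    by apply/rowP => l; rewrite [RHS]mxE [X in _ * X]mxE [q 0 l]mxE -cE mulrC divfK.
  (* The rulings of [X] themselves pass through [q], so [X] is an inflation of itself as a cone. *)
  exists X; last exact: inflation_refl.
  exists q.
    by apply: contraNneq p0 => q0; rewrite qE q0 map_mx0 scaler0.
  have : (map_mx (ff F) (map_mx (@mpolyC m K) q) <= map_mx (ff F) (frame X))%MS.
    rewrite -map_mx_comp; apply: submx_trans pL.
    by rewrite qE; apply/submxP; exists (P 0 j)^-1%:M; rewrite mul_scalar_mx scalerA mulVf // scale1r.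
  by move/(submx_spec irr); apply: generic_imp => b _; rewrite spec_const.
(* A basis of the tangent spaces, cleared of denominators, makes the tangent scroll a family over
   [B]. *)
have [h h0 [W0 W0E]] := common_denominator (@ff_frac _ _ _ F)
  (row_base (map_mx (ff F) (tangent_frame p F))).
pose W : 'M_(e.+2, N.+1) := castmx (rkT, erefl) W0.
have WT : (map_mx (ff F) W :=: map_mx (ff F) (tangent_frame p F))%MS.
  rewrite map_castmx; apply: eqmx_trans (eqmx_cast _ _) _.
  by rewrite W0E; apply: eqmx_trans (eqmx_scale _ h0) (eq_row_base _).
have Wfree : generic B (fun b => row_free (W^@b)).
  apply: generic_imp (rank_spec F W) => b _; rewrite WT rkT => rkW.
  by rewrite /row_free rkW.
exists (Family Wfree).
  exists (Variety (zclosure_closed _) (cone_closure_irr B p)), e.+1, p; split=> //.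
  - exact: cone_closure_cone.
  - by split=> //; have := has_dim_cone_closure p F; rewrite rkT.
  have /eqmxP/andP[s1 s2] := WT.
  have := generic_and irr (cone_closure_tangent p F)
    (generic_and irr (submx_spec irr s1) (submx_spec irr s2)).
  apply: generic_imp => b _ [tanE [le1 le2]] w.
  have /eqmxP eW : (W^@b == (tangent_frame p F)^@b)%MS by apply/andP.
  by rewrite -tanE -eW.
have : (map_mx (ff F) W <= map_mx (ff F) (frame X))%MS by rewrite WT.
by move/(submx_spec irr).
Qed.

End SmallGaussDimension.

(** * The Gauss map *)

Section DerivationMatrix.
Variables (F : fieldType) (D : F -> F).
Hypothesis derD : derivation_over (idfun : {rmorphism F -> F}) D.

Lemma map_der_mulmx a b c (M : 'M[F]_(a, b)) (M' : 'M[F]_(b, c)) :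
  map_mx D (M *m M') = map_mx D M *m M' + M *m map_mx D M'.
Proof.
apply/matrixP => i j; rewrite !mxE (derivation_over_sum derD) -big_split.
by apply: eq_bigr => k _; rewrite (proj2 derD) !mxE.
Qed.

Lemma map_der0 a b : map_mx D (0 : 'M[F]_(a, b)) = 0.
Proof. by apply/matrixP => i j; rewrite !mxE (derivation_over0 derD). Qed.

Lemma derivation_det0 n (M : 'M[F]_n) : map_mx D M = 0 -> D (\det M) = 0.
Proof.
move=> /matrixP M0; rewrite /determinant (derivation_over_sum derD) big1 // => s _.
rewrite (proj2 derD) (derivation_over_prod0 derD) => [|i _]; last first.
  by have := M0 i (s i); rewrite !mxE.
rewrite mulr0 addr0; case: (odd_perm s).
  by rewrite expr1 (derivation_overN derD) (derivation_over1 derD) oppr0 mul0r.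
by rewrite expr0 (derivation_over1 derD) mul0r.
Qed.

(* The coefficients of [q] are constants of [D] and [D k = k], so [D] acts on
   [q(k)] as [Y d/dY]. *)
Lemma euler_transcendental (k : F) (q : {poly F}) :
  (forall i, i.+1%:R != 0 :> F) -> k != 0 -> D k = k -> (forall i, D q`_i = 0) ->
  q.[k] = 0 -> q = 0.
Proof.
move=> charF k0 Dk; move: {2}(size q).+1 (ltnSn (size q)) => s.
elim: s q => // s IH q sq dq qk.
have Dexp i : D (k ^+ i) = k ^+ i *+ i.
  elim: i => [|i IHi]; first by rewrite expr0 (derivation_over1 derD).
  by rewrite exprS (proj2 derD) IHi Dk /= mulrnAr -exprS mulrS.
have [sq0|sq0] := eqVneq (size q) 0%N; first by apply/eqP; rewrite -size_poly_eq0 sq0.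
have dq0 : q^`() = 0.
  apply: IH; first by rewrite (leq_trans (lt_size_deriv _)) // -size_poly_eq0.
    move=> i; rewrite coef_deriv -mulr_natr (proj2 derD) dq mul0r add0r /=.
    have -> : D i.+1%:R = 0; last by rewrite mulr0.
    by elim: i.+1 => [|j IHj]; rewrite ?(derivation_over0 derD) // mulrS
      (proj1 derD) IHj (derivation_over1 derD) addr0.
  (* Applying [D] to [q.[k] = 0] gives [k] times the value at [k] of the derivative of [q]. *)
  apply: (mulIf k0); rewrite mul0r -[RHS](derivation_over0 derD) -qk.
  rewrite [q.[k]]horner_coef (derivation_over_sum derD).
  rewrite (horner_coef_wide _ (_ : size q^`() <= size q)%N); last first.
    by rewrite ltnW // lt_size_deriv // -size_poly_eq0.
  have [n sz] : exists n, size q = n.+1 by exists (size q).-1; rewrite prednK // lt0n.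
  rewrite mulr_suml sz big_ord_recr [RHS]big_ord_recl /= coef_deriv nth_default ?sz //.
  rewrite mul0rn !mul0r addr0.
  rewrite expr0 mulr1 dq add0r; apply: eq_bigr => i _.
  rewrite coef_deriv (proj2 derD) dq mul0r add0r /= Dexp /bump /= add1n.
  by rewrite exprSr mulrnAr !mulrnAl mulrA.
have : (size q <= 1)%N.
  rewrite leqNgt; apply/negP => lt1; have /polyP/(_ (size q).-2) := dq0.
  rewrite coef0 coef_deriv prednK; last by rewrite -subn1 subn_gt0.
  move=> /eqP; have -> : (size q).-1 = ((size q).-2).+1 by rewrite prednK // -subn1 subn_gt0.
  rewrite -mulr_natr mulf_eq0 (negbTE (charF _)) orbF prednK; last by rewrite -subn1 subn_gt0.
  by rewrite -lead_coefE lead_coef_eq0 -size_poly_eq0 (negbTE sq0).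
move=> /size1_polyC qC; move: qk; rewrite qC hornerC => ->; by rewrite polyC0.
Qed.

End DerivationMatrix.

Section HStack.
Variables (R : Type) (k d n : nat).
(** Each row of [V] is a vectorized matrix; these matrices are placed side by side, so that the left
    kernel of the result is their common left kernel. *)
Definition hstack (V : 'M[R]_(k, d * n)) : 'M[R]_(d, #|{: 'I_k * 'I_n}|) :=
  \matrix_(a < d, l < #|{: 'I_k * 'I_n}|) vec_mx (row (enum_val l).1 V) a (enum_val l).2.
End HStack.

Lemma map_hstack (R S : Type) (f : R -> S) k d n (V : 'M[R]_(k, d * n)) :
  map_mx f (hstack V) = hstack (map_mx f V).
Proof. by apply/matrixP => i j; rewrite !mxE. Qed.

Lemma mulmx_hstack (F : fieldType) k d n r (V : 'M[F]_(k, d * n)) (a : 'M[F]_(r, d)) :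
  a *m hstack V = 0 <-> forall v : 'rV_(d * n), (v <= V)%MS -> a *m vec_mx v = 0.
Proof.
split=> [aV v /submxP[c ->]|aV].
  have aVi i : a *m vec_mx (row i V) = 0.
    apply/matrixP => b j; have /matrixP/(_ b (enum_rank (i, j))) := aV.
    rewrite !mxE => e; rewrite -[RHS]e; apply: eq_bigr => l _.
    by rewrite [in RHS]mxE enum_rankK.
  rewrite mulmx_sum_row linear_sum mulmx_sumr big1 // => i _.
  by rewrite linearZ -scalemxAr aVi scaler0.
apply/matrixP => b l; rewrite !mxE.
have /matrixP/(_ b (enum_val l).2) := aV _ (row_sub (enum_val l).1 V).
by rewrite !mxE => e; rewrite -[RHS]e; apply: eq_bigr => c _; rewrite [in LHS]mxE.
Qed.

Section GaussMap.
Variables (K : numFieldType) (m : nat) (A : 'rV[K]_m -> Prop) (F : function_field A).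
Local Notation d := (ffdim F).
Variables (N : nat) (x : 'rV[F]_N.+1).
Hypothesis eulerx : (x <= jac x)%MS.
Variable f : 'I_d -> 'I_N.+1.
Hypothesis fU : colsub f (jac x) \in unitmx.

Let J := colsub f (jac x).
(* The reduced frame, equal to the identity in the columns [f], of the embedded
   tangent space at the generic point [x]; its entries generate the function field
   of the Gauss image. *)
Definition gauss_frame : 'M[F]_(d, N.+1) := invmx J *m jac x.
Local Notation G := gauss_frame.
Let u := colsub f x.
Let DG i := map_mx (ffder i) G.
Let der i := @ffder_over _ _ _ F i.

Lemma jac_gauss : jac x = J *m G.
Proof. by rewrite mulKVmx. Qed.

Lemma gauss_frame_eq : (G :=: jac x)%MS.
Proof. by apply: eqmxMfull; rewrite row_full_unit unitmx_inv. Qed.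

Lemma colsub_gauss : colsub f G = 1%:M.
Proof. by rewrite /gauss_frame -mulmx_colsub mulVmx. Qed.

Lemma x_gauss : x = u *m G.
Proof.
have : (x <= G)%MS by rewrite gauss_frame_eq.
case/submxP => c xE; rewrite {1}xE /u xE -mulmx_colsub colsub_gauss mulmx1 //.
Qed.

Lemma u_der i : map_mx (ffder i) u = row i J.
Proof. by apply/rowP => j; rewrite !mxE. Qed.

Lemma row_jac_der i : row i (jac x) = map_mx (ffder i) x.
Proof. by apply/rowP => j; rewrite !mxE. Qed.

(** [G] is the identity in the columns [f], so the coordinates of [D x] in the frame [G] are [D u];
    the Leibniz rule for [x = u G] leaves [u D(G) = 0]. *)
Lemma u_gauss_der i : u *m DG i = 0.
Proof.
have : map_mx (ffder i) x = row i J *m G by rewrite -row_jac_der jac_gauss row_mul.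
rewrite {1}x_gauss map_der_mulmx // u_der => /eqP.
by rewrite -subr_eq0 addrAC subrr add0r => /eqP.
Qed.

Lemma u_gauss_derivation D : is_derivation D -> u *m map_mx D G = 0.
Proof.
case/derivation_span => b DE.
have -> : map_mx D G = \sum_i b 0 i *: DG i.
  by apply/matrixP => i j; rewrite mxE DE summxE; apply: eq_bigr => k _; rewrite !mxE.
rewrite mulmx_sumr big1 // => i _.
by rewrite -scalemxAr u_gauss_der scaler0.
Qed.

(* Symmetry of the second fundamental form. *)
Lemma gauss_sym i k : row i J *m DG k = row k J *m DG i.
Proof.
(* The commutator is a derivation, so [u] kills its action on [G]; then [u DG_k = 0] and
   [u DG_i = 0] are differentiated crosswise. *)
pose D y := ffder i (ffder k y) - ffder k (ffder i y).
have derD : is_derivation D.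
  split=> [|c]; last first.
    by rewrite /D !(proj2 (ffder_is_derivation _)) !(derivation_over0 (der _)) subrr.
  split=> a b; rewrite /D.
    by rewrite !(proj1 (der _)) opprD addrACA.
  by rewrite !(proj2 (der _)) !(proj1 (der _)) !(proj2 (der _)) /=; ring.
have := u_gauss_derivation derD.
have -> : map_mx D G = map_mx (ffder i) (DG k) - map_mx (ffder k) (DG i).
  by apply/matrixP => a b; rewrite !mxE.
rewrite mulmxBr => /eqP; rewrite subr_eq0 => /eqP e.
have h1 := congr1 (map_mx (ffder i)) (u_gauss_der k).
have h2 := congr1 (map_mx (ffder k)) (u_gauss_der i).
move: h1 h2; rewrite !map_der_mulmx // !map_der0 // !u_der e => /eqP + /eqP.
by rewrite !addr_eq0 => /eqP -> /eqP ->.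
Qed.

Definition gauss_point : 'rV[F]_(d * N.+1) := mxvec G.
Local Notation gp := gauss_point.

Lemma row_jac_gp i : row i (jac gp) = mxvec (DG i).
Proof.
apply/rowP => l; case/mxvec_indexP: l => a b.
by rewrite !mxE mxvecE mxE /gauss_point !mxvecE.
Qed.

Lemma vec_jac_gp (b : 'rV_d) : vec_mx (b *m jac gp) = \sum_i b 0 i *: DG i.
Proof.
rewrite mulmx_sum_row linear_sum; apply: eq_bigr => i _.
by rewrite linearZ /= row_jac_gp mxvecK.
Qed.

Lemma gauss_swap (b : 'rV_d) i :
  b *m J *m DG i = row i J *m vec_mx (b *m jac gp).
Proof.
rewrite vec_jac_gp mulmx_sumr [b *m J]mulmx_sum_row mulmx_suml.
by apply: eq_bigr => k _; rewrite -scalemxAl -scalemxAr gauss_sym.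
Qed.

(** By symmetry, [b J] is killed by all [DG i] exactly when all rows of the invertible [J] kill the
    derivative of [G] along [b]. *)
Lemma hstack_gauss (b : 'rV_d) : b *m J *m hstack (jac gp) = 0 <-> b *m jac gp = 0.
Proof.
split=> [/mulmx_hstack H|bG].
  apply: (can_inj (@vec_mxK _ _ _)); rewrite linear0.
  apply: (can_inj (mulKmx fU)); rewrite -/J mulmx0; apply/row_matrixP => i.
  rewrite row_mul row0 -gauss_swap -(mxvecK (DG i)) -row_jac_gp; apply: H.
  exact: row_sub.
apply/mulmx_hstack => v /submxP[c ->]; rewrite vec_jac_gp mulmx_sumr big1 // => i _.
by rewrite -scalemxAr gauss_swap bG linear0 mulmx0 scaler0.
Qed.

Lemma rank_hstack_gauss : \rank (hstack (jac gp)) = \rank (jac gp).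
Proof.
have e : (kermx (hstack (jac gp)) :=: kermx (jac gp) *m J)%MS.
  apply/eqmxP/andP; split; apply/rV_subP => a.
    move/sub_kermxP => a0; apply/submxP; exists (a *m invmx J *m pinvmx (kermx (jac gp))).
    rewrite mulmxA mulmxKpV ?mulmxKV //; apply/sub_kermxP/hstack_gauss.
    by rewrite mulmxKV.
  case/submxP => c ->; apply/sub_kermxP; rewrite mulmxA; apply/hstack_gauss.
  by rewrite -mulmxA mulmx_ker mulmx0.
have := mxrank_ker (hstack (jac gp)); rewrite e mxrankMfree ?row_free_unit //.
rewrite mxrank_ker; have := rank_leq_row (jac gp); have := rank_leq_row (hstack (jac gp)).
by move=> h1 h2 h3; lia.
Qed.

Lemma u_hstack : u *m hstack (jac gp) = 0.
Proof.
apply/mulmx_hstack => v /submxP[c ->]; rewrite vec_jac_gp mulmx_sumr big1 // => i _.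
by rewrite -scalemxAr u_gauss_der scaler0.
Qed.

(** The Euler derivation: moving [x] along its own line leaves the tangent space fixed. *)
Lemma euler_exists : exists2 b : 'rV_d, b *m jac gp = 0 & b *m jac x = x.
Proof.
case/submxP: eulerx => b xE; exists b => //; apply/hstack_gauss.
have -> : b *m J = u by rewrite /u [in RHS]xE -mulmx_colsub.
exact: u_hstack.
Qed.

Definition gauss_pluecker := pluecker G.
Local Notation P := gauss_pluecker.

Lemma pluecker_pivot : P 0 (enum_rank (finfun f)) = 1.
Proof.
rewrite mxE enum_rankK (_ : colsub _ G = 1%:M) ?det1 // -colsub_gauss.
by apply/matrixP => i j; rewrite !mxE ffunE.
Qed.

(* The determinant is that of the identity with column [i] replaced by column [c]
   of [G]. *)
Lemma pluecker_entry i c :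
  P 0 (enum_rank [ffun k => if k == i then c else f k]) = G i c.
Proof.
rewrite mxE enum_rankK (expand_det_row _ i).
rewrite (bigD1 i) //= big1 ?addr0 => [|k ki].
  rewrite !mxE ffunE eqxx /cofactor addnn -mul2n exprM sqrrN expr1n expr1n mul1r.
  rewrite (_ : row' i _ = 1%:M) ?det1 ?mulr1 //.
  apply/matrixP => a b; rewrite !mxE ffunE [lift i b == i]eq_sym (negbTE (neq_lift i b)).
  by have /matrixP/(_ (lift i a) (lift i b)) := colsub_gauss;
    rewrite !mxE (inj_eq lift_inj) => ->.
rewrite !mxE ffunE (negbTE ki); have /matrixP/(_ i k) := colsub_gauss.
by rewrite !mxE => ->; rewrite eq_sym (negbTE ki) mul0r.
Qed.

(** The entries of [G] occur among the Plücker coordinates, which in turn are determinants in these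
    entries. *)
Lemma jac_pluecker_eq0 (b : 'rV_d) : b *m jac P = 0 <-> b *m jac gp = 0.
Proof.
have [derb _] := comb_is_derivation b; set D := fun y => _ in derb.
rewrite !jac_comb; split=> [/rowP P0|/rowP G0]; apply/rowP => l; rewrite !mxE.
  case/mxvec_indexP: l => i c; rewrite mxvecE -pluecker_entry.
  by have := P0 (enum_rank [ffun k => if k == i then c else f k]); rewrite !mxE.
rewrite -/(D _); apply: (derivation_det0 derb); apply/matrixP => i c.
rewrite [LHS]mxE [RHS]mxE [colsub _ _ i c]mxE.
by have := G0 (mxvec_index i (enum_val l c)); rewrite [LHS]mxE [RHS]mxE /gauss_point mxvecE.
Qed.

(** [x 0 j] serves as the scaling parameter of the cone. It can be read off at the pivot coordinate,
    where [P] is 1, and the Euler derivation moves it while fixing [P]; this accounts for the extra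
    dimension. *)
Lemma rank_jac_pluecker_cone j : x 0 j != 0 ->
  \rank (jac (x 0 j *: P)) = (\rank (jac gp)).+1.
Proof.
move=> xj; have [b bG bx] := euler_exists.
pose k : 'cV[F]_d := \col_i ffder i (x 0 j).
have bk : (b *m k) 0 0 = x 0 j.
  have /rowP/(_ j) := bx; rewrite mxE => e; rewrite -[RHS]e mxE.
  by apply: eq_bigr => i _; rewrite !mxE.
have kerE (c : 'rV_d) : c *m jac (x 0 j *: P) = 0 <-> c *m jac gp = 0 /\ c *m k = 0.
  have [derc _] := comb_is_derivation c; set D := fun y => _ in derc.
  have ck : (c *m k) 0 0 = D (x 0 j) by rewrite mxE; apply: eq_bigr => i _; rewrite mxE.
  have cJ l : (c *m jac (x 0 j *: P)) 0 l = D (x 0 j) * P 0 l + x 0 j * D (P 0 l).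
    by rewrite jac_comb mxE; have := proj2 derc (x 0 j) (P 0 l); rewrite /D => <-; apply: eq_bigr => i _; rewrite mxE.
  split=> [/rowP c0|[/jac_pluecker_eq0/rowP cP /rowP ck0]].
    have Dx : D (x 0 j) = 0.
      have := c0 (enum_rank (finfun f)); rewrite cJ pluecker_pivot mulr1.
      by rewrite (derivation_over1 derc) mulr0 addr0 mxE.
    split; last by apply/rowP => i; rewrite ord1 ck Dx mxE.
    apply/jac_pluecker_eq0/rowP => l; have := c0 l.
    rewrite cJ Dx mul0r add0r jac_comb !mxE => /eqP.
    by rewrite mulf_eq0 (negbTE xj) => /eqP.
  apply/rowP => l; have := cP l; have := ck0 0.
  by rewrite cJ ck jac_comb !mxE -/(D _) => -> ->; rewrite mul0r mulr0 addr0.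
have e : (kermx (jac (x 0 j *: P)) :=: kermx (jac gp) :&: kermx k)%MS.
  apply/eqmxP/andP; split; apply/rV_subP => c.
    by move/sub_kermxP/kerE => [cG ck]; rewrite sub_capmx; apply/andP; split; apply/sub_kermxP.
  rewrite sub_capmx => /andP[/sub_kermxP cG /sub_kermxP ck]; apply/sub_kermxP/kerE.
  by split.
(* The Euler derivation [b] lies in the first kernel, and [b *m k] is [x 0 j]. *)
have rk1 : \rank (kermx (jac gp) *m k) = 1%N.
  apply/eqP; rewrite eqn_leq rank_leq_col /= lt0n mxrank_eq0; apply/negP => /eqP k0.
  have /submxP[c cE] : (b <= kermx (jac gp))%MS by apply/sub_kermxP.
  by move: xj; rewrite -bk cE -mulmxA k0 mulmx0 mxE eqxx.
have := mxrank_mul_ker (kermx (jac gp)) k; rewrite -e !mxrank_ker rk1.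
have := rank_leq_row (jac gp); have := rank_leq_row (jac (x 0 j *: P)).
by move=> h1 h2 h3; lia.
Qed.

Definition pluecker_line p : {poly F} :=
  mmap (@polyC F \o ffC F)%FUN (fun l => (P 0 l)%:P * 'X) p.

Lemma pluecker_lineE p c : (pluecker_line p).[c] = ffeval (c *: P) p.
Proof.
pose g : {rmorphism {mpoly K[_]} -> F} := (horner_eval c \o
  mmap (@polyC F \o ffC F)%FUN (fun l => (P 0 l)%:P * 'X))%FUN.
apply: (@eq_rmorph_mpoly _ _ _ g (ffeval (c *: P))) => [a|l] /=; rewrite /horner_eval.
  by rewrite mmapC /= hornerC ffevalC.
rewrite mmap_mpolyX ffevalX hornerM hornerC hornerX [RHS]mxE; exact: mulrC.
Qed.

(** By the Euler derivation [x 0 j] is transcendental over the field of the Gauss image, so an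
    equation holding at [x 0 j *: P] holds on the whole line through [P]. *)
Lemma pluecker_line_eq0 j p : x 0 j != 0 ->
  ffeval (x 0 j *: P) p = 0 -> pluecker_line p = 0.
Proof.
move=> xj; have [b bG bx] := euler_exists.
have [derb Cb] := comb_is_derivation b; set D := fun y => _ in derb Cb.
rewrite -pluecker_lineE => q0; apply: (euler_transcendental derb (@ff_charE _ _ _ F) xj _ _ q0).

- by have /rowP/(_ j) := bx; rewrite jac_comb mxE.
have DP l : D (P 0 l) = 0.
  by have /jac_pluecker_eq0/rowP/(_ l) := bG; rewrite jac_comb !mxE.
rewrite /pluecker_line => {q0}; elim/mpoly_ring_ind: p => [c|l|p q IHp IHq|p q IHp IHq] i.
- rewrite mmapC coefC; case: eqP => _; first exact: Cb.
  exact: derivation_over0 derb.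
- rewrite mmap_mpolyX coefCM coefX (proj2 derb) DP mul0r add0r.
  by case: eqP => _ /=; rewrite ?(derivation_over1 derb) ?(derivation_over0 derb) mulr0.
- by rewrite rmorphD coefD (proj1 derb) IHp IHq addr0.
rewrite rmorphM coefM (derivation_over_sum derb) big1 // => l _.
by rewrite (proj2 derb) IHp IHq mul0r mulr0 addr0.
Qed.

End GaussMap.

Section FamilyMap.
Variables (K : numFieldType) (N m : nat) (B : variety K m) (X : family N B).
Local Notation k := (rdim X).+1.
Let irr : zirreducible B := points_irreducible B.

Definition family_map : 'rV[{mpoly K[m + k]}]_N.+1 :=
  right_coords K m k *m map_mx (poly_comp (left_coords K m k)) (frame X).

Lemma total_irr : zirreducible (total (X:=X)).
Proof. exact: (@prod_affine_irr K m B k irr). Qed.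

Lemma family_map_spec z : family_map^@z = rsubmx z *m ruling X (lsubmx z).
Proof. by rewrite map_mxM spec_right spec_map_comp spec_left. Qed.

Lemma family_map_jacobian (z v : 'rV[K]_(m + k)) :
  v *m (jacobian family_map)^@z =
  rsubmx v *m ruling X (lsubmx z) + rsubmx z *m dframe X (lsubmx z) (lsubmx v).
Proof.
apply/rowP => j; rewrite !mxE.
pose d (q : {mpoly K[m + k]}) := \sum_i v 0 i * (mderiv i q).@[z 0].
have derd : derivation_over (meval (z 0)) d := vector_derivation (meval (z 0)) v.
have dX i : d 'X_i = v 0 i.
  rewrite /d (bigD1 i) //= mderivXU eqxx meval1 mulr1 big1 ?addr0 // => l li.
  by rewrite mderivXU (negbTE li) meval0 mulr0.
have dcomp q : d (poly_comp (left_coords K m k) q) =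
    \sum_i lsubmx v 0 i * (mderiv i q).@[(lsubmx z) 0].
  rewrite /d meval_chain spec_left; apply: eq_bigr => i _; congr (_ * _).
  rewrite mxE (bigD1 (lshift k i)) //= big1 ?addr0 => [|l li].
    by rewrite !mxE mderivXU eqxx meval1 mulr1.
  by rewrite !mxE mderivXU (negbTE li) meval0 mulr0.
transitivity (d (family_map 0 j)).
  by apply: eq_bigr => i _; rewrite !mxE.
rewrite [family_map 0 j]mxE (derivation_over_sum derd) -big_split /=.
apply: eq_bigr => a _; rewrite (proj2 derd) !mxE dX dcomp poly_compE spec_left mevalXU.
congr (_ + _ * _); rewrite summxE; apply: eq_bigr => i _.
by rewrite !mxE.
Qed.

Lemma embedded_tangent_map b (s : 'rV[K]_k) w : B b ->
  embedded_tangent b s w <-> exists2 v, zariski_tangent (total (X:=X)) (row_mx b s) v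
    & w = v *m (jacobian family_map)^@(row_mx b s).
Proof.
move=> Bb; have Az : total (X:=X) (row_mx b s) by rewrite /total row_mxKl.
split=> [[v [t [vt ->]]]|[v /(tangent_prod v Az) vt ->]].
  exists (row_mx v t); last by rewrite family_map_jacobian !row_mxKl !row_mxKr.
  by apply/(tangent_prod _ Az); rewrite !row_mxKl.
exists (lsubmx v), (rsubmx v); split; first by move: vt; rewrite row_mxKl.
by rewrite family_map_jacobian !row_mxKl !row_mxKr.
Qed.

Lemma embedded_tangent_frame b (s : 'rV[K]_k) w r (V : 'M_(r, m + k)) : B b ->
  (forall v, zariski_tangent (total (X:=X)) (row_mx b s) v <-> (v <= V)%MS) ->
  embedded_tangent b s w <-> (w <= V *m (jacobian family_map)^@(row_mx b s))%MS.
Proof.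
move=> Bb VT; rewrite embedded_tangent_map //; split=> [[v /VT/submxP[c ->] ->]|].
  by rewrite -mulmxA submxMl.
by case/submxP => c ->; exists (c *m V); [apply/VT/submxMl | rewrite mulmxA].
Qed.

Lemma embedded_tangent_at z w r (V : 'M_(r, m + k)) : total (X:=X) z ->
  (forall v, zariski_tangent (total (X:=X)) z v <-> (v <= V)%MS) ->
  embedded_tangent (X:=X) (lsubmx z) (rsubmx z) w <-> (w <= V *m (jacobian family_map)^@z)%MS.
Proof.
by move=> Az; have := @embedded_tangent_frame (lsubmx z) (rsubmx z) w r V Az; rewrite hsubmxK.
Qed.

Lemma ruling_embedded_tangent b (s : 'rV[K]_k) t : embedded_tangent b s (t *m ruling X b).
Proof.
exists 0, t; split; last first.
  by rewrite /dframe big1 ?mulmx0 ?addr0 // => i _; rewrite mxE scale0r.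
by move=> p Bp; rewrite big1 // => i _; rewrite mxE mul0r.
Qed.

Lemma image_cone_vanishes m' (A : 'rV[K]_m' -> Prop) (F : function_field A)
    (zeta : 'rV[F]_(m + k)) p : generic_point (total (X:=X)) zeta ->
  vanishes_on (image_cone X) p <-> ffeval (map_mx (ffeval zeta) family_map) p = 0.
Proof.
move=> zE; rewrite ffeval_comp -/(poly_comp family_map p) -zE; split=> [H|H _ [b [s [Bb fr ->]]]].
  (* The image cone only contains points over those [b] with a free frame; the factor [h] removes
     the others. *)
  have [h nh hP] := @generic_left K m B k _ (frame_free X).
  have : vanishes_on (total (X:=X)) (h * poly_comp family_map p).
    move=> z Az; rewrite mevalM poly_compE; have [->|hz] := eqVneq h.@[z 0] 0.
      by rewrite mul0r.
    rewrite H ?mulr0 //; exists (lsubmx z), (rsubmx z); split=> //.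
      exact: hP.
    by rewrite family_map_spec.
  by case/(zirreducible_prime total_irr).
have := H (row_mx b s); rewrite poly_compE family_map_spec row_mxKl row_mxKr; apply.
by rewrite /total row_mxKl.
Qed.

End FamilyMap.

Lemma zclosure_congr (K : fieldType) m (A A' : 'rV[K]_m -> Prop) :
  (forall p, vanishes_on A p <-> vanishes_on A' p) -> forall x, zclosure A x <-> zclosure A' x.
Proof. by move=> AA' x; split=> H p /AA'; apply: H. Qed.

Lemma smooth_total (K : numFieldType) N m (B : variety K m) (X : family N B) b s :
  B b -> smooth_at B b -> exists d (V : 'M_(d, m + (rdim X).+1)),
    has_dim (total (X:=X)) d /\ row_basis V (zariski_tangent (total (X:=X)) (row_mx b s)).
Proof.
move=> Bb [d [T [dimB [frT TT]]]]; exists (d + (rdim X).+1)%N, (block_mx T 0 0 1%:M).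
have Az : total (X:=X) (row_mx b s) by rewrite /total row_mxKl.
split; first exact: has_dim_prod (points_irreducible B) dimB.
split; first by rewrite /row_free rank_diag_block_mx (eqP frT) mxrank1.
move=> v; rewrite (tangent_prod v Az) row_mxKl TT; split=> [/submxP[c cE]|/submxP[c ->]].
  apply/submxP; exists (row_mx c (rsubmx v)).
  by rewrite mul_row_block !mulmx0 addr0 add0r mulmx1 -cE hsubmxK.
by rewrite -[c]hsubmxK mul_row_block mulmx0 addr0 row_mxKl submxMl.
Qed.

Section Pluecker.
Variables (R : comNzRingType) (r N : nat).
(** [pluecker] over a ring, for frames with polynomial entries. *)
Definition plueckerR (W : 'M[R]_(r, N.+1)) : 'rV[R]_#|{ffun 'I_r -> 'I_N.+1}| :=
  \row_j \det (colsub (enum_val j : {ffun 'I_r -> 'I_N.+1}) W).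

Lemma plueckerR_mul (C : 'M_r) W : plueckerR (C *m W) = \det C *: plueckerR W.
Proof. by apply/rowP => j; rewrite !mxE -mulmx_colsub det_mulmx. Qed.

End Pluecker.

Lemma map_plueckerR (R S : comNzRingType) (f : {rmorphism R -> S}) r N (W : 'M_(r, N.+1)) :
  map_mx f (plueckerR W) = plueckerR (map_mx f W).
Proof. by apply/rowP => j; rewrite !mxE -det_map_mx map_mxsub. Qed.

(** * The generic point of the Gauss cone *)

Section GaussCone.
Variables (K : numFieldType) (N m : nat) (B : variety K m) (X : family N B).
Let irr : zirreducible B := points_irreducible B.
Let irrT := total_irr X.
Variable F : function_field (total (X:=X)).
Local Notation r := (ffdim F).
Local Notation phi := (family_map X).
Let x := map_mx (ff F) phi.

(** [gauss_cone] with a free rank [t], so that [ffdim F] can stand for [n.+1] without a cast. *)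
Definition gauss_cone_rank t (y : 'rV[K]_#|{ffun 'I_t -> 'I_N.+1}|) : Prop :=
  exists b (s : 'rV[K]_(rdim X).+1) (W : 'M[K]_(t, N.+1)),
    [/\ B b, smooth_at B b, row_basis W (embedded_tangent b s)
      & y = pluecker W].

Let JX := fftan F *m jacobian phi.

Lemma jac_family : jac x = map_mx (ff F) JX.
Proof. exact: jac_ff. Qed.

Lemma family_map_euler : (x <= jac x)%MS.
Proof.
rewrite jac_family; apply: generic_submx => //.
apply: generic_imp (generic_tangent F irrT) => z Az [_ VT].
rewrite family_map_spec [X in (_ <= X)%MS]map_mxM; apply/(embedded_tangent_at _ Az VT).
exact: ruling_embedded_tangent.
Qed.

Lemma family_map_neq0 : x != 0.
Proof.
apply/negP => /eqP x0; have [b Bb frb] := generic_exists (frame_free X).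
have Az : total (X:=X) (row_mx b (delta_mx 0 0)) by rewrite /total row_mxKl.
have := map_mx_ff_eq0 x0 Az; rewrite family_map_spec row_mxKl row_mxKr => /eqP.
rewrite mulmx_free_eq0 // => /eqP/rowP/(_ 0)/eqP.
by rewrite !mxE eqxx oner_eq0.
Qed.

Lemma ffdim_gt0 : (0 < r)%N.
Proof.
rewrite lt0n; apply: contraNneq family_map_neq0 => r0; rewrite -mxrank_eq0 -leqn0.
by rewrite (leq_trans (mxrankS family_map_euler)) // -r0 rank_leq_row.
Qed.

(** A tangent frame at the given smooth point extends to polynomial vector fields tangent
    everywhere, whose images in projective space are generic combinations of [jac x]. Equations at
    the generic point thus specialize to special smooth points. *)
Lemma gauss_cone_frame y : gauss_cone_rank (t:=r) y ->
  exists V : 'M[{mpoly K[m + (rdim X).+1]}]_(r, N.+1), exists C : 'M[F]_r,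
    exists2 z, total (X:=X) z & [/\ y = (plueckerR V)^@z, row_free (V^@z)
      & map_mx (ff F) V = C *m jac x].
Proof.
case=> b [s [W [Bb smb [frW WT] ->]]].
have Az : total (X:=X) (row_mx b s) by rewrite /total row_mxKl.
have [d [V0 [dimT VT]]] := smooth_total s Bb smb.
have dE : d = r := has_dim_unique dimT (has_dim_ff F).
subst d; have [V V0E Vtan] := smooth_frame irrT dimT Az VT.
have sW : (W <= V^@(row_mx b s) *m (jacobian phi)^@(row_mx b s))%MS.
  apply/row_subP => i; rewrite -embedded_tangent_frame //; first by apply/WT/row_sub.
  by case: VT => _ VT; rewrite V0E.
case/submxP: sW => Q0 QE.
have Vle : (map_mx (ff F) V <= map_mx (ff F) (fftan F))%MS.
  apply: generic_submx => //; apply: generic_imp (generic_tangent F irrT) => z Azz [_ H].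
  by apply/row_subP => i; apply/H/Vtan.
case/submxP: Vle => E EE.
exists (map_mx (@mpolyC _ K) Q0 *m (V *m jacobian phi)),
  (map_mx (ff F) (map_mx (@mpolyC _ K) Q0) *m E), (row_mx b s) => //; split.
- by rewrite map_plueckerR !map_mxM spec_const -QE.
- by rewrite !map_mxM spec_const -QE.
by rewrite !map_mxM EE jac_family map_mxM !mulmxA.
Qed.

(** An immersion at one point is one at the generic point, by semicontinuity. *)
Lemma row_free_jac_family : (exists y, gauss_cone_rank (t:=r) y) -> row_free (jac x).
Proof.
case=> y /gauss_cone_frame[V [C [z Az [_ fr VE]]]].
rewrite /row_free eqn_leq rank_leq_row /= -{1}(eqP fr).
by rewrite (leq_trans (rank_spec_le F V Az)) // VE mxrankM_maxr.
Qed.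

Hypothesis freex : row_free (jac x).

Lemma generic_family_tangent : generic (total (X:=X)) (fun z =>
  row_basis (JX^@z) (embedded_tangent (X:=X) (lsubmx z) (rsubmx z))).
Proof.
apply: generic_imp (generic_and irrT (generic_tangent F irrT) (rank_spec F JX)) => z Az [[_ VT]].
rewrite -jac_family (eqP freex) => rk; split; first by rewrite /row_free rk.
by move=> w; rewrite map_mxM; exact: embedded_tangent_at.
Qed.

Lemma generic_smooth : generic (total (X:=X)) (fun z => smooth_at B (lsubmx z)).
Proof.
have [FB] := function_field_exists irr; apply: (@generic_left _ _ B).
apply: generic_imp (generic_tangent FB irr) => b Bb tanb.
by exists (ffdim FB), ((fftan FB)^@b); split=> //; exact: has_dim_ff.
Qed.

Variable f : 'I_r -> 'I_N.+1.
Hypothesis fU : colsub f (jac x) \in unitmx.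
Local Notation P := (gauss_pluecker x f).

(** At a general point the frame [JX] has Plücker vector [\det (colsub f (jac x))] times [P], and
    changing the basis realizes all further scalings by [c]. *)
Lemma gauss_cone_scale p (c : K) : c != 0 -> vanishes_on (gauss_cone_rank (t:=r)) p ->
  (pluecker_line x f p).[ffC F c * \det (colsub f (jac x))] = 0.
Proof.
move=> c0 pv; rewrite pluecker_lineE -scalerA -plueckerR_mul.
rewrite -[colsub f (jac x) *m _]jac_gauss // jac_family -map_plueckerR.
have -> : ffC F c *: map_mx (ff F) (plueckerR JX) = map_mx (ff F) (c%:MP *: plueckerR JX).
  by apply/rowP => l; rewrite !mxE rmorphM.
rewrite ffeval_poly; apply/ff_ker; rewrite -/(poly_comp (c%:MP *: plueckerR JX) p).
have gen := generic_and irrT generic_smooth generic_family_tangent.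
have [h nh hP] := gen.
have : vanishes_on (total (X:=X)) (h * poly_comp (c%:MP *: plueckerR JX) p).
  move=> z Az; rewrite mevalM poly_compE; have [->|hz] := eqVneq h.@[z 0] 0.
    by rewrite mul0r.
  have [smz [frJ JT]] := hP z Az hz; rewrite pv ?mulr0 //.
  have r0 := ffdim_gt0.
  (* Scaling one basis vector multiplies the Plücker vector by [c]; this takes a positive rank. *)
  pose D : 'M[K]_r := diag_mx (\row_i if i == Ordinal r0 then c else 1).
  have detD : \det D = c.
    rewrite det_diag (bigD1 (Ordinal r0)) //= big1 ?mxE ?eqxx ?mulr1 // => i ne.
    by rewrite mxE (negbTE ne).
  have DU : D \in unitmx by rewrite unitmxE detD unitfE.
  exists (lsubmx z), (rsubmx z), (D *m JX^@z); split=> //.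
    have DJ : (D *m JX^@z :=: JX^@z)%MS by apply: eqmxMfull; rewrite row_full_unit.
    by split=> [|w]; rewrite /row_free DJ // JT.
  rewrite -[pluecker _]/(plueckerR _) plueckerR_mul detD.
  by apply/rowP => l; rewrite !mxE mevalM mevalC -det_map_mx map_mxsub.
by case/(zirreducible_prime irrT).
Qed.

(** An equation of the cone has infinitely many roots on the line through [P], so it vanishes on
    this line. Conversely, every point of the cone is a specialization of a point of the line. *)
Lemma gauss_cone_vanishes j p : x 0 j != 0 ->
  vanishes_on (gauss_cone_rank (t:=r)) p <-> ffeval (x 0 j *: P) p = 0.
Proof.
move=> xj; rewrite -pluecker_lineE; split=> [pv|q0].
  suff -> : pluecker_line x f p = 0 by rewrite horner0.
  have dJ : \det (colsub f (jac x)) != 0 by rewrite -unitfE -unitmxE.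
  (* Distinct by characteristic 0; the shift [i.+1] keeps the scalings nonzero. *)
  pose rt i : F := ffC F (i.+1)%:R * \det (colsub f (jac x)).
  apply: (@roots_geq_poly_eq0 _ _ [seq rt i | i <- iota 0 (size (pluecker_line x f p))]).
  - apply/allP => y /mapP[i _ ->]; rewrite /root /rt gauss_cone_scale //.
    by rewrite pnatr_eq0.
  - rewrite map_inj_uniq ?iota_uniq // => i l /(mulIf dJ)/fmorph_inj/eqP.
    by rewrite eqr_nat => /eqP [].
  - by rewrite size_map size_iota.
have line0 : pluecker_line x f p = 0.
  apply: (pluecker_line_eq0 family_map_euler fU xj).
  by rewrite -pluecker_lineE.
move=> y /gauss_cone_frame[V [C [z Az [-> _ VE]]]].
have : ffeval (map_mx (ff F) (plueckerR V)) p = 0.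
  rewrite map_plueckerR VE (jac_gauss fU) mulmxA plueckerR_mul.
  by rewrite -[plueckerR _]/P -pluecker_lineE line0 horner0.
by rewrite ffeval_poly_eq0; apply.
Qed.

Lemma gauss_rank g : has_dim (gauss_cone_rank (t:=r)) g.+1 ->
  \rank (jac (gauss_point x f)) = g.
Proof.
move=> dimG.
have [j xj] : exists j, x 0 j != 0.
  apply: contrapT => H; case/eqP: family_map_neq0; apply/rowP => j.
  by rewrite [RHS]mxE; apply: contrapT => /eqP nz; apply: H; exists j.
have := has_dim_generic_point (fun p => gauss_cone_vanishes p xj).
rewrite rank_jac_pluecker_cone //; last exact: family_map_euler.
by move/(has_dim_unique dimG) => -[].
Qed.

End GaussCone.

Section PointClosure.
Variables (K : numFieldType) (m : nat) (A : 'rV[K]_m -> Prop) (F : function_field A).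
Variables (q : nat) (xi : 'rV[F]_q).

Definition point_closure (y : 'rV[K]_q) : Prop := forall p, ffeval xi p = 0 -> p.@[y 0] = 0.

Lemma point_closure_closed : zclosed point_closure.
Proof. by exists (fun p => ffeval xi p = 0). Qed.

(** There are enough points over [K]: [xi] can be evaluated at all points of [A] where its common
    denominator is nonzero. *)
Lemma point_closure_generic : generic_point point_closure xi.
Proof.
have [h h0 [phi phiE]] := common_denominator (@ff_frac _ _ _ F) xi.
move=> p; split=> [pv|p0 y]; last exact.
apply/(ffeval_spec h0 phiE) => x Ax hx; apply: pv => p' /(ffeval_spec h0 phiE).
exact.
Qed.

Lemma point_closure_irr : zirreducible point_closure.
Proof. exact: generic_point_irr point_closure_generic. Qed.

End PointClosure.

(** * The ruling over the Gauss image *)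

Section ReducedFamily.
Variables (K : numFieldType) (m : nat) (A : 'rV[K]_m -> Prop) (F : function_field A).
Local Notation d := (ffdim F).
Variables (N : nat) (x : 'rV[F]_N.+1).
Hypothesis eulerx : (x <= jac x)%MS.
Variable f : 'I_d -> 'I_N.+1.
Hypothesis fU : colsub f (jac x) \in unitmx.
Local Notation G := (gauss_frame x f).
Local Notation gp := (gauss_point x f).
Local Notation q := (d * N.+1)%N.
Variables (r : nat).
Hypothesis rE : (r.+1 + \rank (jac gp) = d)%N.

(* An affine chart of the Gauss image. *)
Definition gauss_base : variety K q :=
  Variety (point_closure_closed gp) (point_closure_irr gp).

Let gen : generic_point gauss_base gp := point_closure_generic gp.

(** The tautological frame: at a point [y] of the base it is the matrix [y]. *)
Definition generic_mx : 'M[{mpoly K[q]}]_(d, N.+1) := vec_mx (\row_j 'X_j).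

Lemma generic_mx_spec y : generic_mx^@y = vec_mx y.
Proof. by apply/matrixP => i j; rewrite !mxE mevalXU. Qed.

Lemma generic_mx_gauss : map_mx (ffeval gp) generic_mx = G.
Proof.
rewrite -[RHS]mxvecK; apply/matrixP => i j; rewrite !mxE ffevalX.
by rewrite /gauss_point.
Qed.

Lemma row_free_gauss : row_free G.
Proof.
apply/row_freeP; exists (\matrix_(c, i) (c == f i)%:R); rewrite -(colsub_gauss fU).
apply/matrixP => i j; rewrite mxE [RHS]mxE (bigD1 (f j)) //= big1 => [|c cj].
  by rewrite mxE eqxx mulr1 addr0.
by rewrite mxE (negbTE cj) mulr0.
Qed.

(** The row space of [jac gp] is the tangent space of the Gauss image, which has a frame with
    coefficients in the coordinates of that image. The common left kernel is computed over its own
    function field and then carried to [F]. *)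
Lemma kernel_frame : exists U : 'M[{mpoly K[q]}]_(r.+1, d),
  [/\ row_free (map_mx (ffeval gp) U),
      (map_mx (ffeval gp) U :=: kermx (hstack (jac gp)))%MS
    & generic gauss_base (fun y => forall v, zariski_tangent gauss_base y v ->
        U^@y *m vec_mx v = 0)].
Proof.
have irrB := points_irreducible gauss_base.
have [FB] := function_field_exists irrB.
have eqV := generic_point_tangent FB gen.
pose E := hstack (fftan FB).
have kerE p : ff FB p = 0 <-> ffeval gp p = 0 by rewrite ff_ker; exact: gen.
have EJ (a : 'rV_d) : a *m map_mx (ffeval gp) E = 0 <-> a *m hstack (jac gp) = 0.
  rewrite map_hstack; split=> /mulmx_hstack H; apply/mulmx_hstack => v le_v; apply: H.
    by rewrite eqV.
  by rewrite -eqV.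
have kerEJ : (kermx (map_mx (ffeval gp) E) :=: kermx (hstack (jac gp)))%MS.
  by apply/eqmxP/andP; split; apply/rV_subP => a /sub_kermxP/EJ H; apply/sub_kermxP.
have rkE : \rank (kermx (map_mx (ff FB) E)) = r.+1.
  rewrite mxrank_ker -(rank_map_mx_eq kerE) -mxrank_ker kerEJ mxrank_ker.
  by rewrite rank_hstack_gauss // -{1}rE addnK.
have [h h0 [U0 U0E]] := common_denominator (@ff_frac _ _ _ FB) (row_base (kermx (map_mx (ff FB) E))).
pose U : 'M_(r.+1, d) := castmx (rkE, erefl) U0.
have UE : (map_mx (ff FB) U :=: kermx (map_mx (ff FB) E))%MS.
  rewrite map_castmx; apply: eqmx_trans (eqmx_cast _ _) _.
  by rewrite U0E; apply: eqmx_trans (eqmx_scale _ h0) (eq_row_base _).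
have UE0 : map_mx (ff FB) (U *m E) = 0 by rewrite map_mxM; apply/sub_kermxP; rewrite UE.
have rkU : \rank (map_mx (ffeval gp) U) = r.+1 by rewrite (rank_map_mx_eq kerE) UE.
exists U; split; first by rewrite /row_free rkU.
  apply/eqmxP; rewrite -(geq_leqif (mxrank_leqif_eq _)).
    by rewrite rkU mxrank_ker rank_hstack_gauss // -{1}rE addnK.
  rewrite -kerEJ; apply/sub_kermxP; rewrite -map_mxM.
  apply/matrixP => i j; have /matrixP/(_ i j) := UE0.
  by rewrite [LHS]mxE [RHS]mxE => /kerE e; rewrite [LHS]mxE [RHS]mxE.
apply: generic_imp (generic_tangent FB irrB) => y By [_ VT] v /VT le_v.
have : U^@y *m hstack ((fftan FB)^@y) = 0.
  by rewrite -map_hstack -map_mxM (map_mx_ff_eq0 UE0).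
by move/mulmx_hstack; apply.
Qed.

Section WithKernel.
Variable U : 'M[{mpoly K[q]}]_(r.+1, d).
Hypothesis freeU : row_free (map_mx (ffeval gp) U).
Hypothesis kerU : (map_mx (ffeval gp) U :=: kermx (hstack (jac gp)))%MS.
Hypothesis tanU : generic gauss_base (fun y => forall v, zariski_tangent gauss_base y v ->
        U^@y *m vec_mx v = 0).

Lemma gauss_family_free :
  generic gauss_base (fun b => row_free (map_mx (meval (b 0)) (U *m generic_mx))).
Proof.
have irrB := points_irreducible gauss_base.
have [FB] := function_field_exists irrB.
have kerE p : ff FB p = 0 <-> ffeval gp p = 0 by rewrite ff_ker; exact: gen.
have e : \rank (map_mx (ffeval gp) (U *m generic_mx)) = r.+1.
  by rewrite map_mxM /= generic_mx_gauss mxrankMfree ?row_free_gauss // (eqP freeU).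
apply: generic_imp (rank_spec FB (U *m generic_mx)) => b _.
by rewrite -(rank_map_mx_eq kerE) [\rank (map_mx (ffeval gp) _)]e /row_free => ->.
Qed.

(* The ruling over the tangent space [T] is the set of [w] in [T] such that [w] is
   mapped to [T] by all first-order deformations of [T] in the Gauss image. *)
Definition gauss_family : family N gauss_base := Family gauss_family_free.
Local Notation X' := gauss_family.
Local Notation phi := (family_map X').

Lemma ruling_gauss_family b : ruling X' b = U^@b *m vec_mx b.
Proof. by rewrite /ruling /= map_mxM generic_mx_spec. Qed.

Lemma gauss_family_dim : has_dim (total (X:=X')) d.
Proof.
have := has_dim_prod r.+1 (points_irreducible gauss_base) (has_dim_generic_point gen).
by rewrite [(\rank _ + _)%N]addnC rE.
Qed.

Lemma kernel_coords : exists s, colsub f x = s *m map_mx (ffeval gp) U.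
Proof. by apply/submxP; rewrite kerU; apply/sub_kermxP/u_hstack. Qed.

(** In [x = u G] write [u = s U]; the point [(gp, s)] maps to [x]. It satisfies the equations of the
    total space and its closure has the same dimension, so it is generic. *)
Lemma total_generic : exists2 zeta : 'rV[F]_(q + r.+1),
  generic_point (total (X:=X')) zeta & map_mx (ffeval zeta) phi = x.
Proof.
have [s sE] := kernel_coords; pose zeta := row_mx gp s.
have zl p : ffeval zeta (poly_comp (left_coords K q r.+1) p) = ffeval gp p.
  rewrite -[poly_comp _ p]/(mmap _ _ p) -ffeval_comp; congr (ffeval _ p).
  by apply/rowP => j; rewrite [LHS]mxE [left_coords _ _ _ 0 j]mxE ffevalX row_mxEl.
have phix : map_mx (ffeval zeta) phi = x.
  rewrite [RHS](x_gauss eulerx fU) sE -mulmxA map_mxM.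
  have -> : map_mx (ffeval zeta) (right_coords K q r.+1) = s.
    by apply/rowP => j; rewrite [LHS]mxE [right_coords _ _ _ 0 j]mxE ffevalX row_mxEr.
  congr (s *m _); rewrite -[in RHS]generic_mx_gauss -map_mxM.
  rewrite -map_mx_comp; apply: eq_map_mx => p; exact: zl.
exists zeta; last exact: phix.
have irrT := total_irr X'.
have sub p : vanishes_on (total (X:=X')) p -> ffeval zeta p = 0.
  have [h h0 [psi psiE]] := common_denominator (@ff_frac _ _ _ F) zeta.
  move=> pv; apply/(ffeval_spec h0 psiE) => z Az hz; apply: pv => p' p'0.
  rewrite -spec_left -poly_compE.
  have e0 : ffeval zeta (poly_comp (left_coords K q r.+1) p') = 0 by rewrite zl.
  exact: (proj1 (ffeval_spec h0 psiE _) e0 z Az hz).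
(* [x] is polynomial in [zeta], so [jac zeta] has at least the rank of [jac x]. *)
have rkz : \rank (jac zeta) = d.
  apply/eqP; rewrite eqn_leq rank_leq_row /= -[X in (X <= _)%N](mxrank_unit fU).
  rewrite (leq_trans (rank_mxsub _ _ _)) // -[in X in (X <= _)%N]phix jac_ffeval.
  exact: mxrankM_maxl.
have dimz := has_dim_generic_point (point_closure_generic zeta); rewrite rkz in dimz.
move=> p; split=> [/sub //|p0]; apply: (equal_dim_vanishes irrT _ gauss_family_dim (proj1 dimz)).
  by move=> p' /sub p'0; apply/point_closure_generic.
exact/point_closure_generic.
Qed.

Variables (zeta : 'rV[F]_(q + r.+1)).
Hypotheses (zgen : generic_point (total (X:=X')) zeta) (zx : map_mx (ffeval zeta) phi = x).

Lemma rank_jac_x : \rank (jac x) = d.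
Proof.
apply/eqP; rewrite eqn_leq rank_leq_row /= -[X in (X <= _)%N](mxrank_unit fU).
exact: rank_mxsub.
Qed.

(** The derivative of [U G] is [dU G + U dG], and its second term vanishes along [v]. *)
Lemma gauss_dframe b v (s : 'rV_r.+1) : U^@b *m vec_mx v = 0 ->
  (s *m dframe X' b v <= vec_mx b)%MS.
Proof.
move=> Uv.
have -> : dframe X' b v = (\sum_i v 0 i *: (map_mx (mderiv i) U)^@b) *m vec_mx b + U^@b *m vec_mx v.
  apply/matrixP => a c.
  have mulE (R : comNzRingType) k1 k2 k3 (M : 'M[R]_(k1, k2)) (M' : 'M_(k2, k3)) i j :
    (M *m M') i j = \sum_e M i e * M' e j by rewrite mxE.
  have -> : dframe X' b v a c = \sum_i \sum_e
      v 0 i * (mderiv i (U a e * generic_mx e c)).@[b 0].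
    rewrite summxE; apply: eq_bigr => i _; rewrite -mulr_sumr -!raddf_sum -mulE.
    by rewrite mxE [X in _ * X]mxE [X in _ * meval _ X]mxE.
  rewrite [RHS]mxE !mulE.
  rewrite exchange_big -big_split; apply: eq_bigr => e _ /=.
  rewrite summxE mulr_suml.
  have -> : (U^@b) a e * vec_mx v e c = \sum_i v 0 i * ((U^@b) a e * (mderiv i (generic_mx e c)).@[b 0]).
    rewrite (bigD1 (mxvec_index e c)) //= big1 ?addr0 => [|i ne].
      by rewrite !mxE mderivXU eqxx meval1 mulr1 mulrC.
    by rewrite !mxE mderivXU (negbTE ne) meval0 !mulr0.
  rewrite -big_split; apply: eq_bigr => i _ /=.
  rewrite mderivM mevalD !mevalM !mxE mevalXU; ring.
by rewrite Uv addr0 mulmxA submxMl.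
Qed.

(** Along a general ruling all tangent spaces lie in the row space of [vec_mx b], of rank at most
    [d]; for general [s] they have dimension [d], so they all equal it. *)
Lemma gauss_family_stationary : stationary X'.
Proof.
have irrT := total_irr X'; have [FT] := function_field_exists irrT.
have kerE p : ff FT p = 0 <-> ffeval zeta p = 0 by rewrite ff_ker; exact: zgen.
have rk : \rank (map_mx (ff FT) (fftan FT *m jacobian phi)) = d.
  have zJ : map_mx (ffeval zeta) (jacobian phi) =
      \matrix_(j, k) ffeval zeta (mderiv j (phi 0 k)).
    by apply/matrixP => i j; rewrite !mxE.
  rewrite -(rank_map_mx_eq kerE) map_mxM; apply: etrans rank_jac_x.
  rewrite -[in RHS]zx jac_ffeval -zJ.
  by rewrite (eqmxMr _ (generic_point_tangent FT zgen)).
have gT := generic_and irrT (generic_tangent FT irrT)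
  (generic_and irrT (rank_spec FT (fftan FT *m jacobian phi)) (generic_left r.+1 tanU)).
move/generic_prod: gT; apply: generic_imp => b Bb gs.
exists (fun w => (w <= vec_mx b)%MS); apply: generic_imp gs => s _ [[_ VT] [rks Ub]] w.
rewrite (embedded_tangent_frame w Bb VT) -map_mxM.
rewrite row_mxKl in Ub.
set E := _^@_ in rks *; rewrite rk in rks.
have sE : (E <= vec_mx b)%MS.
  apply/row_subP => i; have := row_sub i E; rewrite {2}/E map_mxM.
  rewrite -(embedded_tangent_frame _ Bb VT) => -[v [t [vt ->]]].
  by rewrite addmx_sub ?gauss_dframe ?Ub // ruling_gauss_family mulmxA submxMl.
have /eqmxP -> // : (E == vec_mx b)%MS.
by rewrite -(geq_leqif (mxrank_leqif_eq sE)) rks rank_leq_row.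
Qed.

End WithKernel.
End ReducedFamily.

(** * The theorem *)

Lemma last_subst_map (R S T : comNzRingType) (f : {rmorphism R -> S}) (g : {rmorphism S -> T})
    (h : {rmorphism R -> T}) d (tau : 'rV[S]_d) c Q : (forall a, g (f a) = h a) ->
  g (last_subst f tau c Q) = last_subst h (map_mx g tau) (g c) Q.
Proof.
move=> gf; pose g1 : {rmorphism {mpoly R[d.+1]} -> T} := (g \o
  mmap f (fun i => oapp (tau 0) c (unlift ord_max i)))%FUN.
pose g2 : {rmorphism {mpoly R[d.+1]} -> T} :=
  mmap h (fun i => oapp ((map_mx g tau) 0) (g c) (unlift ord_max i)).
apply: (@eq_rmorph_mpoly _ _ _ g1 g2) => [a|i] /=; first by rewrite !mmapC gf.
by rewrite !mmap_mpolyX; case: unliftP => [j|] _ //=; rewrite mxE.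
Qed.

Lemma finite_box (K : eqType) (x0 : K) q (rs : 'I_q -> seq K) : exists L : seq ('rV[K]_q),
  forall b : 'rV[K]_q, (forall i, b 0 i \in rs i) -> b \in L.
Proof.
pose M := \max_i size (rs i).
exists [seq \row_i nth x0 (rs i) (g i) | g : {ffun 'I_q -> 'I_M.+1}] => b brs.
apply/codomP; exists [ffun i => inord (index (b 0 i) (rs i))].
apply/rowP => i; rewrite mxE ffunE inordK ?nth_index //.
by rewrite ltnS (leq_trans (index_size _ _)) // (leq_bigmax i).
Qed.

Lemma closed_roots (K : numClosedFieldType) (P : {poly K}) : P != 0 ->
  exists rs : seq K, forall y, P.[y] = 0 -> y \in rs.
Proof.
move=> P0; have [rs PE] := closed_field_poly_normal P; exists rs => y.
rewrite PE hornerZ => /eqP; rewrite mulf_eq0 lead_coef_eq0 (negbTE P0) /=.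
by rewrite -[_ == 0]/(root _ _) root_prod_XsubC.
Qed.

(** * Finiteness of the general fibre *)

Section Finiteness.
Variables (K : numClosedFieldType) (N q : nat) (B : variety K q) (X : family N B).
Variables (m : nat) (A : 'rV[K]_m -> Prop) (F : function_field A).
Local Notation k := (rdim X).+1.
Local Notation d := (ffdim F).
Local Notation phi := (family_map X).
Variable zeta : 'rV[F]_(q + k).
Hypothesis zgen : generic_point (total (X:=X)) zeta.
Variable f : 'I_d -> 'I_N.+1.
Hypothesis fU : colsub f (jac (map_mx (ffeval zeta) phi)) \in unitmx.

Let u := map_mx (ffeval zeta) (colsub f phi).

(** The coordinates [f] of the image are a transcendence basis of [F], so each coordinate of the
    base is algebraic over them; it remains so on the fibre through a general point. *)
Lemma fibre_coordinate (i : 'I_q) : exists2 h, ~ vanishes_on (total (X:=X)) h &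
  forall z, total (X:=X) z -> h.@[z 0] != 0 ->
  exists2 P : {poly K}, P != 0 & forall z', total (X:=X) z' ->
    phi^@z' = phi^@z -> P.[lsubmx z' 0 i] = 0.
Proof.
have indep P : ffeval u P = 0 -> P = 0.
  move: P; apply/jac_full_indep; rewrite -[RHS](mxrank_unit fU); congr (\rank _).
  by apply/matrixP => a b; rewrite !mxE.
pose eta : 'rV[F]_d.+1 := \row_l oapp (u 0) (zeta 0 (lshift k i)) (unlift ord_max l).
(* There are only [d] basic derivations, so the [d + 1] entries of [eta] satisfy a relation. *)
have [Q Qn0 Qeta] : exists2 Q, Q != 0 & ffeval eta Q = 0.
  apply: contrapT => H; have : \rank (jac eta) = d.+1.
    apply/jac_full_indep => Q Q0; apply: contrapT => /eqP Qn0.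
    by apply: H; exists Q.
  by have := rank_leq_row (jac eta) => + e; rewrite e ltnn.
have Q0 : last_subst (ffC F) u (zeta 0 (lshift k i)) Q = 0.
  rewrite -[RHS]Qeta; apply: eq_bigr => mm _; congr (_ * _).
  by apply: mmap1_eq => l; rewrite mxE.
(* Where [H c%:MP] is nonzero, the specialized equation in the last variable is nontrivial, since it
   is nonzero at [c]. *)
have [c cQ] := indep_specialize_last indep Qn0.
pose PC := @mpolyC (q + k) K; pose H (y : {mpoly K[q + k]}) := last_subst PC (colsub f phi) y Q.
have evH y : ffeval zeta (H y) = last_subst (ffC F) u (ffeval zeta y) Q.
  by apply: last_subst_map => a; exact: ffevalC.
have mH (z : 'rV[K]_(q + k)) y : meval (z 0) (H y) = last_subst idfun ((colsub f phi)^@z) (y.@[z 0]) Q.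
  by apply: last_subst_map => a; exact: mevalC.
exists (H c%:MP).
  by move/zgen/eqP; rewrite evH ffevalC (negbTE cQ).
move=> z Az; rewrite mH mevalC => Hz.
pose P := last_subst (@polyC K) (map_mx (@polyC K) ((colsub f phi)^@z)) 'X Q.
have PE y : P.[y] = last_subst idfun ((colsub f phi)^@z) y Q.
  have -> : P.[y] = last_subst idfun (map_mx (horner_eval y)
      (map_mx (@polyC K) ((colsub f phi)^@z))) (horner_eval y 'X) Q.
    exact: (@last_subst_map _ _ _ (@polyC K) (horner_eval y) idfun) (@hornerC _ ^~ y).
  congr (last_subst _ _ _ _); last exact: hornerX.
  by apply/rowP => l; rewrite !mxE; exact: hornerC.
exists P; first by apply: contraNneq Hz => P0; rewrite -PE P0 horner0.
move=> z' Az' phiz; rewrite PE.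
have : vanishes_on (total (X:=X)) (H 'X_(lshift k i)).
  by apply/zgen; rewrite evH ffevalX.
move/(_ z' Az'); rewrite mH mevalXU => e; rewrite -[RHS]e.
congr (last_subst _ _ _ _); last by rewrite mxE.
by rewrite !map_mxsub phiz.
Qed.

Lemma generic_fibre_finite : generically_finite X.
Proof.
have irrT := total_irr X.
have [h hP] := choice (fun i => let: ex_intro2 h nh hP := fibre_coordinate i in
  ex_intro _ h (conj nh hP)).
exists (\prod_i h i).
  elim/big_rec: _ => [|i p _ IH]; last first.
    by move/(zirreducible_prime irrT) => [|//]; case: (hP i).
  by rewrite -mpolyC1 => /(vanishes_onC (proj1 irrT))/eqP; rewrite oner_eq0.
move=> z Az; rewrite rmorph_prod => /prodf_neq0 hz.
have rts i : exists rs : seq K, forall z', total (X:=X) z' ->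
    phi^@z' = phi^@z -> lsubmx z' 0 i \in rs.
  have [P P0 Pz] := proj2 (hP i) z Az (hz i isT); have [rs rsP] := closed_roots P0.
  by exists rs => z' Az' e; apply/rsP/Pz.
have [rs rsP] := choice rts; have [L LP] := finite_box 0 rs.
(* Rescaling [s'] turns equality of projective points into equality of vectors. *)
exists L => b' s' Bb' _ _ [c c0 e]; apply: LP => i.
have := rsP i (row_mx b' (c^-1 *: s')); rewrite /total row_mxKl; apply=> //.
by rewrite !family_map_spec row_mxKl row_mxKr -scalemxAl e scalerA mulVf // scale1r.
Qed.

End Finiteness.

Lemma has_dim_nonempty (K : fieldType) m (A : 'rV[K]_m -> Prop) d :
  has_dim A d -> exists x, A x.
Proof.
case=> -[t ti] _; apply: contrapT => nA.
have /eqP : (1 : {mpoly K[d]}) = 0 by apply: ti => x Ax; case: nA; exists x.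
by rewrite oner_eq0.
Qed.

(** The conclusion concerns a ruling of the same variety by [(n - g)]-planes, large enough for the
    kernel argument; a scroll already ruled by planes of this dimension is kept. *)
Theorem theorem35 (R : realType) (N : nat) (X : scroll R[i] N) (n g : nat) :
  stationary X -> scroll_dim X n -> gauss_dim X g -> (g * (g + 1) <= n)%N ->
  exists X' : scroll R[i] N,
    [/\ gauss_ruling X n g X',
        ((rdim X + g = n)%N -> X' = X)
      & inflated_cone X' \/ inflated_tangent_scroll X'].
Proof.
move=> statX dimX [n' [dimX' dimG]] gn.
have n'E : n' = n by have := has_dim_unique dimX' dimX => -[].
subst n'; rewrite mulnDr muln1 in gn.
have gle : (g <= n)%N := leq_trans (leq_addl _ _) gn; have irrB := points_irreducible (base X).
(* With rulings of dimension [n - g] the base has dimension [g], and [X] serves as [X']. *)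
have [rk|rk] := eqVneq (rdim X + g)%N n.
  exists X; split=> //; apply: (stationary_inflated (g := g) statX); last first.
    by rewrite ltnS -(leq_add2r g) rk.
  have [FB] := function_field_exists irrB; have dimB := has_dim_ff FB.
  have := has_dim_unique dimX (has_dim_prod (rdim X).+1 irrB dimB).
  by rewrite -rk addnS addnC => /eqP; rewrite eqSS eqn_add2r => /eqP ->.
have [F] := function_field_exists (total_irr X).
have nE : ffdim F = n.+1 := has_dim_unique (has_dim_ff F) dimX.
have dimGF : has_dim (gauss_cone_rank X (t := ffdim F)) g.+1 by rewrite nE.
have freex := row_free_jac_family (has_dim_nonempty dimGF).
have [f _ fU] := row_free_colsub freex.
have rkG := gauss_rank freex fU dimGF.
have euler := family_map_euler F.
have rE : ((n - g).+1 + \rank (jac (gauss_point (map_mx (ff F) (family_map X)) f)) = ffdim F)%N.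
  by rewrite rkG nE; lia.
have [U [freeU kerU tanU]] := kernel_frame euler fU rE.
have [zeta zgen zx] := total_generic euler fU rE freeU kerU.
have stat' := gauss_family_stationary tanU zgen zx.
have fin' : generically_finite (gauss_family fU freeU).
  by apply: (generic_fibre_finite zgen (f := f)); rewrite zx.
exists (Scroll fin'); split.
- split=> //=; last by lia.
  apply: zclosure_congr => p.
  rewrite (image_cone_vanishes _ zgen) zx.
  rewrite (image_cone_vanishes p (@ffX_generic_point _ _ _ F)).
  rewrite [X in ffeval X _ = 0 <-> _](_ : _ = map_mx (ff F) (family_map X)) //.
  by apply/matrixP => i j; rewrite !mxE -ffX_eval.
- by move=> e; rewrite e eqxx in rk.
apply: (stationary_inflated (g := g) stat'); last first.
  (* The inequality [g * g < n - g + 1] is the bound on [g], read as [g + g * g <= n]. *)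
  by rewrite /= ltnS leq_subRL // addnC.
rewrite -rkG; exact: has_dim_generic_point (point_closure_generic _).
Qed.
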